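(* Let $d\ge2$ be even, let $\kappa\in\mathbb R\setminus\{0\}$, let $\tau_1,\ldots,\tau_d>0$, and suppose that $\kappa\ge-\min(\tau_1^2,\ldots,\tau_d^2)$. Then the Riemannian volume of $P=\operatorname{conv}(0,e_1/\tau_1,\ldots,e_d/\tau_d)$ (where $e_1,\ldots,e_d$ is the standard basis of $\mathbb R^d$) is $$\operatorname{Vol}_{d,\kappa}(P)=\frac{\omega_{d+1}}{\kappa^{d/2}}\left[\frac1{2^{d+1}}+\frac{\mathrm i}{2\pi}\int_0^\infty e^{-(\kappa+\tau_1^2+\cdots+\tau_d^2)y^2/2}\,\frac1y\left(\prod_{j=1}^d\Phi(\mathrm i\tau_jy)-\prod_{j=1}^d\Phi(-\mathrm i\tau_jy)\right)dy\right],$$ where $\omega_{d+1}=\frac{2\pi^{(d+1)/2}}{\Gamma((d+1)/2)}$.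
   Context: $\mathbb B^d(\kappa):=\mathbb R^d$ if $\kappa\ge0$ and $\mathbb B^d(\kappa):=\{x\in\mathbb R^d:\|x\|<1/\sqrt{-\kappa}\}$ if $\kappa<0$ (Klein model of the space of constant curvature $\kappa$); $\bar{\mathbb B}^d(\kappa)$ is its Euclidean closure. The condition on $\kappa$ is equivalent to $P\subseteq\bar{\mathbb B}^d(\kappa)$. The Riemannian volume of a Borel set $B\subseteq\bar{\mathbb B}^d(\kappa)$ is $$\operatorname{Vol}_{d,\kappa}(B)=\int_{B\cap\mathbb B^d(\kappa)}\frac{dy_1\cdots dy_d}{(1+\kappa\|y\|^2)^{(d+1)/2}}\in[0,+\infty].$$ $\Phi$ is the entire function $\Phi(z)=\frac12+\frac1{\sqrt{2\pi}}\int_0^z e^{-t^2/2}\,dt$, $z\in\mathbb C$, and $\mathrm i=\sqrt{-1}$. *)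

(* Defs.v *)
From HB Require Import structures.
From mathcomp Require Import all_boot all_order all_algebra complex.
From mathcomp Require Import all_classical all_reals all_analysis.

Set Implicit Arguments.
Unset Strict Implicit.
Unset Printing Implicit Defensive.

Import Order.TTheory GRing.Theory Num.Theory.
Import numFieldNormedType.Exports.

Local Open Scope classical_set_scope.
Local Open Scope ring_scope.
Local Open Scope complex_scope.

(** Lebesgue measure on R^n. It is carried by [n.-tuple R], whose
    sigma-algebra in the library is the product (Borel) one, and is built by
    iterating the product with the one-dimensional Lebesgue measure. *)

Section cons_measure.
Context (R : realType) (n : nat).

Definition tuple_cons (p : measurableTypeR R * n.-tuple R) : n.+1.-tuple R :=
  [tuple of p.1 :: p.2].

Lemma measurable_tuple_cons : measurable_fun setT tuple_cons.
Proof.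
exact: (@measurable_cons _ _ _ R fst n snd measurable_fst measurable_snd).
Qed.

Lemma tuple_cons_head_behead (t : n.+1.-tuple R) :
  tuple_cons (thead t, [tuple of behead t]) = t.
Proof. by rewrite [RHS]tuple_eta; exact: val_inj. Qed.

Variable m : {sigma_finite_measure set (n.-tuple R) -> \bar R}.

Definition cons_measure : set (n.+1.-tuple R) -> \bar R :=
  pushforward (@lebesgue_measure R \x m)%E tuple_cons.

Let cons_measure0 : cons_measure set0 = 0%E.
Proof. by rewrite /cons_measure /pushforward preimage_set0 measure0. Qed.

Let cons_measure_ge0 A : (0 <= cons_measure A)%E.
Proof. by rewrite /cons_measure /pushforward; apply: measure_ge0. Qed.

Let cons_measure_sigma_additive : semi_sigma_additive cons_measure.
Proof.
move=> F mF tF mUF; rewrite /cons_measure /pushforward preimage_bigcup.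
apply: measure_semi_sigma_additive.
- by move=> k; rewrite -[X in measurable X]setTI; exact: measurable_tuple_cons.
- apply/trivIsetP => /= i j _ _ ij; rewrite -preimage_setI.
  by move/trivIsetP : tF => /(_ _ _ _ _ ij) ->//; rewrite preimage_set0.
- rewrite -preimage_bigcup -[X in measurable X]setTI.
  exact: measurable_tuple_cons.
Qed.

HB.instance Definition _ := isMeasure.Build _ _ _ cons_measure
  cons_measure0 cons_measure_ge0 cons_measure_sigma_additive.

Lemma cons_measureX (A : set R) (B : set (n.-tuple R)) :
  measurable A -> measurable B ->
  cons_measure [set t | A (thead t) /\ B [tuple of behead t]] =
  (lebesgue_measure A * m B)%E.
Proof.
move=> mA mB; rewrite -product_measure1E//; congr (product_measure1 _ _ _).
apply/seteqP; split=> -[x t]; rewrite /preimage/= theadE.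
  by case=> Ax Bt; split=> //=; have -> : t = [tuple of behead (x :: t)] by exact: val_inj.
by case=> /= Ax Bt; split=> //; have <- : t = [tuple of behead (x :: t)] by exact: val_inj.
Qed.

Let cons_measure_sigma_finite : sigma_finite setT cons_measure.
Proof.
have /sigma_finiteP[F [TF ndF Foo]] := sigma_finiteT (@lebesgue_measure R).
have /sigma_finiteP[G [TG ndG Goo]] := sigma_finiteT m.
exists (fun k => [set t | F k (thead t) /\ G k [tuple of behead t]]).
  apply/seteqP; split=> // t _.
  have [i _ Fi] : (\bigcup_i F i) (thead t) by rewrite -TF.
  have [j _ Gj] : (\bigcup_i G i) [tuple of behead t] by rewrite -TG.
  exists (maxn i j) => //; split.
  - by move: Fi; exact/subsetPset/ndF/leq_maxl.
  - by move: Gj; exact/subsetPset/ndG/leq_maxr.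
move=> k; have [mF Foo'] := Foo k; have [mG Goo'] := Goo k; split.
- apply: measurableI; rewrite -[X in measurable X]setTI.
  + exact: (measurable_tnth (ord0 : 'I_n.+1)).
  + exact: measurable_behead.
- by rewrite cons_measureX// lte_mul_pinfty// ge0_fin_numE.
Qed.

HB.instance Definition _ := Measure_isSigmaFinite.Build _ _ _ cons_measure
  cons_measure_sigma_finite.

End cons_measure.

Fixpoint lebesgue_tuple (R : realType) (n : nat) :
    {sigma_finite_measure set (n.-tuple R) -> \bar R} :=
  if n is k.+1 then cons_measure (lebesgue_tuple R k)
  else \d_ ([tuple] : 0.-tuple R).

Lemma lebesgue_tuple_box (R : realType) (n : nat) (A : 'I_n -> set R) :
  (forall i, measurable (A i)) ->
  lebesgue_tuple R n [set t | forall i, A i (tnth t i)] =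
  (\prod_(i < n) lebesgue_measure (A i))%E.
Proof.
elim: n A => [|n IHn] A mA.
  by rewrite big_ord0 /= diracE mem_set// => -[].
rewrite big_ord_recl -IHn//= -cons_measureX//; last first.
  have -> : [set t : n.-tuple R | forall i, A (lift ord0 i) (tnth t i)] =
      \bigcap_(i in [set: 'I_n]) ((@tnth _ R)^~ i @^-1` A (lift ord0 i)).
    by apply/seteqP; split=> t /= At i; [move=> _; exact: At|exact: (At i I)].
  apply: fin_bigcap_measurable => // i _.
  by rewrite -[X in measurable X]setTI; exact: measurable_tnth.
congr (cons_measure _ _); apply/seteqP; split=> t /=.
  move=> At; split=> [|i]; first exact: At.
  by have := At (lift ord0 i); rewrite {1}[t]tuple_eta tnthS.
by case=> A0 At i; have [j ->|->//] := unliftP ord0 i; rewrite [t]tuple_eta tnthS.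
Qed.

(** Complex exponential, and Lebesgue integration of complex-valued functions
    of one real variable. *)

Section complex_analysis.
Context {R : realType}.
Implicit Types (D : set R) (f : R -> R[i]) (z : R[i]).

Definition cexp z : R[i] :=
  (expR (complex.Re z))%:C * (cos (complex.Im z) +i* sin (complex.Im z)).

Definition cintegrable D f : Prop :=
  (@lebesgue_measure R).-integrable D (fun x => (complex.Re (f x))%:E) /\
  (@lebesgue_measure R).-integrable D (fun x => (complex.Im (f x))%:E).

Definition cintegral D f : R[i] :=
  (\int[@lebesgue_measure R]_(x in D) complex.Re (f x)) +i*
  (\int[@lebesgue_measure R]_(x in D) complex.Im (f x)).

(** [\int_0^z f(t) dt] along the segment [t = s z], [0 <= s <= 1]; for entire
    [f] every path from [0] to [z] gives the same value. *)
Definition segment_integral (f : R[i] -> R[i]) z : R[i] :=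
  cintegral `[0, 1] (fun s => f (s%:C * z) * z).

Definition Phi z : R[i] :=
  2^-1 + (Num.sqrt (2 * pi))^-1%:C *
         segment_integral (fun t => cexp (- (t ^+ 2 / 2))) z.

End complex_analysis.

Definition Gamma {R : realType} (x : R) : R :=
  \int[@lebesgue_measure R]_(t in `]0, +oo[) (t `^ (x - 1) * expR (- t)).

(** Surface area of the unit sphere in R^n. *)
Definition omega {R : realType} (n : nat) : R :=
  2 * pi `^ (n%:R / 2) / Gamma (n%:R / 2).

Section klein_model.
Context {R : realType} {d : nat}.
Implicit Types (kappa : R) (x : 'rV[R]_d) (A B : set 'rV[R]_d).

(** Not [`|x|], which is the sup norm on matrices. *)
Definition enorm x : R := Num.sqrt (\sum_(j < d) x ord0 j ^+ 2).

Definition klein_ball kappa : set 'rV[R]_d :=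
  if 0 <= kappa then setT else [set x | enorm x < 1 / Num.sqrt (- kappa)].

Definition riemannian_vol kappa B : \bar R :=
  (\int[lebesgue_tuple R d]_(t in [set t | (B `&` klein_ball kappa)
                                             (\row_j tnth t j)])
     (((1 + kappa * enorm (\row_j tnth t j) ^+ 2) `^ (d.+1%:R / 2))^-1)%:E)%E.

Definition conv_hull A : set 'rV[R]_d :=
  [set x | exists (n : nat) (w : 'I_n -> R) (p : 'I_n -> 'rV[R]_d),
     [/\ forall i, 0 <= w i, \sum_(i < n) w i = 1, forall i, A (p i) &
         x = \sum_(i < n) w i *: p i]].

Definition orthosimplex (tau : 'I_d -> R) : set 'rV[R]_d :=
  conv_hull ([set 0] `|` range (fun j => (tau j)^-1 *: delta_mx ord0 j)).

End klein_model.

(* Main.v *)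
Require Import Defs.
From mathcomp Require Import all_boot all_order all_algebra complex.
From mathcomp Require Import all_classical all_reals all_analysis.
From mathcomp Require Import measurable_realfun ring lra.

Set Implicit Arguments.
Unset Strict Implicit.
Unset Printing Implicit Defensive.

Import Order.TTheory GRing.Theory Num.Theory.
Import numFieldNormedType.Exports.

Local Open Scope classical_set_scope.
Local Open Scope ring_scope.
Local Open Scope complex_scope.

(** The volume is first turned into a Gaussian integral. Writing the density
    [(1 + kappa |y|^2)^(-(d+1)/2)] as a Gamma integral and rescaling [y] gives,
    up to the constant [2^(-(d-1)/2) / Gamma ((d+1)/2)],
    [A (kappa) = int_(s > 0) int_(t in orthant)
       exp (- kappa |t|^2 / 2 - (s + tau . t)^2 / 2) dt ds]
    ([cone_mass], [Gamma_open_simplex]).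

    For [kappa = 1] replace the Gaussian of [s + tau . t] by its Fourier integral.
    The integral over the orthant then factors into the half-line transforms
    [J (tau_j y)], [J (y) = int_0^oo exp (- x^2 / 2 + i y x) dx], and
    [J (y) = sqrt (2 pi) exp (- y^2 / 2) Phi (i y)] ([cone_section_fourier],
    [Phi_gtransform]). Integrating [exp (i s y)] over [s > 0] produces half a Dirac
    mass at [y = 0], which is the term [1 / 2^(d+1)], and a principal value of
    [1 / y], which is the integral in the formula ([cone_mass1]). A dilation gives
    all [kappa > 0].

    For [kappa < 0] the Fourier computation diverges, and the formula is reached by
    analytic continuation in [kappa]. Here [d] even is essential: the imaginary part
    of [\prod_j J (tau_j y)] is a sum of products in which an odd number of the [d]
    factors is replaced by its imaginary part, so at least one factor is a real
    part, which decays like [exp (- tau_j^2 y^2 / 2)]. The integrand is therefore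
    [O (1 / (1 + y^2))] as long as [kappa >= - tau_j^2] for all [j]
    ([Im_prodG_even_bound]); moreover [kappa^(d/2)] is a polynomial. Expanding
    [exp (x w)] in Laplace transforms of positive measures shows that
    [kappa^(d/2) A (kappa)] and the right-hand side are power series in
    [x = 1 - kappa] that converge absolutely up to the curvature of interest, the
    endpoint included; they agree for [0 < kappa < 1], hence everywhere
    ([laplace_power_series], [power_series_identity], [cone_mass_continuation]).

    The continuation needs [A (kappa)] to be finite. Above the critical curvature
    [- min tau_j^2] this holds because the density is bounded on the simplex. At the
    critical curvature, where vertices are ideal, the formula for larger curvatures
    bounds [A] uniformly and monotone convergence concludes
    ([cone_mass_ideal_lty]). *)


(** * Fubini on rectangles and dilations of the half-line *)

Section fubini_domains.
Local Open Scope ereal_scope.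
Context d1 d2 (T1 : measurableType d1) (T2 : measurableType d2) (R : realType).
Variables (m1 : {sigma_finite_measure set T1 -> \bar R})
  (m2 : {sigma_finite_measure set T2 -> \bar R}).
Variables (D1 : set T1) (D2 : set T2).
Hypotheses (mD1 : measurable D1) (mD2 : measurable D2).
Variable f : T1 * T2 -> \bar R.
Hypothesis mf : measurable_fun (D1 `*` D2) f.

Let g := f \_ (D1 `*` D2).

Let mD12 : measurable (D1 `*` D2). Proof. exact: measurableX. Qed.

Let mg : measurable_fun setT g.
Proof. exact/(measurable_restrictT f mD12). Qed.

Let slice2 (h : \bar R -> \bar R) : h 0 = 0 -> forall x,
  \int[m2]_y h (g (x, y)) = ((fun x => \int[m2]_(y in D2) h (f (x, y))) \_ D1) x.
Proof.
move=> h0 x; rewrite patchE; case: ifPn => [xD1|xD1].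
  rewrite [RHS]integral_mkcond; apply: eq_integral => y _.
  by rewrite /g !patchE in_setX xD1/=; case: ifPn.
by apply: integral0_eq => y _; rewrite /g patchE in_setX (negbTE xD1).
Qed.

Let slice1 (h : \bar R -> \bar R) : h 0 = 0 -> forall y,
  \int[m1]_x h (g (x, y)) = ((fun y => \int[m1]_(x in D1) h (f (x, y))) \_ D2) y.
Proof.
move=> h0 y; rewrite patchE; case: ifPn => [yD2|yD2].
  rewrite [RHS]integral_mkcond; apply: eq_integral => x _.
  by rewrite /g !patchE in_setX yD2 andbT; case: ifPn.
by apply: integral0_eq => x _; rewrite /g patchE in_setX (negbTE yD2) andbF.
Qed.

Lemma integral_prod_dom : (forall z, (D1 `*` D2) z -> 0 <= f z) ->
  \int[m1 \x m2]_(z in D1 `*` D2) f z =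
  \int[m1]_(x in D1) \int[m2]_(y in D2) f (x, y).
Proof.
move=> f0; have g0 z : 0 <= g z.
  by rewrite /g patchE; case: ifPn => // /[!inE] Dz; exact: f0.
rewrite integral_mkcond (@fubini_tonelli1 _ _ _ _ _ m1 m2 g mg g0) /fubini_F.
by under eq_integral do rewrite (@slice2 id)//; rewrite -integral_mkcond.
Qed.

Lemma fubini_tonelli_dom : (forall z, (D1 `*` D2) z -> 0 <= f z) ->
  \int[m1]_(x in D1) \int[m2]_(y in D2) f (x, y) =
  \int[m2]_(y in D2) \int[m1]_(x in D1) f (x, y).
Proof.
move=> f0; have g0 z : 0 <= g z.
  by rewrite /g patchE; case: ifPn => // /[!inE] Dz; exact: f0.
have := @fubini_tonelli _ _ _ _ _ m1 m2 g mg g0.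
under eq_integral do rewrite (@slice2 id)//.
under [in RHS]eq_integral do rewrite (@slice1 id)//.
by rewrite -!integral_mkcond.
Qed.

Lemma measurable_integral_dom : (forall z, (D1 `*` D2) z -> 0 <= f z) ->
  measurable_fun D1 (fun x => \int[m2]_(y in D2) f (x, y)).
Proof.
move=> f0; have g0 z : 0 <= g z.
  by rewrite /g patchE; case: ifPn => // /[!inE] Dz; exact: f0.
have := @measurable_fun_fubini_tonelli_F _ _ _ _ _ m2 g mg g0.
rewrite /fubini_F; under eq_fun do rewrite (@slice2 id)//.
by move/(measurable_restrictT _ mD1).
Qed.

Lemma Fubini_dom :
  \int[m1]_(x in D1) \int[m2]_(y in D2) `|f (x, y)| < +oo ->
  \int[m1]_(x in D1) \int[m2]_(y in D2) f (x, y) =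
  \int[m2]_(y in D2) \int[m1]_(x in D1) f (x, y).
Proof.
move=> foo.
have ig : (m1 \x m2).-integrable setT g.
  apply/integrable12ltyP => //.
  under eq_integral do rewrite (@slice2 abse) ?abse0//.
  by rewrite -integral_mkcond.
have := Fubini ig.
under eq_integral do rewrite (@slice2 id)//.
under [in RHS]eq_integral do rewrite (@slice1 id)//.
by rewrite -!integral_mkcond.
Qed.

End fubini_domains.

Section half_line.
Context {R : realType}.
Notation mu := (@lebesgue_measure R).
Notation pos := (`]0, +oo[%classic : set R).

Let scalem (c : R) (x : measurableTypeR R) : measurableTypeR R := c * x.

Let mscalem c : measurable_fun setT (scalem c).
Proof. exact: measurable_funM. Qed.


Let dilation c : {measure set (measurableTypeR R) -> \bar R} :=
  measure_function_pushforward__canonical__measure_function_Measure mu (mscalem c).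

(** Two measures that agree on half-open intervals are equal. *)
Lemma lebesgue_measure_dilation (c : R) (c0 : 0 < c) (A : set R) : measurable A ->
  mu A = mscale (NngNum (ltW c0)) (dilation c) A.
Proof.
move=> mA; apply: (@lebesgue_measure_unique R
  (mscale (NngNum (ltW c0)) (dilation c))) => //.
move=> X [[a b] _ <-{X}] /=.
rewrite /mscale/= /dilation/= /pushforward.
have -> : scalem c @^-1` `]a, b] = `](c^-1 * a), (c^-1 * b)]%classic.
  apply/seteqP; split => x /=; rewrite !in_itv/= /scalem => /andP[ax xb];
  by rewrite ?ltr_pdivrMl ?ler_pdivlMl// in ax xb *; apply/andP; split.
rewrite !lebesgue_measure_itv/= !lte_fin ltr_pM2l ?invr_gt0//.
case: ifPn => _; last by rewrite mule0.
by rewrite -!EFinD -EFinM -mulrBr mulrA divff ?gt_eqF// mul1r.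
Qed.

Lemma integral_dilation (c : R) (f : R -> \bar R) : 0 < c ->
  measurable_fun pos f -> (forall x, 0 < x -> (0 <= f x)%E) ->
  (\int[mu]_(x in pos) f x = c%:E * \int[mu]_(x in pos) f (c * x)%R)%E.
Proof.
move=> c0 mf f0.
have f0' x : pos x -> (0 <= f x)%E by rewrite /= in_itv/= andbT; exact: f0.
rewrite (eq_measure_integral (mscale (NngNum (ltW c0)) (dilation c))); last first.
  by move=> A mA _; exact: lebesgue_measure_dilation.
rewrite ge0_integral_mscale//.
rewrite (ge0_integral_pushforward (mscalem c))//; last by move=> y /[!inE]; exact: f0'.
congr (_ * integral _ _ _)%E.
by apply/seteqP; split => x /=; rewrite /scalem !in_itv/= !andbT pmulr_rgt0.
Qed.

End half_line.

(** * Iterated integrals over the positive orthant *)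

Section orthant.
Context {R : realType}.
Notation mu := (@lebesgue_measure R).
Notation pos := (`]0, +oo[%classic : set R).

Definition orthant n : set (n.-tuple R) := [set t | forall i, 0 < tnth t i].

Lemma measurable_tuple_forall n (A : 'I_n -> set R) :
  (forall i, measurable (A i)) ->
  measurable [set t : n.-tuple R | forall i, A i (tnth t i)].
Proof.
move=> mA.
have -> : [set t : n.-tuple R | forall i, A i (tnth t i)] =
    \bigcap_(i in [set: 'I_n]) ((@tnth _ R)^~ i @^-1` A i).
  by apply/seteqP; split=> t /= At i; [move=> _; exact: At|exact: (At i I)].
apply: fin_bigcap_measurable => // i _.
by rewrite -[X in measurable X]setTI; exact: measurable_tnth.
Qed.

Lemma orthantE n : @orthant n = [set t | forall i, pos (tnth t i)].
Proof.
by apply/seteqP; split=> t /= t0 i; have := t0 i; rewrite in_itv/= andbT.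
Qed.

Lemma measurable_orthant n : measurable (@orthant n).
Proof.
rewrite orthantE; apply: (@measurable_tuple_forall n (fun=> pos)) => i.
exact: measurable_itv.
Qed.

Lemma orthant_cons n x (t : n.-tuple R) :
  orthant (tuple_cons (x, t)) <-> 0 < x /\ orthant t.
Proof.
split=> [xt|[x0 t0] i].
  split=> [|i]; first exact: (xt ord0).
  by have := xt (lift ord0 i); rewrite tnthS.
by have [j ->|->//] := unliftP ord0 i; rewrite tnthS.
Qed.

(** The measure on tuples is the image of a product under [tuple_cons], so
    Tonelli peels off the first coordinate; inductions on the dimension rest on
    this step. *)
Lemma integral_orthantS n (f : n.+1.-tuple R -> \bar R) :
  measurable_fun (@orthant n.+1) f ->
  (forall t, orthant t -> (0 <= f t)%E) ->
  (\int[lebesgue_tuple R n.+1]_(t in @orthant n.+1) f t =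
   \int[mu]_(x in pos) \int[lebesgue_tuple R n]_(t in @orthant n)
     f (tuple_cons (x, t)))%E.
Proof.
move=> mf f0.
pose m := measure_function_pushforward__canonical__measure_function_Measure
  (mu \x lebesgue_tuple R n)%E (@measurable_tuple_cons R n).
rewrite (eq_measure_integral m)//=.
have mo := @measurable_orthant n.+1.
rewrite (ge0_integral_pushforward (@measurable_tuple_cons R n))//; last first.
  by move=> t /[!inE]; exact: f0.
have -> : @tuple_cons R n @^-1` @orthant n.+1 = pos `*` @orthant n.
  by apply/seteqP; split=> -[x t] /=; rewrite orthant_cons in_itv/= andbT.
rewrite integral_prod_dom//.
- exact: measurable_orthant.
- apply: (measurable_comp mo) => //.
    by move=> _ [[x t] [/= + t0] <-]; rewrite in_itv/= andbT => x0; exact/orthant_cons.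
  apply: measurable_funTS; exact: measurable_tuple_cons.
- by move=> [x t] [/= + t0]; rewrite in_itv/= andbT => x0; apply/f0/orthant_cons.
Qed.

Definition scale_tuple n (c : R) (t : n.-tuple R) : n.-tuple R :=
  [tuple c * tnth t i | i < n].

Lemma measurable_scale_tuple n c : measurable_fun setT (@scale_tuple n c).
Proof.
apply/measurable_fun_tnthP => i; rewrite /comp/=.
under eq_fun do rewrite tnth_mktuple.
by apply: measurable_funM => //; exact: measurable_tnth.
Qed.

Lemma orthant_scale n c (t : n.-tuple R) : 0 < c ->
  orthant t -> orthant (scale_tuple c t).
Proof. by move=> c0 t0 i; rewrite tnth_mktuple mulr_gt0. Qed.

Lemma measurable_comp_tuple_cons n (f : n.+1.-tuple R -> \bar R) :
  measurable_fun (@orthant n.+1) f ->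
  measurable_fun (pos `*` @orthant n) (f \o (@tuple_cons R n)).
Proof.
move=> mf; apply: (measurable_comp (@measurable_orthant n.+1)) => //.
  by move=> _ [[x t] [/= + t0] <-]; rewrite in_itv/= andbT => x0; exact/orthant_cons.
by apply: measurable_funTS; exact: measurable_tuple_cons.
Qed.

(** One factor [c] per coordinate, by induction on the dimension. Stated for
    merely measurable integrands: it is applied to indicators of simplices. *)
Lemma integral_orthant_dilation n (c : R) (f : n.-tuple R -> \bar R) : 0 < c ->
  measurable_fun (@orthant n) f -> (forall t, orthant t -> (0 <= f t)%E) ->
  (\int[lebesgue_tuple R n]_(t in @orthant n) f t =
   (c ^+ n)%:E * \int[lebesgue_tuple R n]_(t in @orthant n) f (scale_tuple c t))%E.
Proof.
move=> c0; elim: n f => [|n IHn] f mf f0.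
  rewrite expr0 mul1e; apply: eq_integral => t _; congr f.
  by apply: eq_from_tnth => -[].
have mc : measurable_fun (@orthant n.+1) (f \o scale_tuple c).
  apply: (measurable_comp (@measurable_orthant n.+1)) => //.
    by move=> _ [t /= t0 <-]; exact: orthant_scale.
  by apply: measurable_funTS; exact: measurable_scale_tuple.
rewrite !integral_orthantS//; last by move=> t t0; exact/f0/orthant_scale.
have mfc := measurable_comp_tuple_cons mf.
have f0' (z : R * n.-tuple R) : (pos `*` @orthant n) z -> (0 <= (f \o (@tuple_cons R n)) z)%E.
  by case: z => [x t] /= [+ t0]; rewrite in_itv/= andbT => x0; apply/f0/orthant_cons.
have mS x : 0 < x -> measurable_fun (@orthant n) (fun t => f (tuple_cons (x, t))).
  move=> x0; apply: (measurable_comp (@measurable_orthant n.+1)) => //.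
    by move=> _ [t /= t0 <-]; exact/orthant_cons.
  apply: measurable_funTS.
  by apply: (@measurableT_comp _ _ _ _ _ _ (@tuple_cons R n)) => //;
    exact: measurable_tuple_cons.
rewrite (@integral_dilation R c)//; last 2 first.
  apply: (@measurable_integral_dom _ _ _ _ _ _ _ _ _ _ (f \o (@tuple_cons R n))) => //.
    exact: measurable_orthant.
  by move=> x x0; apply: integral_ge0 => t t0; exact/f0/orthant_cons.
rewrite exprS EFinM -muleA; congr (_ * _)%E.
rewrite -ge0_integralZl//.
- apply: eq_integral => x /[!inE]/=; rewrite in_itv/= andbT => x0.
  have cx0 : 0 < c * x by rewrite mulr_gt0.
  rewrite IHn//; [|exact: mS|by move=> t t0; exact/f0/orthant_cons].
  congr (_ * _)%E; apply: eq_integral => t _; congr f.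
  apply: eq_from_tnth => i; rewrite tnth_mktuple.
  have [j ->|->//] := unliftP ord0 i.
  by rewrite !tnthS tnth_mktuple.
- apply: (@measurable_integral_dom _ _ _ _ _ _ _ _ _ _
    ((f \o scale_tuple c) \o (@tuple_cons R n))) => //.
  + exact: measurable_orthant.
  + exact: measurable_comp_tuple_cons.
  + case=> x t /= [+ t0]; rewrite in_itv/= andbT => x0.
    by apply/f0/orthant_scale => //; exact/orthant_cons.
- move=> x /=; rewrite in_itv/= andbT => x0; apply: integral_ge0 => t t0.
  by apply/f0/orthant_scale => //; exact/orthant_cons.
- by rewrite lee_fin exprn_ge0// ltW.
Qed.

End orthant.

(** * Calculus on the half-line *)

Section derivatives.
Context {R : realType}.
Implicit Types (f g : R -> R) (x : R).

Lemma is_derive_mul f g x df dg : is_derive x 1 f df -> is_derive x 1 g dg ->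
  is_derive x 1 (fun y => f y * g y) (df * g x + f x * dg).
Proof.
move=> hf hg; have := @is_deriveM R _ f g x 1 df dg hf hg.
by rewrite addrC /GRing.scale/= (mulrC df).
Qed.

Lemma is_derive_expR_comp f x df : is_derive x 1 f df ->
  is_derive x 1 (fun y => expR (f y)) (df * expR (f x)).
Proof.
by move=> hf; rewrite mulrC; apply: (@is_derive1_comp R expR f x (expR (f x)) df).
Qed.

Lemma is_derive_sin_comp f x df : is_derive x 1 f df ->
  is_derive x 1 (fun y => sin (f y)) (df * cos (f x)).
Proof.
by move=> hf; rewrite mulrC; apply: (@is_derive1_comp R sin f x (cos (f x)) df).
Qed.

Lemma is_derive_cos_comp f x df : is_derive x 1 f df ->
  is_derive x 1 (fun y => cos (f y)) (- df * sin (f x)).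
Proof.
move=> hf; rewrite mulNr -mulrN mulrC.
by apply: (@is_derive1_comp R cos f x (- sin (f x)) df).
Qed.

Lemma is_derive_mulc (a : R) x : is_derive x 1 (fun y => a * y) a.
Proof.
have := @is_deriveZ R _ _ (@idfun R) a x 1 1 (is_derive_id _ _).
by rewrite /GRing.scale/= mulr1.
Qed.

Lemma is_derive_half_sqr x : is_derive x 1 (fun y : R => y ^+ 2 / 2) x.
Proof.
have h := is_derive_mul (is_derive_mul (is_derive_id x (1:R)) (is_derive_id x (1:R)))
  (is_derive_cst (2^-1 : R) x 1).
rewrite (_ : (fun y => _) = (fun y => y * y * 2^-1)); last first.
  by apply/funext => y; rewrite expr2.
by apply: is_derive_eq h _ => /=; field.
Qed.

Lemma is_derive_continuous f x df : is_derive x 1 f df -> {for x, continuous f}.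
Proof. by case=> df1 _; apply: differentiable_continuous; exact/derivable1_diffP. Qed.

End derivatives.

Section half_line_calculus.
Context {R : realType}.
Notation mu := (@lebesgue_measure R).
Notation pos := (`]0, +oo[%classic : set R).

Lemma measurable_pos : measurable (pos : set (measurableTypeR R)).
Proof. exact: measurable_itv. Qed.

Lemma integral_segment_is_derive (f F : R -> R) (a b : R) : a < b ->
  {within `[a, b], continuous f} ->
  (forall x : R, is_derive x 1 F (f x)) ->
  (\int[mu]_(x in `[a, b]) (f x)%:E = (F b - F a)%:E)%E.
Proof.
move=> ab cf dF; have cF (x : R) : {for x, continuous F}.
  exact: is_derive_continuous (dF x).
rewrite (@continuous_FTC2 R f F)//.
- split => [x _||].
  + by case: (dF x).
  + by apply: cvg_at_right_filter; exact: cF.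
  + by apply: cvg_at_left_filter; exact: cF.
- by move=> x _; rewrite derive1E; have [_ ->] := dF x.
Qed.

(** The integrand may change sign, so the half-line is exhausted by segments
    and dominated convergence replaces monotone convergence. *)
Lemma Rintegral_half_line_is_derive (f F : R -> R) (l : R) :
  continuous f -> mu.-integrable pos (EFin \o f) ->
  (forall x : R, is_derive x 1 F (f x)) -> F x @[x --> +oo] --> l ->
  (\int[mu]_(x in pos) f x = l - F 0)%R.
Proof.
move=> cf intf dF Fl.
have mfT : measurable_fun setT f by exact: continuous_measurable_fun.
suff : (\int[mu]_(x in pos) (f x)%:E = (l - F 0)%:E)%E.
  by rewrite /Rintegral => ->.
pose f_ (n : nat) := (EFin \o f) \_ `[0, n.+1%:R].
have h1 : (\int[mu]_(x in pos) f_ n x)%E @[n --> \oo] -->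
    (\int[mu]_(x in pos) (f x)%:E)%E.
  apply: (@dominated_cvg _ _ _ mu pos _ f_ _ (fun x => `|(f x)%:E|%E)) => //.
  - by move=> n; apply/measurable_restrict => //; apply: measurable_funTS; exact/measurable_EFinP.
  - move=> x; rewrite /= in_itv/= andbT => x0.
    apply: cvg_near_cst; near=> n; rewrite /f_ patchE mem_set//= in_itv/= ltW//=.
    have : (Num.truncn x <= n)%N by near: n; exact: nbhs_infty_ge.
    move=> xn; apply/ltW/(lt_le_trans (truncnS_gt _)).
    by rewrite ler_nat ltnS.
  - exact: integrable_abse.
  - move=> n x _; rewrite /f_ patchE; case: ifPn => // _.
    by rewrite abse0.
have h2 : (\int[mu]_(x in pos) f_ n x)%E @[n --> \oo] --> (l - F 0)%:E.
  rewrite (_ : (fun n => _) = (fun n : nat => (F n.+1%:R - F 0)%:E)); last first.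
    apply/funext => n.
    rewrite /f_ -integral_mkcondr -(@integral_segment_is_derive f)//; last first.
      by apply: continuous_subspaceT.
    rewrite -integral_itv_obnd_cbnd; last exact/measurable_EFinP/measurable_funTS.
    congr (integral _ _ _); apply/seteqP; split=> x /=; rewrite !in_itv/= andbT.
      by move=> [-> /andP[]].
    by move=> /andP[x0 ->]; rewrite x0 ltW.
  apply: cvg_EFin; first exact: nearW.
  apply: cvgB; last exact: cvg_cst.
  apply/((cvg_pinftyP F l).1 Fl)/cvgryPge => A; near=> n.
have An : (Num.truncn A <= n)%N by near: n; exact: nbhs_infty_ge.
by apply/ltW/(lt_le_trans (truncnS_gt _)); rewrite ler_nat ltnS.
by apply: cvg_unique h1 h2.
Unshelve. all: end_near. Qed.

End half_line_calculus.

(** * Cosine and sine transforms of the half-Gaussian *)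

Section half_gaussian.
Context {R : realType}.
Notation mu := (@lebesgue_measure R).
Notation pos := (`]0, +oo[%classic : set R).

Definition hgauss (x : R) : R := expR (- (x ^+ 2 / 2)).

Lemma hgauss_ge0 x : 0 <= hgauss x. Proof. exact: expR_ge0. Qed.

Lemma hgauss0 : hgauss 0 = 1.
Proof. by rewrite /hgauss expr0n mul0r oppr0 expR0. Qed.

Lemma hgauss_le1 x : hgauss x <= 1.
Proof. by rewrite -expR0 ler_expR oppr_le0 divr_ge0// sqr_ge0. Qed.

Lemma is_derive_hgauss (x : R) : is_derive x 1 hgauss (- x * hgauss x).
Proof.
apply: is_derive_expR_comp.
by apply: is_derive_eq (is_deriveN (is_derive_half_sqr x)) _.
Qed.

Lemma continuous_hgauss : continuous hgauss.
Proof. by move=> x; exact: is_derive_continuous (is_derive_hgauss x). Qed.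

Lemma measurable_hgauss : measurable_fun setT hgauss.
Proof. by apply: continuous_measurable_fun; exact: continuous_hgauss. Qed.

Lemma cvg_hgauss : hgauss x @[x --> +oo] --> (0 : R).
Proof.
apply: (cvg_comp (fun x : R => x ^+ 2 / 2) (fun x => expR (- x))).
  have h2 : (0 : R) < 2^-1 by rewrite invr_gt0.
  by apply: (gt0_cvgMly h2); exact: cvgr_expr2.
exact: cvgr_expR.
Qed.

Lemma integral_hgauss :
  (\int[mu]_(x in pos) (hgauss x)%:E = (Num.sqrt (pi / 2))%:E)%E.
Proof.
have s2 : 0 < Num.sqrt (2 : R) by rewrite sqrtr_gt0.
rewrite (@integral_dilation R (Num.sqrt 2) (EFin \o hgauss))//; last 2 first.
- by apply/measurable_EFinP/measurable_funTS; exact: measurable_hgauss.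
- by move=> x _; rewrite lee_fin hgauss_ge0.
transitivity ((Num.sqrt 2)%:E * \int[mu]_(x in pos) (gauss_fun x)%:E)%E.
  congr (_ * _)%E; apply: eq_integral => x _; rewrite /= /hgauss /gauss_fun exprMn sqr_sqrtr//.
  by congr (expR _)%:E; field.
rewrite integral_itv_obnd_cbnd; last first.
  by apply/measurable_EFinP/measurable_funTS; exact: measurable_gauss_fun.
rewrite integral0y_gauss -EFinM; congr EFin.
rewrite sqrtrM ?pi_ge0// sqrtrV//.
rewrite mulrCA; congr (_ * _).
apply: (mulIf (lt0r_neq0 s2)).
rewrite mulVf ?lt0r_neq0// mulrAC -expr2 sqr_sqrtr//.
by rewrite divff.
Qed.

Lemma integrable_hgauss : mu.-integrable pos (EFin \o hgauss).
Proof.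
apply/integrableP; split.
  by apply/measurable_EFinP/measurable_funTS; exact: measurable_hgauss.
under eq_integral do rewrite /= ger0_norm ?hgauss_ge0//.
by rewrite integral_hgauss ltry.
Qed.

Lemma integrable_mul_hgauss : mu.-integrable pos (fun x => (`|x| * hgauss x)%:E).
Proof.
have m : measurable_fun setT (fun x : R => x * hgauss x).
  by apply: measurable_funM => //; exact: measurable_hgauss.
have e : (\int[mu]_(x in pos) (x * hgauss x)%:E = 1)%E.
  rewrite integral_itv_obnd_cbnd; last exact/measurable_EFinP/measurable_funTS.
  rewrite (@ge0_continuous_FTC2y R _ (fun x => - hgauss x) 0 0).
  - by rewrite hgauss0 sub0e EFinN oppeK.
  - by move=> x x0; rewrite mulr_ge0// hgauss_ge0.
  - apply: continuous_subspaceT => x.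
    by apply: cvgM; [exact: cvg_id|exact: continuous_hgauss].
  - by rewrite -oppr0; apply: cvgN; exact: cvg_hgauss.
  - by move=> x _; have [] := is_deriveN (is_derive_hgauss x).
  - apply: cvgN; apply: cvg_at_right_filter; exact: continuous_hgauss.
  - move=> x _; rewrite derive1E; have [_ ->] := is_deriveN (is_derive_hgauss x).
    by rewrite mulNr opprK.
apply/integrableP; split.
  apply/measurable_EFinP/measurable_funTS.
  by apply: measurable_funM; [exact: normr_measurable|exact: measurable_hgauss].
rewrite [ltLHS](_ : _ = 1%E) ?ltry// -e; apply: eq_integral => x /[!inE]/=.
rewrite in_itv/= andbT => x0.
by rewrite ger0_norm ?mulr_ge0 ?hgauss_ge0// gtr0_norm.
Qed.

Lemma integrable_bounded_mul (D : set R) (g h : R -> R) (M : R) : measurable D ->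
  mu.-integrable D (EFin \o g) -> measurable_fun D h ->
  (forall x, D x -> `|h x| <= M) -> mu.-integrable D (fun x => (g x * h x)%:E).
Proof.
move=> mD ig mh hM; have /integrableP[/measurable_EFinP mg _] := ig.
have iM : mu.-integrable D (fun x => (M%:E * (EFin \o g) x)%E) by exact: integrableZl.
apply: le_integrable iM => //.
  by apply/measurable_EFinP/measurable_funM.
move=> x Dx /=; rewrite lee_fin !normrM mulrC ler_wpM2r//.
by apply: (le_trans (hM _ Dx)); exact: ler_norm.
Qed.

(** Real part of the half-line Fourier transform of the Gaussian. *)
Definition cosg (y : R) : R := \int[mu]_(x in pos) (hgauss x * cos (y * x)).
(** Imaginary part of the same transform; unlike the real part it decays only
    like [1 / y], and it equals [sqrt 2] times Dawson's function of [y / sqrt 2]. *)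
Definition sing (y : R) : R := \int[mu]_(x in pos) (hgauss x * sin (y * x)).

Lemma continuous_hgauss_cos (y : R) : continuous (fun x => hgauss x * cos (y * x)).
Proof.
move=> x; apply: (is_derive_continuous (is_derive_mul (is_derive_hgauss x)
  (is_derive_cos_comp (is_derive_mulc y x)))).
Qed.

Lemma continuous_hgauss_sin (y : R) : continuous (fun x => hgauss x * sin (y * x)).
Proof.
move=> x; apply: (is_derive_continuous (is_derive_mul (is_derive_hgauss x)
  (is_derive_sin_comp (is_derive_mulc y x)))).
Qed.

Lemma measurable_cos_mul (y : R) : measurable_fun setT (fun x : R => cos (y * x)).
Proof.
apply: continuous_measurable_fun => x.
exact: (is_derive_continuous (is_derive_cos_comp (is_derive_mulc y x))).
Qed.

Lemma measurable_sin_mul (y : R) : measurable_fun setT (fun x : R => sin (y * x)).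
Proof.
apply: continuous_measurable_fun => x.
exact: (is_derive_continuous (is_derive_sin_comp (is_derive_mulc y x))).
Qed.

Lemma integrable_hgauss_cos (y : R) :
  mu.-integrable pos (fun x => (hgauss x * cos (y * x))%:E).
Proof.
apply: (@integrable_bounded_mul _ _ _ 1) => //; first exact: integrable_hgauss.
  by apply: measurable_funTS; exact: measurable_cos_mul.
by move=> x _; rewrite ler_norml cos_geN1 cos_le1.
Qed.

Lemma integrable_hgauss_sin (y : R) :
  mu.-integrable pos (fun x => (hgauss x * sin (y * x))%:E).
Proof.
apply: (@integrable_bounded_mul _ _ _ 1) => //; first exact: integrable_hgauss.
  by apply: measurable_funTS; exact: measurable_sin_mul.
by move=> x _; rewrite ler_norml sin_geN1 sin_le1.
Qed.

Let integrable_x_trig (h : R -> R) : measurable_fun setT h ->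
  (forall x, `|h x| <= 1) ->
  mu.-integrable pos (fun x => (x * hgauss x * h x)%:E).
Proof.
move=> mh h1.
apply: le_integrable integrable_mul_hgauss => //.
  apply/measurable_EFinP/measurable_funTS/measurable_funM => //.
  by apply: measurable_funM => //; exact: measurable_hgauss.
move=> x _ /=; rewrite lee_fin !normrM normr_id.
by rewrite -[leRHS]mulr1 ler_wpM2l// mulr_ge0.
Qed.

(** Integration by parts against the antiderivative [- hgauss] of
    [x * hgauss x]; with its cosine analogue it turns differentiation under the
    integral into a linear differential equation for the transform. *)
Lemma integral_x_hgauss_sin (y : R) :
  \int[mu]_(x in pos) (x * hgauss x * sin (y * x)) = y * cosg y.
Proof.
have i1 : mu.-integrable pos (fun x => (x * hgauss x * sin (y * x))%:E).
  apply: integrable_x_trig; first exact: measurable_sin_mul.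
  by move=> x; rewrite ler_norml sin_geN1 sin_le1.
have i2 : mu.-integrable pos (fun x => (y * (hgauss x * cos (y * x)))%:E).
  by have := integrableZl (@measurable_pos R) y (integrable_hgauss_cos y).
have := @Rintegral_half_line_is_derive R
  (fun x => x * hgauss x * sin (y * x) - y * (hgauss x * cos (y * x)))
  (fun x => - (hgauss x * sin (y * x))) 0.
rewrite mulr0 sin0 mulr0 oppr0 subr0 RintegralB// RintegralZl//; last exact: integrable_hgauss_cos.
move=> H; apply/eqP; rewrite -subr_eq0; apply/eqP; apply: H.
- move=> x; apply: cvgB.
    apply: cvgM.
      by apply: cvgM; [exact: cvg_id|exact: continuous_hgauss].
    exact: (is_derive_continuous (is_derive_sin_comp (is_derive_mulc y x))).
  by apply: cvgMl_tmp; exact: continuous_hgauss_cos.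
- exact: (integrableB (@measurable_pos R) i1 i2).
- move=> x; apply: is_derive_eq (is_deriveN (is_derive_mul (is_derive_hgauss x)
    (is_derive_sin_comp (is_derive_mulc y x)))) _; ring.
- apply/norm_cvg0P.
  apply: (@squeeze_cvgr _ _ _ _ (cst 0) hgauss).
  + near=> x; rewrite normr_ge0/= normrN normrM ger0_norm ?hgauss_ge0//.
    by rewrite -[leRHS]mulr1 ler_wpM2l ?hgauss_ge0// ler_norml sin_geN1 sin_le1.
  + exact: cvg_cst.
  + exact: cvg_hgauss.
Unshelve. all: end_near. Qed.

(** The constant [1] is the boundary term at [0], where the cosine does not
    vanish. *)
Lemma integral_x_hgauss_cos (y : R) :
  \int[mu]_(x in pos) (x * hgauss x * cos (y * x)) = 1 - y * sing y.
Proof.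
have i1 : mu.-integrable pos (fun x => (x * hgauss x * cos (y * x))%:E).
  apply: integrable_x_trig; first exact: measurable_cos_mul.
  by move=> x; rewrite ler_norml cos_geN1 cos_le1.
have i2 : mu.-integrable pos (fun x => (y * (hgauss x * sin (y * x)))%:E).
  by have := integrableZl (@measurable_pos R) y (integrable_hgauss_sin y).
have := @Rintegral_half_line_is_derive R
  (fun x => x * hgauss x * cos (y * x) + y * (hgauss x * sin (y * x)))
  (fun x => - (hgauss x * cos (y * x))) 0.
rewrite mulr0 cos0 mulr1 hgauss0 opprK add0r RintegralD// RintegralZl//; last first.
  exact: integrable_hgauss_sin.
move=> H; apply/eqP; rewrite eq_sym subr_eq eq_sym; apply/eqP; apply: H.
- move=> x; apply: cvgD.
    apply: cvgM.
      by apply: cvgM; [exact: cvg_id|exact: continuous_hgauss].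
    exact: (is_derive_continuous (is_derive_cos_comp (is_derive_mulc y x))).
  by apply: cvgMl_tmp; exact: continuous_hgauss_sin.
- exact: (integrableD (@measurable_pos R) i1 i2).
- move=> x; apply: is_derive_eq (is_deriveN (is_derive_mul (is_derive_hgauss x)
    (is_derive_cos_comp (is_derive_mulc y x)))) _; ring.
- apply/norm_cvg0P.
  apply: (@squeeze_cvgr _ _ _ _ (cst 0) hgauss).
  + near=> x; rewrite normr_ge0/= normrN normrM ger0_norm ?hgauss_ge0//.
    by rewrite -[leRHS]mulr1 ler_wpM2l ?hgauss_ge0// ler_norml cos_geN1 cos_le1.
  + exact: cvg_cst.
  + exact: cvg_hgauss.
Unshelve. all: end_near. Qed.

Lemma is_derive_cosg (y : R) : is_derive y 1 cosg (- y * cosg y).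
Proof.
pose f (y x : R) := hgauss x * cos (y * x).
have df (a x : R) : is_derive a 1 (f ^~ x) (- (x * hgauss x * sin (a * x))).
  have h : is_derive a 1 (fun y => y * x) x.
    by under eq_fun do rewrite mulrC; exact: is_derive_mulc.
  apply: is_derive_eq (is_derive_mul (is_derive_cst (hgauss x) a 1)
    (is_derive_cos_comp h)) _; rewrite /cst; ring.
have dd a x : derivable (f ^~ x) a 1 by case: (df a x).
have d1 a x : partial1of2 f a x = - (x * hgauss x * sin (a * x)).
  by rewrite partial1of2E; have [_ ->] := df a x.
have Ia : `]y - 1, y + 1[%classic y by rewrite /= in_itv/= ltrBlDr ltrDl ltr01.
have ub a x : `|partial1of2 f a x| <= `|x| * hgauss x.
  rewrite d1 normrN !normrM (ger0_norm (hgauss_ge0 _)).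
  by rewrite -[leRHS]mulr1 ler_wpM2l ?mulr_ge0 ?hgauss_ge0// ler_norml sin_geN1 sin_le1.
have G0 x : 0 <= `|x| * hgauss x by rewrite mulr_ge0 ?hgauss_ge0.
split.
  exact: (@derivable_under_integral R _ _ mu f pos (@measurable_pos R) y _ _ Ia
   (fun a _ => integrable_hgauss_cos a) (fun a x _ _ => dd a x)
   _ G0 integrable_mul_hgauss (fun a x _ _ => ub a x)).
rewrite -derive1E (@differentiation_under_integral R _ _ mu f pos (@measurable_pos R) y _ _ Ia
   (fun a _ => integrable_hgauss_cos a) (fun a x _ _ => dd a x)
   _ G0 integrable_mul_hgauss (fun a x _ _ => ub a x)).
rewrite mulNr -integral_x_hgauss_sin -mulN1r -RintegralZl//.
  by apply: eq_Rintegral => x _; rewrite d1 mulN1r.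
apply: integrable_x_trig; first exact: measurable_sin_mul.
by move=> x; rewrite ler_norml sin_geN1 sin_le1.
Qed.

Lemma is_derive_sing (y : R) : is_derive y 1 sing (1 - y * sing y).
Proof.
pose f (y x : R) := hgauss x * sin (y * x).
have df (a x : R) : is_derive a 1 (f ^~ x) (x * hgauss x * cos (a * x)).
  have h : is_derive a 1 (fun y => y * x) x.
    by under eq_fun do rewrite mulrC; exact: is_derive_mulc.
  apply: is_derive_eq (is_derive_mul (is_derive_cst (hgauss x) a 1)
    (is_derive_sin_comp h)) _; rewrite /cst; ring.
have dd a x : derivable (f ^~ x) a 1 by case: (df a x).
have d1 a x : partial1of2 f a x = x * hgauss x * cos (a * x).
  by rewrite partial1of2E; have [_ ->] := df a x.
have Ia : `]y - 1, y + 1[%classic y by rewrite /= in_itv/= ltrBlDr ltrDl ltr01.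
have ub a x : `|partial1of2 f a x| <= `|x| * hgauss x.
  rewrite d1 !normrM (ger0_norm (hgauss_ge0 _)).
  by rewrite -[leRHS]mulr1 ler_wpM2l ?mulr_ge0 ?hgauss_ge0// ler_norml cos_geN1 cos_le1.
have G0 x : 0 <= `|x| * hgauss x by rewrite mulr_ge0 ?hgauss_ge0.
split.
  exact: (@derivable_under_integral R _ _ mu f pos (@measurable_pos R) y _ _ Ia
   (fun a _ => integrable_hgauss_sin a) (fun a x _ _ => dd a x)
   _ G0 integrable_mul_hgauss (fun a x _ _ => ub a x)).
rewrite -derive1E (@differentiation_under_integral R _ _ mu f pos (@measurable_pos R) y _ _ Ia
   (fun a _ => integrable_hgauss_sin a) (fun a x _ _ => dd a x)
   _ G0 integrable_mul_hgauss (fun a x _ _ => ub a x)).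
rewrite -integral_x_hgauss_cos.
by apply: eq_Rintegral => x _; rewrite d1.
Qed.

End half_gaussian.

(** * Closed forms, and the function Phi on the imaginary axis *)

Section gaussian_transform.
Context {R : realType}.
Notation mu := (@lebesgue_measure R).
Implicit Types x y s : R.

(** The equation [cosg' = - y cosg] forces [cosg y * expR (y ^+ 2 / 2)] to be
    constant. *)
Lemma cosgE y : cosg y = Num.sqrt (pi / 2) * hgauss y.
Proof.
have d x : is_derive x 1 (fun x => cosg x * expR (x ^+ 2 / 2)) 0.
  apply: is_derive_eq (is_derive_mul (is_derive_cosg x)
    (is_derive_expR_comp (is_derive_half_sqr x))) _; ring.
have := is_derive_0_is_cst y 0 d.
rewrite expr0n mul0r expR0 mulr1 => h.
have -> : Num.sqrt (pi / 2) = cosg (0 : R).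
  rewrite /cosg; under eq_Rintegral do rewrite mul0r cos0 mulr1.
  by rewrite /Rintegral integral_hgauss.
by rewrite -h /hgauss expRN mulfK// gt_eqF// expR_gt0.
Qed.

(** The integrating factor of [sing' = 1 - y sing]. *)
Lemma is_derive_sing_expR y :
  is_derive y 1 (fun y => sing y * expR (y ^+ 2 / 2)) (expR (y ^+ 2 / 2)).
Proof.
apply: is_derive_eq (is_derive_mul (is_derive_sing y)
  (is_derive_expR_comp (is_derive_half_sqr y))) _; ring.
Qed.

Lemma sing0 : sing (0 : R) = 0.
Proof.
rewrite /sing; under eq_Rintegral do rewrite mul0r sin0 mulr0.
by rewrite /Rintegral integral0.
Qed.

(** The segment [[0, y]] is parametrised by [s * y], which is the shape in
    which [segment_integral] presents the integral defining [Phi]. *)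
Lemma sing_expRE y :
  \int[mu]_(s in `[0, 1]) (y * expR ((s * y) ^+ 2 / 2)) =
  sing y * expR (y ^+ 2 / 2).
Proof.
have d s : is_derive s 1 (fun s => sing (s * y) * expR ((s * y) ^+ 2 / 2))
    (y * expR ((s * y) ^+ 2 / 2)).
  have h : is_derive s 1 (fun s => s * y) y.
    by under eq_fun do rewrite mulrC; exact: is_derive_mulc.
  rewrite mulrC; exact: (@is_derive1_comp R
    (fun y => sing y * expR (y ^+ 2 / 2)) _ s _ y (is_derive_sing_expR (s * y)) h).
rewrite /Rintegral (integral_segment_is_derive _ _ d)//.
  by rewrite mul1r mul0r sing0 mul0r subr0.
apply: continuous_subspaceT => s; apply: cvgM; first exact: cvg_cst.
have h : is_derive s 1 (fun s => s * y) y.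
  by under eq_fun do rewrite mulrC; exact: is_derive_mulc.
exact: (is_derive_continuous (@is_derive1_comp R (fun y => expR (y ^+ 2 / 2)) _ s _ y
  (is_derive_expR_comp (is_derive_half_sqr (s * y))) h)).
Qed.

Lemma sing_ge0 y : 0 <= y -> 0 <= sing y.
Proof.
move=> y0; rewrite -(pmulr_lge0 _ (expR_gt0 (y ^+ 2 / 2))) -sing_expRE.
by apply: Rintegral_ge0 => s _; rewrite mulr_ge0// expR_ge0.
Qed.

(** After multiplication by [expR (y ^+ 2 / 2)] both sides vanish at [0], and the
    derivative of their difference is a square times a positive function. *)
Lemma sing_le y : 0 <= y -> sing y <= 2 * y / (1 + y ^+ 2).
Proof.
rewrite le_eqVlt => /predU1P[<-|y0].
  by rewrite sing0 mulr0 mul0r.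
have p x : 0 < 1 + x ^+ 2 by rewrite ltr_wpDr// sqr_ge0.
have dV x : is_derive x 1 (fun x : R => (1 + x ^+ 2)^-1) (- (2 * x) / (1 + x ^+ 2) ^+ 2).
  have h : is_derive x 1 (fun x : R => 1 + x ^+ 2) (2 * x).
    have -> : (fun x : R => 1 + x ^+ 2) = cst 1 + (fun x => x * x).
      by apply/funext => z; rewrite /= expr2.
    apply: is_derive_eq (is_deriveD (is_derive_cst (1 : R) x (1 : R))
      (is_derive_mul (is_derive_id x (1 : R)) (is_derive_id x (1 : R)))) _.
    by rewrite /=; ring.
  apply: is_derive_eq (is_deriveV (f := fun x : R => 1 + x ^+ 2) _ h) _.
    by rewrite gt_eqF.
  by rewrite /GRing.scale/=; field; rewrite gt_eqF.
pose H x := 2 * x * (1 + x ^+ 2)^-1 * expR (x ^+ 2 / 2) - sing x * expR (x ^+ 2 / 2).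
have dH x : is_derive x 1 H (expR (x ^+ 2 / 2) * (1 - x ^+ 2) ^+ 2 / (1 + x ^+ 2) ^+ 2).
  apply: is_derive_eq (is_deriveB (is_derive_mul (is_derive_mul (is_derive_mulc 2 x) (dV x))
    (is_derive_expR_comp (is_derive_half_sqr x))) (is_derive_sing_expR x)) _.
  by field; rewrite gt_eqF.
have cH : {within `[0, y], continuous H}.
  by apply: continuous_subspaceT => x; exact: (is_derive_continuous (dH x)).
have [c _] := @MVT R H _ 0 y y0 (fun x _ => dH x) cH.
rewrite {2}/H mulr0 !mul0r sing0 mul0r !subr0 => Hy.
rewrite -(ler_pM2r (expR_gt0 (y ^+ 2 / 2))) -subr_ge0.
rewrite -/(H y) Hy mulr_ge0 ?(ltW y0)// divr_ge0 ?sqr_ge0//.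
by rewrite mulr_ge0 ?expR_ge0 ?sqr_ge0.
Qed.

(** On the imaginary axis [t ^+ 2] is negative, so the Gaussian becomes a
    growing real exponential and the path integral is purely imaginary. *)
Lemma PhiE x : Phi (0 +i* x) =
  (2^-1 +i* ((Num.sqrt (2 * pi))^-1 * (sing x * expR (x ^+ 2 / 2)))) :> R[i].
Proof.
rewrite /Phi /segment_integral /cintegral.
have e s : cexp (- ((s%:C * (0 +i* x)) ^+ 2 / 2)) * (0 +i* x) =
    0 +i* (x * expR ((s * x) ^+ 2 / 2)).
  have -> : - ((s%:C * (0 +i* x)) ^+ 2 / 2) = ((s * x) ^+ 2 / 2)%:C :> R[i].
    have -> : s%:C * (0 +i* x) = 'i%C * (s * x)%:C by simpc; congr (_ +i* _); ring.
    rewrite exprMn sqr_i mulN1r mulNr opprK.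
    by rewrite -(rmorph_nat (real_complex R) 2) -fmorphV -rmorphXn -rmorphM.
  by rewrite /cexp/= cos0 sin0; simpc; congr (_ +i* _); ring.
under eq_Rintegral do rewrite e /=.
under [X in _ +i* X]eq_Rintegral do rewrite e /=.
rewrite sing_expRE [X in X +i* _](_ : _ = 0); last by rewrite /Rintegral integral0.
have -> : 2^-1 = 2^-1%:C :> R[i] by rewrite fmorphV (rmorph_nat (real_complex R) 2).
by simpc.
Qed.

End gaussian_transform.

(** * Products of half-line transforms *)

Section products.
Context {R : realType}.
Notation mu := (@lebesgue_measure R).
Notation pos := (`]0, +oo[%classic : set R).

(** Every monomial of the expanded product picks [complex.Re] or [complex.Im]
    in each factor, and the number of imaginary picks is odd in the imaginary
    part of the product and even in its real part. When the number of factors is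
    even, an odd number of imaginary picks leaves at least one real pick, which
    contributes the small factor [e]; this is where an even dimension matters.
    The parity alternates along the induction. *)
Lemma prod_complex_bound (m : nat) (K : R) : 0 <= K -> exists2 C : R, 0 <= C &
  forall (z : 'I_m -> R[i]) (e Q : R), 0 <= e <= 1 -> 0 <= Q <= K ->
  (forall j, `|complex.Re (z j)| <= K * e) -> (forall j, `|complex.Im (z j)| <= Q) ->
  if odd m then `|complex.Re (\prod_j z j)| <= C * e /\
                `|complex.Im (\prod_j z j)| <= C * Q
  else `|complex.Re (\prod_j z j)| <= C /\
       `|complex.Im (\prod_j z j)| <= C * (e * Q).
Proof.
move=> K0; elim: m => [|m [C C0 IH]].
  exists 1 => // z e Q /andP[e0 _] /andP[Q0 _] _ _ /=.
  by rewrite big_ord0 /= normr1 normr0 mul1r mulr_ge0.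
exists (C * (K + K ^+ 2 + 1)) => [|z e Q /andP[e0 e1] /andP[Q0 QK] zp zq].
  by rewrite mulr_ge0// addr_ge0// addr_ge0// sqr_ge0.
rewrite big_ord_recl; set w := \prod_(i < m) _.
have := IH (fun i => z (lift ord0 i)) e Q; rewrite e0 e1 Q0 QK.
move=> /(_ isT isT (fun j => zp _) (fun j => zq _)).
rewrite -/w; have := zp ord0; have := zq ord0.
case: (z ord0) => p q /=; case: w => X Y /= hq hp.
have Ke : 0 <= K * e by rewrite mulr_ge0.
have eK : K * e <= K by rewrite ler_piMr.
have eQ0 : 0 <= e * Q by rewrite mulr_ge0.
have hX : `|p * X - q * Y| <= `|p| * `|X| + `|q| * `|Y|.
  by rewrite (le_trans (ler_normB _ _))// !normrM.
have hY : `|p * Y + q * X| <= `|p| * `|Y| + `|q| * `|X|.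
  by rewrite (le_trans (ler_normD _ _))// !normrM.
case: (odd m) => /= -[X1 Y1]; split.
- apply: (le_trans hX).
  apply: (le_trans (lerD (ler_pM _ _ hp X1) (ler_pM _ _ hq Y1))) => //.
  have : K * e * (C * e) <= K * C.
    rewrite (_ : K * e * (C * e) = K * C * (e * e)); last ring.
    by rewrite ler_piMr ?mulr_ge0// mulr_ile1.
  have : Q * (C * Q) <= K ^+ 2 * C.
    rewrite (_ : Q * (C * Q) = Q ^+ 2 * C); last ring.
    by rewrite ler_wpM2r// lerXn2r// nnegrE.
  lra.
- apply: (le_trans hY).
  apply: (le_trans (lerD (ler_pM _ _ hp Y1) (ler_pM _ _ hq X1))) => //.
  rewrite (_ : K * e * (C * Q) + Q * (C * e) = C * (K + 1) * (e * Q)); last ring.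
  by rewrite ler_wpM2r// ler_wpM2l// lerD2r lerDl sqr_ge0.
- apply: (le_trans hX).
  apply: (le_trans (lerD (ler_pM _ _ hp X1) (ler_pM _ _ hq Y1))) => //.
  rewrite (_ : K * e * C + Q * (C * (e * Q)) = C * (K + Q ^+ 2) * e); last ring.
  rewrite ler_wpM2r// ler_wpM2l// -addrA lerD2l.
  by rewrite (@le_trans _ _ (K ^+ 2)) ?lerDl// lerXn2r// nnegrE.
- apply: (le_trans hY).
  apply: (le_trans (lerD (ler_pM _ _ hp Y1) (ler_pM _ _ hq X1))) => //.
  rewrite (_ : K * e * (C * (e * Q)) + Q * C = C * (K * e ^+ 2 + 1) * Q); last ring.
  rewrite ler_wpM2r// ler_wpM2l// lerD2r.
  rewrite (@le_trans _ _ K)// ?lerDl ?sqr_ge0//.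
  by rewrite ler_piMr// expr_le1.
Qed.

(** The transform [int_0^oo exp (- x ^+ 2 / 2 + i y x) dx], which is
    [sqrt (2 pi) exp (- y ^+ 2 / 2) Phi (i y)] (see [Phi_gtransform]). *)
Definition gtransform (y : R) : R[i] := cosg y +i* sing y.

Definition prodG m (tau : 'I_m -> R) (y : R) : R[i] :=
  \prod_(j < m) gtransform (tau j * y).

Lemma continuous_cosg_mul (a : R) : continuous (fun y => cosg (a * y)).
Proof.
by move=> y; exact: (is_derive_continuous (@is_derive1_comp R cosg _ y _ _
  (is_derive_cosg (a * y)) (is_derive_mulc a y))).
Qed.

Lemma continuous_sing_mul (a : R) : continuous (fun y => sing (a * y)).
Proof.
by move=> y; exact: (is_derive_continuous (@is_derive1_comp R sing _ y _ _
  (is_derive_sing (a * y)) (is_derive_mulc a y))).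
Qed.

Lemma prodGS m (tau : 'I_m.+1 -> R) y :
  prodG tau y = gtransform (tau ord0 * y) * prodG (fun j => tau (lift ord0 j)) y.
Proof. by rewrite /prodG big_ord_recl. Qed.

Lemma continuous_prodG m (tau : 'I_m -> R) :
  continuous (fun y => complex.Re (prodG tau y)) /\
  continuous (fun y => complex.Im (prodG tau y)).
Proof.
elim: m tau => [|m IHm] tau.
  by split=> y; rewrite /prodG; under eq_fun do rewrite big_ord0 /=; exact: cvg_cst.
have [cR cI] := IHm (fun j => tau (lift ord0 j)).
split=> y.
  rewrite (_ : (fun _ => _) = (fun y => cosg (tau ord0 * y) *
       complex.Re (prodG (fun j => tau (lift ord0 j)) y) - sing (tau ord0 * y) *
       complex.Im (prodG (fun j => tau (lift ord0 j)) y))); last first.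
    by apply/funext => x; rewrite prodGS /gtransform; case: (prodG _ x).
  by apply: cvgB; (apply: cvgM; [|exact: cR || exact: cI]);
    [exact: continuous_cosg_mul|exact: continuous_sing_mul].
rewrite (_ : (fun _ => _) = (fun y => cosg (tau ord0 * y) *
     complex.Im (prodG (fun j => tau (lift ord0 j)) y) + sing (tau ord0 * y) *
     complex.Re (prodG (fun j => tau (lift ord0 j)) y))); last first.
  by apply/funext => x; rewrite prodGS /gtransform; case: (prodG _ x).
by apply: cvgD; (apply: cvgM; [|exact: cR || exact: cI]);
  [exact: continuous_cosg_mul|exact: continuous_sing_mul].
Qed.

End products.

Section prodG_bounds.
Context {R : realType}.
Notation mu := (@lebesgue_measure R).
Notation pos := (`]0, +oo[%classic : set R).

Lemma oneDsqr_gt0 (y : R) : 0 < 1 + y ^+ 2.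
Proof. by rewrite ltr_wpDr// sqr_ge0. Qed.

Lemma div_oneDsqr_le1 (y : R) : y / (1 + y ^+ 2) <= 1.
Proof.
rewrite ler_pdivrMr ?oneDsqr_gt0// mul1r.
have := sqr_ge0 (y - 1); have := sqr_ge0 y; lra.
Qed.

Lemma prodG_bounded m (tau : 'I_m -> R) : (forall j, 0 < tau j) ->
  exists2 M : R, 0 <= M & forall y, 0 <= y ->
    `|complex.Re (prodG tau y)| <= M /\ `|complex.Im (prodG tau y)| <= M.
Proof.
move=> t0; pose K : R := Num.sqrt (pi / 2) + 2.
have K0 : 0 <= K by rewrite addr_ge0.
have [C C0 HC] := @prod_complex_bound R m K K0.
exists (C * (1 + K)); first by rewrite mulr_ge0// addr_ge0.
move=> y y0.
(* no decay is claimed here, so [prod_complex_bound] is used with [e = 1] *)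
have := HC (fun j => gtransform (tau j * y)) 1 K.
rewrite ler01 lexx K0 lexx => /(_ isT isT).
have hp j : `|complex.Re (gtransform (tau j * y))| <= K * 1.
  rewrite /= cosgE mulr1 ger0_norm ?mulr_ge0 ?hgauss_ge0//.
  by rewrite (@le_trans _ _ (Num.sqrt (pi / 2)))// ?lerDl// ler_piMr// hgauss_le1.
have hq j : `|complex.Im (gtransform (tau j * y))| <= K.
  have ty0 : 0 <= tau j * y by rewrite mulr_ge0// ltW.
  rewrite /= ger0_norm ?sing_ge0// (le_trans (sing_le ty0))// -mulrA.
  rewrite (@le_trans _ _ 2) ?lerDr//.
  by rewrite -[leRHS]mulr1 ler_wpM2l// div_oneDsqr_le1.
move=> /(_ hp hq); rewrite -/(prodG tau y).
have C1 : C <= C * (1 + K) by rewrite ler_peMr// lerDl.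
have CK : C * K <= C * (1 + K) by rewrite ler_wpM2l// lerDr.
case: odd => -[]; rewrite ?mulr1 ?mul1r => h1 h2; split.
- exact: le_trans C1.
- exact: le_trans CK.
- exact: le_trans C1.
- exact: le_trans CK.
Qed.

(** In even dimension the parity argument of [prod_complex_bound] yields a
    decaying factor [expR (- tau j ^+ 2 * y ^+ 2 / 2)] and a factor [sing], both
    needed to integrate up to [kappa = - tau j ^+ 2]: the first absorbs the
    growth of [expR (- kappa * y ^+ 2 / 2)], the second gives integrability at
    infinity and cancels the pole at [0]. *)
Lemma Im_prodG_even_bound m (tau : 'I_m -> R) (a : R) : ~~ odd m ->
  (forall j, 0 < tau j) -> 0 <= a -> (forall j, a <= tau j ^+ 2) ->
  exists2 C : R, 0 <= C & forall y, 0 <= y ->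
    `|complex.Im (prodG tau y)| <= C * (expR (- (a * y ^+ 2 / 2)) * (y / (1 + y ^+ 2))).
Proof.
move=> em t0 a0 at2.
(* [tau / (1 + tau ^+ 2 * y ^+ 2) <= (tau + tau^-1) / (1 + y ^+ 2)] makes the
   bounds on the factors uniform in [j] *)
pose B : R := \sum_(j < m) (2 * (tau j + (tau j)^-1)).
have Bj0 j : 0 <= 2 * (tau j + (tau j)^-1) by rewrite mulr_ge0// addr_ge0 ?invr_ge0// ltW.
have B0 : 0 <= B by exact: sumr_ge0.
have BB j : 2 * (tau j + (tau j)^-1) <= B.
  by rewrite /B (bigD1 j)//= lerDl sumr_ge0.
pose K : R := Num.sqrt (pi / 2) + B.
have K0 : 0 <= K by rewrite addr_ge0.
have [C C0 HC] := @prod_complex_bound R m K K0.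
exists (C * B); first by rewrite mulr_ge0.
move=> y y0.
have yy0 : 0 <= y / (1 + y ^+ 2) by rewrite divr_ge0// ltW// oneDsqr_gt0.
have := HC (fun j => gtransform (tau j * y)) (expR (- (a * y ^+ 2 / 2)))
  (B * (y / (1 + y ^+ 2))).
have e01 : 0 <= expR (- (a * y ^+ 2 / 2)) <= 1.
  rewrite expR_ge0/= -[leRHS]expR0 ler_expR oppr_le0.
  by rewrite divr_ge0// mulr_ge0// sqr_ge0.
have Q0K : 0 <= B * (y / (1 + y ^+ 2)) <= K.
  rewrite mulr_ge0//= (@le_trans _ _ B) ?lerDr//.
  by rewrite -[leRHS]mulr1 ler_wpM2l// div_oneDsqr_le1.
move=> /(_ e01 Q0K).
have hp j : `|complex.Re (gtransform (tau j * y))| <= K * expR (- (a * y ^+ 2 / 2)).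
  rewrite /= cosgE ger0_norm ?mulr_ge0 ?hgauss_ge0//.
  rewrite ler_pM ?hgauss_ge0// ?lerDl// ler_expR lerN2 exprMn.
  by rewrite ler_wpM2r// ler_wpM2r// sqr_ge0.
have hq j : `|complex.Im (gtransform (tau j * y))| <= B * (y / (1 + y ^+ 2)).
  have ty0 : 0 <= tau j * y by rewrite mulr_ge0// ltW.
  rewrite /= ger0_norm ?sing_ge0// (le_trans (sing_le ty0))//.
  rewrite (@le_trans _ _ (2 * (tau j + (tau j)^-1) * (y / (1 + y ^+ 2))))//; last first.
    by rewrite ler_wpM2r.
  rewrite ler_pdivrMr ?oneDsqr_gt0//.
  rewrite [leRHS](_ : _ =
    2 * (tau j + (tau j)^-1) * y * (1 + (tau j * y) ^+ 2) / (1 + y ^+ 2)); last by ring.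
  rewrite ler_pdivlMr ?oneDsqr_gt0//.
  rewrite -subr_ge0 (_ : _ - _ = 2 * y * (tau j ^+ 3 * y ^+ 2 + (tau j)^-1)).
    have tj0 := ltW (t0 j).
    by rewrite mulr_ge0 ?mulr_ge0// addr_ge0 ?invr_ge0// mulr_ge0// exprn_ge0.
  by field; rewrite gt_eqF.
move=> /(_ hp hq); rewrite -/(prodG tau y) (negbTE em) => -[_].
rewrite (_ : C * (_ * (B * _)) =
  C * B * (expR (- (a * y ^+ 2 / 2)) * (y / (1 + y ^+ 2))))//; ring.
Qed.

(** Up to a constant, the imaginary part of the integrand of the volume
    formula on the positive half-line (see [integrandE]). *)
Definition rho (kappa : R) m (tau : 'I_m -> R) (y : R) : R :=
  expR (- (kappa * y ^+ 2 / 2)) * (complex.Im (prodG tau y) / y).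

Lemma measurable_rho (kappa : R) m (tau : 'I_m -> R) : measurable_fun pos (rho kappa tau).
Proof.
apply: measurable_funM.
  apply: measurable_funTS; apply: measurableT_comp => //.
  apply: measurableT_comp => //; apply: measurable_funM => //.
  by apply: measurable_funM => //; exact: measurable_funX.
apply: measurable_funM.
  apply: measurable_funTS; apply: continuous_measurable_fun.
  exact: (continuous_prodG tau).2.
apply: (open_continuous_measurable_fun (interval_open _ _)) => //.
move=> x; rewrite inE/= in_itv/= andbT => x0.
by apply: inv_continuous; rewrite gt_eqF.
Qed.

Lemma integrable_oneDsqrV : mu.-integrable pos (fun y : R => (1 + y ^+ 2)^-1%:E).
Proof.
have m : measurable_fun setT (fun y : R => (1 + y ^+ 2)^-1).
  by apply: continuous_measurable_fun; exact: continuous_oneDsqrV.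
apply/integrableP; split; first exact/measurable_EFinP/measurable_funTS.
rewrite [ltLHS](_ : _ = (pi / 2)%:E) ?ltry// -integral0y_oneDsqr.
rewrite -integral_itv_obnd_cbnd; last exact/measurable_EFinP/measurable_funTS.
apply: eq_integral => x _.
by rewrite /= ger0_norm// invr_ge0 ltW// oneDsqr_gt0.
Qed.

Lemma integrable_rho (kappa : R) m (tau : 'I_m -> R) : ~~ odd m ->
  (forall j, 0 < tau j) -> (forall j, - (tau j ^+ 2) <= kappa) ->
  mu.-integrable pos (EFin \o rho kappa tau).
Proof.
move=> em t0 kt.
(* the decay rate that [Im_prodG_even_bound] must provide is the growth rate of
   [expR (- kappa * y ^+ 2 / 2)], if it grows at all *)
have a0 : 0 <= Num.max 0 (- kappa) by rewrite le_max lexx.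
have at2 j : Num.max 0 (- kappa) <= tau j ^+ 2 by rewrite ge_max sqr_ge0/= lerNl.
have [C C0 HC] := Im_prodG_even_bound em t0 a0 at2.
apply: (le_integrable (@measurable_pos R) _ _
  (integrableZl (@measurable_pos R) C integrable_oneDsqrV)) => //.
  by apply/measurable_EFinP; exact: measurable_rho.
move=> y /=; rewrite in_itv/= andbT => y0; rewrite lee_fin /rho.
rewrite normrM normrM normfV (ger0_norm (expR_ge0 _)) (gtr0_norm y0).
rewrite [leRHS]ger0_norm ?mulr_ge0 ?invr_ge0 ?(ltW (oneDsqr_gt0 _))//.
rewrite mulrA ler_pdivrMr//.
apply: (le_trans (ler_wpM2l (expR_ge0 _) (HC _ (ltW y0)))).
rewrite mulrCA -!mulrA ler_wpM2l// [leLHS]mulrA -expRD.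
rewrite [leRHS]mulrC ler_piMl ?divr_ge0 ?(ltW y0)// ?(ltW (oneDsqr_gt0 _))//.
rewrite -expR0 ler_expR -opprD oppr_le0 -mulrDl mulr_ge0 ?mulr_ge0 ?divr_ge0 ?(ltW y0)//.
by rewrite -lerBlDl sub0r le_max lexx orbT.
Qed.

End prodG_bounds.

(** * Damped Fourier integrals *)

Section fourier_tools.
Context {R : realType}.
Notation mu := (@lebesgue_measure R).
Notation pos := (`]0, +oo[%classic : set R).

(** A product majorant settles the integrability of all sections and of the
    double integral at once. *)
Lemma Fubini_product_bound (f : R * R -> R) (g h : R -> R) :
  measurable_fun setT f ->
  mu.-integrable pos (EFin \o g) -> mu.-integrable pos (EFin \o h) ->
  (forall x y, 0 < x -> 0 < y -> `|f (x, y)| <= g x * h y) ->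
  (\int[mu]_(x in pos) (\int[mu]_(y in pos) f (x, y))%:E =
   \int[mu]_(y in pos) (\int[mu]_(x in pos) f (x, y))%:E)%E.
Proof.
move=> mf ig ih fgh.
have posE (x : R) : pos x -> 0 < x by rewrite /= in_itv/= andbT.
have mfx x : measurable_fun setT (fun y => f (x, y)).
  exact: measurableT_comp.
have mfy y : measurable_fun setT (fun x => f (x, y)).
  exact: measurableT_comp.
have ifx x : pos x -> mu.-integrable pos (fun y => (f (x, y))%:E).
  move=> x0; apply: (le_integrable (@measurable_pos R) _ _
    (integrableZl (@measurable_pos R) (g x) ih)).
    by apply/measurable_EFinP/measurable_funTS; exact: mfx.
  move=> y y0; rewrite lee_fin (le_trans (fgh _ _ (posE _ x0) (posE _ y0)))//.
  exact: ler_norm.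
have ify y : pos y -> mu.-integrable pos (fun x => (f (x, y))%:E).
  move=> y0; apply: (le_integrable (@measurable_pos R) _ _
    (integrableZl (@measurable_pos R) (h y) ig)).
    by apply/measurable_EFinP/measurable_funTS; exact: mfy.
  move=> x x0; rewrite lee_fin (le_trans (fgh _ _ (posE _ x0) (posE _ y0)))//.
  by rewrite mulrC; exact: ler_norm.
transitivity (\int[mu]_(x in pos) \int[mu]_(y in pos) (f (x, y))%:E)%E.
  apply: eq_integral => x /[!inE] x0.
  by rewrite /Rintegral fineK//; apply: integrable_fin_num (ifx _ x0).
transitivity (\int[mu]_(y in pos) \int[mu]_(x in pos) (f (x, y))%:E)%E; last first.
  apply: eq_integral => y /[!inE] y0.
  by rewrite /Rintegral fineK//; apply: integrable_fin_num (ify _ y0).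
apply: (@Fubini_dom _ _ _ _ _ mu mu pos pos _ _ (EFin \o f)) => //.
  by apply/measurable_EFinP/measurable_funTS.
pose N := (\int[mu]_(y in pos) `|(h y)%:E|)%E.
have N0 : (0 <= N)%E by exact: integral_ge0.
have Nfin : N \is a fin_num.
  by rewrite ge0_fin_numE//; have /integrableP[] := ih.
apply: (@le_lt_trans _ _ (\int[mu]_(x in pos) (`|(g x)%:E| * N))%E).
  apply: ge0_le_integral => //.
  - by move=> x _; exact: integral_ge0.
  - apply: (@measurable_integral_dom _ _ _ _ _ mu pos pos _ _ (abse \o (EFin \o f))) => //.
      apply: measurableT_comp => //.
      by apply/measurable_EFinP/measurable_funTS.
    by move=> z _; exact: abse_ge0.
  - apply: (@emeasurable_funM _ (measurableTypeR R) R pos (abse \o (EFin \o g)) (cst N)) => //.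
    by apply: measurableT_comp => //; have /integrableP[] := ig.
  - move=> x /posE x0; rewrite -ge0_integralZl//; last first.
      apply: measurableT_comp => //.
      by have /integrableP[] := ih.
    apply: ge0_le_integral => //.
    + apply: measurableT_comp => //.
      by apply/measurable_EFinP/measurable_funTS; exact: mfx.
    + apply: (@emeasurable_funM _ (measurableTypeR R) R pos
        (cst `|(g x)%:E|%E) (abse \o (EFin \o h))) => //.
      by apply: measurableT_comp => //; have /integrableP[] := ih.
    + move=> y /posE y0; rewrite -abseM lee_fin (le_trans (fgh _ _ x0 y0))//.
      by rewrite ler_norm.
rewrite ge0_integralZr//; last first.
  by apply: measurableT_comp => //; have /integrableP[] := ig.
by apply: lte_mul_pinfty => //; [exact: integral_ge0|
  rewrite ge0_fin_numE ?integral_ge0//; have /integrableP[] := ig|rewrite ltey_eq Nfin].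
Qed.

Lemma integrable_dilation (c : R) (f : R -> \bar R) : 0 < c ->
  mu.-integrable pos f ->
  (\int[mu]_(x in pos) f x = c%:E * \int[mu]_(x in pos) f (c * x)%R)%E.
Proof.
move=> c0 fi; have /integrableP[mf _] := fi.
have ip := integral_dilation c0 (measurable_funepos mf) (fun x _ => funepos_ge0 f x).
have im := integral_dilation c0 (measurable_funeneg mf) (fun x _ => funeneg_ge0 f x).
have fp : (\int[mu]_(x in pos) (f^\+ x) \is a fin_num)%E.
  exact: integrable_pos_fin_num.
have fm : (\int[mu]_(x in pos) (f^\- x) \is a fin_num)%E.
  exact: integrable_neg_fin_num.
have cK (z : \bar R) : ((c^-1)%:E * (c%:E * z) = z)%E.
  by rewrite muleA -EFinM mulVf ?mul1e// gt_eqF.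
have fp' : (\int[mu]_(x in pos) (f^\+ (c * x)%R) \is a fin_num)%E.
  by rewrite -(cK (\int[mu]_(x in pos) (f^\+ (c * x)%R))%E) -ip fin_numM.
have fm' : (\int[mu]_(x in pos) (f^\- (c * x)%R) \is a fin_num)%E.
  by rewrite -(cK (\int[mu]_(x in pos) (f^\- (c * x)%R))%E) -im fin_numM.
have -> : (\int[mu]_(x in pos) f (c * x)%R =
    \int[mu]_(x in pos) (f^\+ (c * x)%R) - \int[mu]_(x in pos) (f^\- (c * x)%R))%E.
  rewrite [LHS]integralE; congr (_ - _)%E; apply: eq_integral => x _.
    by rewrite !funeposE.
  by rewrite !funenegE.
rewrite [LHS]integralE muleBr//; last exact: fin_num_adde_defr.
by congr (_ - _)%E.
Qed.

Lemma is_derive_expRN (e s : R) :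
  is_derive s 1 (fun s => expR (- (e * s))) (- e * expR (- (e * s))).
Proof. exact: (is_derive_expR_comp (is_deriveN (is_derive_mulc e s))). Qed.

Lemma cvg_expRN (e : R) : 0 < e -> expR (- (e * s)) @[s --> +oo] --> (0 : R).
Proof.
move=> e0; apply: (cvg_comp (fun x : R => e * x) (fun x => expR (- x))).
  by apply: (gt0_cvgMry e0); exact: cvg_id.
exact: cvgr_expR.
Qed.

Lemma integrable_expRN (e : R) : 0 < e ->
  mu.-integrable pos (fun s => (expR (- (e * s)))%:E).
Proof.
move=> e0.
have c : continuous (fun s => expR (- (e * s))).
  by move=> s; exact: (is_derive_continuous (is_derive_expRN e s)).
have m : measurable_fun setT (fun s : R => expR (- (e * s))).
  exact: continuous_measurable_fun.
apply/integrableP; split; first exact/measurable_EFinP/measurable_funTS.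
rewrite [ltLHS](_ : _ = (0%:E - (- e^-1 * expR (- (e * 0)))%:E)%E) ?ltry//.
rewrite -(@ge0_continuous_FTC2y R (fun s => expR (- (e * s)))
  (fun s => - e^-1 * expR (- (e * s))) 0 0).
- rewrite -integral_itv_obnd_cbnd; last exact/measurable_EFinP/measurable_funTS.
  by apply: eq_integral => x _; rewrite /= ger0_norm ?expR_ge0.
- by move=> x _; exact: expR_ge0.
- exact: continuous_subspaceT.
- by rewrite -[X in _ --> X](mulr0 (- e^-1)); apply: cvgMl_tmp; exact: cvg_expRN.
- move=> x _; have [+ _] := is_derive_mul (is_derive_cst (- e^-1) x 1) (is_derive_expRN e x).
  by [].
- apply: cvgMl_tmp; apply: cvg_at_right_filter; exact: c.
- move=> x _; rewrite derive1E.
  have [_ ->] := is_derive_mul (is_derive_cst (- e^-1) x 1) (is_derive_expRN e x).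
  by rewrite /cst mul0r add0r mulrA mulrNN mulVf ?mul1r// gt_eqF.
Qed.

Lemma integrable_expRN_mul (e : R) (h : R -> R) : 0 < e -> measurable_fun setT h ->
  (forall s, `|h s| <= 1) ->
  mu.-integrable pos (fun s => (expR (- (e * s)) * h s)%:E).
Proof.
move=> e0 mh h1; apply: (@integrable_bounded_mul _ _ _ _ 1) => //.
  exact: integrable_expRN.
exact: measurable_funTS.
Qed.

Lemma integrable_expRN_cos (e y : R) : 0 < e ->
  mu.-integrable pos (fun s => (expR (- (e * s)) * cos (y * s))%:E).
Proof.
move=> e0; apply: integrable_expRN_mul => //; first exact: measurable_cos_mul.
by move=> x; rewrite ler_norml cos_geN1 cos_le1.
Qed.

Lemma integrable_expRN_sin (e y : R) : 0 < e ->
  mu.-integrable pos (fun s => (expR (- (e * s)) * sin (y * s))%:E).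
Proof.
move=> e0; apply: integrable_expRN_mul => //; first exact: measurable_sin_mul.
by move=> x; rewrite ler_norml sin_geN1 sin_le1.
Qed.

Let cvg_expRN_mul0 (e M : R) (h : R -> R) : 0 < e -> (forall s, `|h s| <= M) ->
  expR (- (e * s)) * h s @[s --> +oo] --> (0 : R).
Proof.
move=> e0 hM; apply/norm_cvg0P.
apply: (@squeeze_cvgr _ _ _ _ (cst 0) (fun s => expR (- (e * s)) * M)).
- near=> x; rewrite normr_ge0/= normrM ger0_norm ?expR_ge0//.
  by rewrite ler_wpM2l// expR_ge0.
- exact: cvg_cst.
- by rewrite -[X in _ --> X](mul0r M); apply: cvgMr_tmp; exact: cvg_expRN.
Unshelve. all: end_near. Qed.

(** Real part of [int_0^oo exp (- (e - i y) s) ds = 1 / (e - i y)], by an explicit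
    antiderivative. *)
Lemma Rintegral_expRN_cos (e y : R) : 0 < e ->
  \int[mu]_(s in pos) (expR (- (e * s)) * cos (y * s)) = e / (e ^+ 2 + y ^+ 2).
Proof.
move=> e0; have p : 0 < e ^+ 2 + y ^+ 2 by rewrite ltr_wpDr ?sqr_ge0// exprn_gt0.
have d (s : R) : is_derive s 1
    (fun s => expR (- (e * s)) * ((y * sin (y * s) + - e * cos (y * s)) * (e ^+ 2 + y ^+ 2)^-1))
    (expR (- (e * s)) * cos (y * s)).
  apply: is_derive_eq (is_derive_mul (is_derive_expRN e s)
   (is_derive_mul (is_deriveD
     (is_derive_mul (is_derive_cst y s (1 : R)) (is_derive_sin_comp (is_derive_mulc y s)))
     (is_derive_mul (is_derive_cst (- e) s (1 : R)) (is_derive_cos_comp (is_derive_mulc y s))))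
     (is_derive_cst (e ^+ 2 + y ^+ 2)^-1 s (1 : R)))) _.
  by rewrite /cst !fctE; field; rewrite gt_eqF.
rewrite (Rintegral_half_line_is_derive _ _ d (l := 0)).
- by rewrite !mulr0 oppr0 expR0 sin0 cos0 mulr0 add0r mul1r mulr1 sub0r mulNr opprK.
- move=> s; apply: cvgM.
    exact: (is_derive_continuous (is_derive_expRN e s)).
  exact: (is_derive_continuous (is_derive_cos_comp (is_derive_mulc y s))).
- exact: integrable_expRN_cos.
- apply: (@cvg_expRN_mul0 _ ((`|y| + `|e|) * `|(e ^+ 2 + y ^+ 2)^-1|)) => // s.
  rewrite normrM ler_wpM2r// (le_trans (ler_normD _ _))// !normrM normrN.
  by rewrite lerD// ler_piMr// ler_norml ?sin_geN1 ?sin_le1 ?cos_geN1 ?cos_le1.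
Qed.

Lemma Rintegral_expRN_sin (e y : R) : 0 < e ->
  \int[mu]_(s in pos) (expR (- (e * s)) * sin (y * s)) = y / (e ^+ 2 + y ^+ 2).
Proof.
move=> e0; have p : 0 < e ^+ 2 + y ^+ 2 by rewrite ltr_wpDr ?sqr_ge0// exprn_gt0.
have d (s : R) : is_derive s 1
    (fun s => expR (- (e * s)) * ((- e * sin (y * s) + - y * cos (y * s)) * (e ^+ 2 + y ^+ 2)^-1))
    (expR (- (e * s)) * sin (y * s)).
  apply: is_derive_eq (is_derive_mul (is_derive_expRN e s)
   (is_derive_mul (is_deriveD
     (is_derive_mul (is_derive_cst (- e) s (1 : R)) (is_derive_sin_comp (is_derive_mulc y s)))
     (is_derive_mul (is_derive_cst (- y) s (1 : R)) (is_derive_cos_comp (is_derive_mulc y s))))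
     (is_derive_cst (e ^+ 2 + y ^+ 2)^-1 s (1 : R)))) _.
  by rewrite /cst !fctE; field; rewrite gt_eqF.
rewrite (Rintegral_half_line_is_derive _ _ d (l := 0)).
- by rewrite !mulr0 oppr0 expR0 sin0 cos0 mulr0 add0r mul1r mulr1 sub0r mulNr opprK.
- move=> s; apply: cvgM.
    exact: (is_derive_continuous (is_derive_expRN e s)).
  exact: (is_derive_continuous (is_derive_sin_comp (is_derive_mulc y s))).
- exact: integrable_expRN_sin.
- apply: (@cvg_expRN_mul0 _ ((`|e| + `|y|) * `|(e ^+ 2 + y ^+ 2)^-1|)) => // s.
  rewrite normrM ler_wpM2r// (le_trans (ler_normD _ _))// !normrM !normrN.
  by rewrite lerD// ler_piMr// ler_norml ?sin_geN1 ?sin_le1 ?cos_geN1 ?cos_le1.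
Qed.

End fourier_tools.

(** * The Gaussian cone integral as a Fourier integral *)

Section cone_fourier.
Context {R : realType}.
Notation mu := (@lebesgue_measure R).
Notation pos := (`]0, +oo[%classic : set R).

Definition sqn n (t : n.-tuple R) : R := \sum_(j < n) tnth t j ^+ 2.

Definition dotp n (tau : 'I_n -> R) (t : n.-tuple R) : R :=
  \sum_(j < n) tau j * tnth t j.

(** The density whose integral over [s > 0] and over the orthant is, up to a
    constant, the volume; [hgauss (s + dotp tau t)] arises from the part of the
    cone over the simplex that lies above [t]. *)
Definition cone_density (kappa : R) n (tau : 'I_n -> R) (s : R) (t : n.-tuple R) : R :=
  expR (- (kappa * sqn t / 2)) * hgauss (s + dotp tau t).

Lemma cone_density_ge0 (kappa : R) n (tau : 'I_n -> R) s t : 0 <= cone_density kappa tau s t.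
Proof. by apply: mulr_ge0; [exact: expR_ge0|exact: hgauss_ge0]. Qed.

Lemma measurable_sqn n : measurable_fun setT (@sqn n).
Proof.
rewrite /sqn; apply: measurable_sum => j.
by apply: measurable_funX; exact: measurable_tnth.
Qed.

Lemma measurable_dotp n (tau : 'I_n -> R) : measurable_fun setT (dotp tau).
Proof.
rewrite /dotp; apply: measurable_sum => j.
by apply: measurable_funM => //; exact: measurable_tnth.
Qed.

Lemma measurable_cone_density2 kappa n (tau : 'I_n -> R) :
  measurable_fun setT (fun z : R * n.-tuple R => cone_density kappa tau z.1 z.2).
Proof.
apply: measurable_funM.
  apply: measurableT_comp => //; apply: measurableT_comp => //.
  apply: measurable_funM => //; apply: measurable_funM => //.
  by apply: measurableT_comp; [exact: measurable_sqn|exact: measurable_snd].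
apply: measurableT_comp; first exact: measurable_hgauss.
apply: measurable_funD; first exact: measurable_fst.
by apply: measurableT_comp; [exact: measurable_dotp|exact: measurable_snd].
Qed.

Lemma measurable_cone_density kappa n (tau : 'I_n -> R) s :
  measurable_fun setT (cone_density kappa tau s).
Proof.
exact: (measurableT_comp (measurable_cone_density2 kappa tau) (measurable_pair1 s)).
Qed.

Lemma sqn_cons n x (t : n.-tuple R) : sqn (tuple_cons (x, t)) = x ^+ 2 + sqn t.
Proof.
rewrite /sqn big_ord_recl; congr (_ + _).
by apply: eq_bigr => i _; rewrite tnthS.
Qed.

Lemma dotp_cons n (tau : 'I_n.+1 -> R) x (t : n.-tuple R) :
  dotp tau (tuple_cons (x, t)) = tau ord0 * x + dotp (fun j => tau (lift ord0 j)) t.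
Proof.
rewrite /dotp big_ord_recl; congr (_ + _).
by apply: eq_bigr => i _; rewrite tnthS.
Qed.

Lemma cone_density_cons n (tau : 'I_n.+1 -> R) s x (t : n.-tuple R) :
  cone_density 1 tau s (tuple_cons (x, t)) =
  hgauss x * cone_density 1 (fun j => tau (lift ord0 j)) (s + tau ord0 * x) t.
Proof.
rewrite /cone_density sqn_cons dotp_cons addrA mulrA; congr (_ * _).
by rewrite /hgauss -expRD !mul1r mulrDl opprD.
Qed.

(** [Re (exp (i s y) * prodG tau y)] times a Gaussian; keeping only the real
    part makes [y > 0] suffice. *)
Definition fourier_kernel m (tau : 'I_m -> R) (s y : R) : R :=
  hgauss y * (cos (y * s) * complex.Re (prodG tau y) -
              sin (y * s) * complex.Im (prodG tau y)).

Lemma fourier_kernel_bound m (tau : 'I_m -> R) : (forall j, 0 < tau j) ->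
  exists2 M : R, 0 <= M &
    forall s y, 0 <= y -> `|fourier_kernel tau s y| <= M * hgauss y.
Proof.
move=> t0; have [M M0 HM] := prodG_bounded t0.
exists (M + M); first by rewrite addr_ge0.
move=> s y y0; have [hR hI] := HM y y0.
rewrite /fourier_kernel normrM ger0_norm ?hgauss_ge0// mulrC.
rewrite ler_wpM2r ?hgauss_ge0// (le_trans (ler_normB _ _))// !normrM.
rewrite lerD// -[leRHS]mul1r ler_pM// ler_norml.
  by rewrite cos_geN1 cos_le1.
by rewrite sin_geN1 sin_le1.
Qed.

Lemma measurable_fourier_kernel m (tau : 'I_m -> R) :
  measurable_fun setT (fun z : R * R => fourier_kernel tau z.1 z.2).
Proof.
have [cR cI] := continuous_prodG tau.
have mys : measurable_fun setT (fun z : R * R => z.2 * z.1).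
  by apply: measurable_funM; [exact: measurable_snd|exact: measurable_fst].
apply: measurable_funM.
  by apply: measurableT_comp; [exact: measurable_hgauss|exact: measurable_snd].
apply: measurable_funB; apply: measurable_funM.
- by apply: measurableT_comp => //; apply: continuous_measurable_fun; exact: continuous_cos.
- apply: (@measurableT_comp _ _ _ _ _ _ (fun y => complex.Re (prodG tau y))).
    exact: continuous_measurable_fun.
  exact: measurable_snd.
- by apply: measurableT_comp => //; apply: continuous_measurable_fun; exact: continuous_sin.
- apply: (@measurableT_comp _ _ _ _ _ _ (fun y => complex.Im (prodG tau y))).
    exact: continuous_measurable_fun.
  exact: measurable_snd.
Qed.

Lemma integrable_fourier_kernel m (tau : 'I_m -> R) s : (forall j, 0 < tau j) ->
  mu.-integrable pos (fun y => (fourier_kernel tau s y)%:E).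
Proof.
move=> t0; have [M M0 HM] := fourier_kernel_bound t0.
apply: (le_integrable (@measurable_pos R) _ _
    (integrableZl (@measurable_pos R) M integrable_hgauss)).
  apply/measurable_EFinP/measurable_funTS.
  exact: (measurableT_comp (measurable_fourier_kernel tau) (measurable_pair1 s)).
move=> y; rewrite /= in_itv/= andbT => y0; rewrite lee_fin.
by rewrite (le_trans (HM s y (ltW y0)))// ler_norm.
Qed.

(** Adding a coordinate [x] multiplies the transform by one more factor
    [gtransform (tau ord0 * y)]: the addition formulas split off the
    [x]-dependence of the phase [y * (s + tau ord0 * x)]. *)
Lemma fourier_kernelS m (tau : 'I_m.+1 -> R) s y :
  \int[mu]_(x in pos)
    (hgauss x * fourier_kernel (fun j => tau (lift ord0 j)) (s + tau ord0 * x) y) =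
  fourier_kernel tau s y.
Proof.
rewrite /fourier_kernel prodGS /gtransform.
case: (prodG _ y) => X Y /=; set a := tau ord0.
pose A := hgauss y * (cos (y * s) * X - sin (y * s) * Y).
pose B := hgauss y * (- (sin (y * s) * X) - cos (y * s) * Y).
transitivity (\int[mu]_(x in pos) (A * (hgauss x * cos (a * y * x)) +
                                    B * (hgauss x * sin (a * y * x)))).
  apply: eq_Rintegral => x _.
  rewrite (_ : y * (s + a * x) = y * s + a * y * x); last ring.
  by rewrite cosD sinD /A /B; ring.
have iA := integrable_hgauss_cos (a * y).
have iB := integrable_hgauss_sin (a * y).
rewrite RintegralD//; last 2 first.
- exact: (integrableZl (@measurable_pos R) A iA).
- exact: (integrableZl (@measurable_pos R) B iB).
rewrite !RintegralZl// -/(cosg (a * y)) -/(sing (a * y)) /A /B; ring.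
Qed.

(** In dimension [0] this is the Fourier inversion of the Gaussian; each further
    coordinate is integrated under the Fourier integral, where Fubini applies
    because the kernel stays bounded by a Gaussian in [y]. *)
Lemma cone_section_fourier m (tau : 'I_m -> R) s : (forall j, 0 < tau j) ->
  (\int[lebesgue_tuple R m]_(t in @orthant R m) (cone_density 1 tau s t)%:E =
  (2 / Num.sqrt (2 * pi) * \int[mu]_(y in pos) fourier_kernel tau s y)%:E)%E.
Proof.
set c := 2 / Num.sqrt (2 * pi).
have c0 : 0 <= c by rewrite divr_ge0.
elim: m tau s => [|m IHm] tau s t0.
  have -> : @orthant R 0 = setT by apply/seteqP; split => // t _ [].
  rewrite /= integral_dirac//; last first.
    by apply/measurable_EFinP; exact: measurable_cone_density.
  rewrite diracE in_setT mul1e; congr EFin.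
  rewrite /cone_density /sqn /dotp !big_ord0 addr0 mulr0 mul0r oppr0 expR0 mul1r.
  under eq_Rintegral do rewrite /fourier_kernel /prodG big_ord0/= mulr1 mulr0 subr0 (mulrC _ s).
  rewrite -/(cosg s) cosgE mulrA -[LHS]mul1r; congr (_ * _).
  have r0 : 0 < Num.sqrt (pi / 2 : R) by rewrite sqrtr_gt0 divr_gt0// pi_gt0.
  have -> : c = 2 / (2 * Num.sqrt (pi / 2)).
    rewrite /c (_ : 2 * pi = 2 ^+ 2 * (pi / 2)); last by field.
    by rewrite sqrtrM ?sqr_ge0// sqrtr_sqr ger0_norm.
  by field; rewrite gt_eqF.
clearbody c; pose tau' j := tau (lift ord0 j).
have t0' j : 0 < tau' j by exact: t0.
rewrite integral_orthantS//; last 2 first.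
- by apply/measurable_EFinP/measurable_funTS; exact: measurable_cone_density.
- by move=> t _; rewrite lee_fin cone_density_ge0.
pose f (z : R * R) := c * hgauss z.1 * fourier_kernel tau' (s + tau ord0 * z.1) z.2.
have mf : measurable_fun setT f.
  apply: measurable_funM.
    apply: measurable_funM => //.
    by apply: measurableT_comp; [exact: measurable_hgauss|exact: measurable_fst].
  pose phi (z : R * R) : R * R := (s + tau ord0 * z.1, z.2).
  apply: (@measurableT_comp _ _ _ _ _ _ (fun z => fourier_kernel tau' z.1 z.2) _ phi).
    exact: measurable_fourier_kernel.
  apply/measurable_fun_pair => /=; last exact: measurable_snd.
  apply: measurable_funD => //; apply: measurable_funM => //; exact: measurable_fst.
have [M M0 HM] := fourier_kernel_bound t0'.
transitivity (\int[mu]_(x in pos) (\int[mu]_(y in pos) f (x, y))%:E)%E.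
  apply: eq_integral => x _.
  under eq_integral do rewrite cone_density_cons EFinM.
  rewrite ge0_integralZl//.
  - rewrite (IHm tau')// -EFinM; congr EFin; rewrite mulrA (mulrC (hgauss x)).
    by rewrite -RintegralZl//; exact: integrable_fourier_kernel.
  - exact: measurable_orthant.
  - by apply/measurable_EFinP/measurable_funTS; exact: measurable_cone_density.
  - by move=> t _; rewrite lee_fin cone_density_ge0.
  - by rewrite lee_fin hgauss_ge0.
rewrite (@Fubini_product_bound R f (fun x => c * M * hgauss x) hgauss)//; last 3 first.
- exact: (integrableZl (@measurable_pos R) (c * M) integrable_hgauss).
- exact: integrable_hgauss.
- move=> x y x0 y0; have cx0 : 0 <= c * hgauss x by rewrite mulr_ge0 ?hgauss_ge0.
  rewrite /f/= normrM (ger0_norm cx0) [leRHS](_ : _ = c * hgauss x * (M * hgauss y)); last ring.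
  by rewrite ler_wpM2l//; apply/HM/ltW.
transitivity (\int[mu]_(y in pos) (c * fourier_kernel tau s y)%:E)%E.
  apply: eq_integral => y /[!inE]/=; rewrite in_itv/= andbT => y0; congr EFin.
  rewrite -fourier_kernelS -RintegralZl//.
    by apply: eq_Rintegral => x _; rewrite /f/= mulrA.
  apply: (@integrable_bounded_mul _ _ _ _ (M * hgauss y)) => //.
  - exact: integrable_hgauss.
  - apply: measurable_funTS.
    pose phi (x : R) : R * R := (s + tau ord0 * x, y).
    apply: (@measurableT_comp _ _ _ _ _ _ (fun z => fourier_kernel tau' z.1 z.2) _ phi).
      exact: measurable_fourier_kernel.
    apply/measurable_fun_pair => //=.
    by apply: measurable_funD => //; apply: measurable_funM.
  - by move=> x _; apply: HM; exact: ltW.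
rewrite -RintegralZl//; last exact: integrable_fourier_kernel.
rewrite /Rintegral fineK//; apply: integrable_fin_num => //.
exact: (integrableZl (@measurable_pos R) c (integrable_fourier_kernel s t0)).
Qed.

End cone_fourier.

(** * Integrating out the last cone variable *)

Section cone_mass_one.
Context {R : realType}.
Notation mu := (@lebesgue_measure R).
Notation pos := (`]0, +oo[%classic : set R).
Variables (m : nat) (tau : 'I_m -> R).
Hypotheses (t0 : forall j, 0 < tau j) (em : ~~ odd m).

Let c : R := 2 / Num.sqrt (2 * pi).
Let c0 : 0 <= c. Proof. by rewrite divr_ge0. Qed.
Let P (s : R) : R := \int[mu]_(y in pos) fourier_kernel tau s y.
Let gR (y : R) : R := hgauss y * complex.Re (prodG tau y).
Let gI (y : R) : R := hgauss y * complex.Im (prodG tau y).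
Let e_ (k : nat) : R := k.+1%:R^-1.

Let e_gt0 k : 0 < e_ k. Proof. by rewrite invr_gt0. Qed.

Let cvg_e : e_ @ \oo --> (0 : R). Proof. exact: cvg_harmonic. Qed.

Let sq_gt0 (e y : R) : 0 < e -> 0 < e ^+ 2 + y ^+ 2.
Proof. by move=> e0; rewrite ltr_wpDr ?sqr_ge0// exprn_gt0. Qed.

Let cgR : continuous gR.
Proof.
move=> y; apply: cvgM; first exact: continuous_hgauss.
exact: (continuous_prodG tau).1.
Qed.

Let cgI : continuous gI.
Proof.
move=> y; apply: cvgM; first exact: continuous_hgauss.
exact: (continuous_prodG tau).2.
Qed.

Let gR_bound : exists2 M : R, 0 <= M & forall y, 0 <= y -> `|gR y| <= M.
Proof.
have [M M0 HM] := prodG_bounded t0; exists M => // y y0.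
rewrite normrM ger0_norm ?hgauss_ge0// -[leRHS]mul1r.
by rewrite ler_pM ?hgauss_ge0 ?hgauss_le1// (HM y y0).1.
Qed.

Let rhoE y : rho 1 tau y = gI y / y.
Proof. by rewrite /rho /gI /hgauss mul1r mulrA. Qed.

Let integrable_gR (e : R) : 0 < e ->
  mu.-integrable pos (fun y => (gR y * (e / (e ^+ 2 + y ^+ 2)))%:E).
Proof.
move=> e0; have [M M0 HM] := prodG_bounded t0.
have -> : (fun y => (gR y * (e / (e ^+ 2 + y ^+ 2)))%:E) =
  (fun y => (hgauss y * (complex.Re (prodG tau y) * (e / (e ^+ 2 + y ^+ 2))))%:E).
  by apply/funext => y; rewrite /gR -mulrA.
apply: (@integrable_bounded_mul _ _ _ _ (M * e^-1)) => //.
- exact: integrable_hgauss.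
- apply: measurable_funTS; apply: continuous_measurable_fun => y.
  apply: cvgM; first exact: (continuous_prodG tau).1.
  apply: cvgM; first exact: cvg_cst.
  apply: cvgV; first by rewrite gt_eqF// sq_gt0.
  by apply: cvgD; [exact: cvg_cst|exact: exprn_continuous].
- move=> y; rewrite /= in_itv/= andbT => y0.
  rewrite normrM; apply: ler_pM => //; first exact: (HM y (ltW y0)).1.
  rewrite ger0_norm; last by rewrite divr_ge0 ?(ltW e0)// ltW// sq_gt0.
  rewrite ler_pdivrMr ?sq_gt0// mulrDr expr2 mulrA mulVf ?gt_eqF// mul1r.
  by rewrite lerDl mulr_ge0 ?invr_ge0 ?sqr_ge0// ltW.
Qed.

Let integrable_rho1 : mu.-integrable pos (fun y => (gI y / y)%:E).
Proof.
have : mu.-integrable pos (EFin \o rho 1 tau).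
  by apply: integrable_rho => // j; rewrite (@le_trans _ _ 0)// oppr_le0 sqr_ge0.
by rewrite (_ : EFin \o rho 1 tau = fun y => (gI y / y)%:E)//; apply/funext => y; rewrite /= rhoE.
Qed.

Let gI_bound (e y : R) : 0 < y -> `|gI y * (y / (e ^+ 2 + y ^+ 2))| <= `|gI y / y|.
Proof.
move=> y0; rewrite !normrM ler_wpM2l// normfV.
have p : 0 < e ^+ 2 + y ^+ 2 by rewrite ltr_wpDl ?sqr_ge0// exprn_gt0.
rewrite -normfV -normrM ger0_norm ?divr_ge0 ?(ltW y0) ?(ltW p)//.
rewrite gtr0_norm ?invr_gt0// ler_pdivrMr//.
have -> : y^-1 * (e ^+ 2 + y ^+ 2) = y^-1 * e ^+ 2 + y by field; rewrite gt_eqF.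
by rewrite lerDr mulr_ge0 ?sqr_ge0// invr_ge0 ltW.
Qed.

Let measurable_gI (e : R) : 0 < e -> measurable_fun setT (fun y => gI y * (y / (e ^+ 2 + y ^+ 2))).
Proof.
move=> e0; apply: continuous_measurable_fun => y.
apply: cvgM; first exact: cgI.
apply: cvgM; first exact: cvg_id.
apply: cvgV; first by rewrite gt_eqF// sq_gt0.
by apply: cvgD; [exact: cvg_cst|exact: exprn_continuous].
Qed.

Let integrable_gI (e : R) : 0 < e ->
  mu.-integrable pos (fun y => (gI y * (y / (e ^+ 2 + y ^+ 2)))%:E).
Proof.
move=> e0; apply: (le_integrable (@measurable_pos R) _ _ integrable_rho1).
  by apply/measurable_EFinP/measurable_funTS; exact: measurable_gI.
by move=> y; rewrite /= in_itv/= andbT => y0; rewrite lee_fin gI_bound.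
Qed.

Let damped (e : R) : 0 < e ->
  (\int[mu]_(s in pos) (expR (- (e * s)) * (c * P s))%:E =
   (c * (\int[mu]_(y in pos) (gR y * (e / (e ^+ 2 + y ^+ 2))) -
         \int[mu]_(y in pos) (gI y * (y / (e ^+ 2 + y ^+ 2)))))%:E)%E.
Proof.
move=> e0; have [M M0 HM] := fourier_kernel_bound t0.
pose f (z : R * R) := c * expR (- (e * z.1)) * fourier_kernel tau z.1 z.2.
have mf : measurable_fun setT f.
  apply: measurable_funM; last exact: measurable_fourier_kernel.
  apply: measurable_funM => //; apply: measurableT_comp => //.
  apply: measurableT_comp => //; apply: measurable_funM => //; exact: measurable_fst.
transitivity (\int[mu]_(s in pos) (\int[mu]_(y in pos) f (s, y))%:E)%E.
  apply: eq_integral => s _; congr EFin.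
  rewrite mulrA (mulrC (expR _)) -RintegralZl//; exact: integrable_fourier_kernel.
rewrite (@Fubini_product_bound R f (fun s => c * M * expR (- (e * s))) hgauss)//; last 3 first.
- exact: (integrableZl (@measurable_pos R) (c * M) (integrable_expRN e0)).
- exact: integrable_hgauss.
- move=> s y s0 y0; have cs0 : 0 <= c * expR (- (e * s)) by rewrite mulr_ge0 ?expR_ge0.
  rewrite /f/= normrM (ger0_norm cs0).
  rewrite [leRHS](_ : _ = c * expR (- (e * s)) * (M * hgauss y)); last ring.
  by rewrite ler_wpM2l//; apply/HM/ltW.
have i1 := integrable_gR e0; have i2 := integrable_gI e0.
transitivity (\int[mu]_(y in pos)
    (c * (gR y * (e / (e ^+ 2 + y ^+ 2)) - gI y * (y / (e ^+ 2 + y ^+ 2))))%:E)%E.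
  apply: eq_integral => y _; congr EFin.
  transitivity (\int[mu]_(s in pos) (c * gR y * (expR (- (e * s)) * cos (y * s)) -
      c * gI y * (expR (- (e * s)) * sin (y * s)))).
    by apply: eq_Rintegral => s _; rewrite /f /fourier_kernel /gR /gI/=; ring.
  have iC := integrable_expRN_cos y e0; have iS := integrable_expRN_sin y e0.
  rewrite RintegralB//; last 2 first.
  - exact: (integrableZl (@measurable_pos R) (c * gR y) iC).
  - exact: (integrableZl (@measurable_pos R) (c * gI y) iS).
  rewrite !RintegralZl// Rintegral_expRN_cos// Rintegral_expRN_sin//; ring.
have i12 := integrableB (@measurable_pos R) i1 i2.
rewrite -RintegralB// -RintegralZl//.
rewrite /Rintegral fineK//; apply: integrable_fin_num => //.
exact: (integrableZl (@measurable_pos R) c i12).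
Qed.

Let cvg_T1 : (\int[mu]_(y in pos) (gR y * (e_ k / (e_ k ^+ 2 + y ^+ 2))))
  @[k --> \oo] --> gR 0 * (pi / 2).
Proof.
have [M M0 HM] := gR_bound.
have E (e : R) : 0 < e -> (\int[mu]_(y in pos) (gR y * (e / (e ^+ 2 + y ^+ 2)))%:E =
    \int[mu]_(x in pos) (gR (e * x) * (1 + x ^+ 2)^-1)%:E)%E.
  move=> e0; rewrite (integrable_dilation e0 (integrable_gR e0)).
  have iG : mu.-integrable pos (fun x => (gR (e * x) * (1 + x ^+ 2)^-1)%:E).
    have -> : (fun x => (gR (e * x) * (1 + x ^+ 2)^-1)%:E) =
              (fun x => ((1 + x ^+ 2)^-1 * gR (e * x))%:E).
      by apply/funext => x; rewrite mulrC.
    apply: (@integrable_bounded_mul _ _ _ _ M) => //; first exact: integrable_oneDsqrV.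
      apply: measurable_funTS; apply: continuous_measurable_fun => x.
      apply: (@continuous_comp _ _ _ (fun x => e * x) gR); last exact: cgR.
      by apply: cvgMl_tmp; exact: cvg_id.
    move=> x; rewrite /= in_itv/= andbT => x0; apply: HM.
    by rewrite mulr_ge0 ?ltW.
  transitivity (e%:E * \int[mu]_(x in pos)
      ((e^-1)%:E * (gR (e * x) * (1 + x ^+ 2)^-1)%:E))%E.
    congr (_ * _)%E; apply: eq_integral => x _; rewrite -EFinM; congr EFin.
    have p := oneDsqr_gt0 x.
    have -> : e ^+ 2 + (e * x) ^+ 2 = e ^+ 2 * (1 + x ^+ 2) by ring.
    by field; rewrite !gt_eqF.
  by rewrite integralZl// muleA -EFinM mulfV ?mul1e// gt_eqF.
rewrite /Rintegral; under eq_fun do rewrite E//.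
apply: fine_cvg.
have -> : (gR 0 * (pi / 2))%:E = (\int[mu]_(x in pos) (gR 0 * (1 + x ^+ 2)^-1)%:E)%E.
  under eq_integral do rewrite EFinM.
  rewrite integralZl//; last exact: integrable_oneDsqrV.
  rewrite integral_itv_obnd_cbnd; last first.
    apply/measurable_EFinP/measurable_funTS.
    by apply: continuous_measurable_fun; exact: continuous_oneDsqrV.
  by rewrite EFinM; congr (_ * _)%E; exact/esym/integral0y_oneDsqr.
apply: (@dominated_cvg _ _ _ mu pos _ _ _ (fun x => (M * (1 + x ^+ 2)^-1)%:E)) => //.
- move=> k; apply/measurable_EFinP/measurable_funTS.
  apply: continuous_measurable_fun => x; apply: cvgM; last exact: continuous_oneDsqrV.
  apply: (@continuous_comp _ _ _ (fun x => e_ k * x) gR); last exact: cgR.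
  by apply: cvgMl_tmp; exact: cvg_id.
- move=> x _; apply: cvg_EFin; first exact: nearW.
  have ex0 : e_ k * x @[k --> \oo] --> (0 : R).
    by rewrite -[X in _ --> X](mul0r x); apply: cvgMr_tmp; exact: cvg_e.
  by apply: cvgMr_tmp; apply: (cvg_comp _ _ ex0); exact: cgR.
- exact: (integrableZl (@measurable_pos R) M integrable_oneDsqrV).
- move=> k x; rewrite /= in_itv/= andbT => x0.
  rewrite lee_fin normrM (ger0_norm (_ : 0 <= (1 + x ^+ 2)^-1)) ?invr_ge0 ?(ltW (oneDsqr_gt0 x))//.
  rewrite ler_wpM2r// ?invr_ge0 ?(ltW (oneDsqr_gt0 x))//; apply: HM.
  by rewrite mulr_ge0 ?ltW.
Qed.

Let cvg_T2 : (\int[mu]_(y in pos) (gI y * (y / (e_ k ^+ 2 + y ^+ 2))))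
  @[k --> \oo] --> \int[mu]_(y in pos) rho 1 tau y.
Proof.
rewrite /Rintegral; under [X in _ --> fine X]eq_integral do rewrite rhoE.
apply: fine_cvg; rewrite fineK; last exact: integrable_fin_num integrable_rho1.
apply: (@dominated_cvg _ _ _ mu pos _ _ _ (fun y => `|(gI y / y)%:E|%E)) => //.
- move=> k; apply/measurable_EFinP/measurable_funTS; exact: measurable_gI.
- move=> y; rewrite /= in_itv/= andbT => y0; apply: cvg_EFin; first exact: nearW.
  apply: cvgMl_tmp.
  have -> : y^-1 = y / (0 ^+ 2 + y ^+ 2) by rewrite expr0n add0r; field; rewrite gt_eqF.
  apply: cvgMl_tmp; apply: cvgV.
    by rewrite expr0n add0r gt_eqF// exprn_gt0.
  apply: cvgD; last exact: cvg_cst.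
  by apply: (cvg_comp e_ (fun e : R => e ^+ 2) cvg_e); exact: exprn_continuous.
- exact: (integrable_abse integrable_rho1).
- move=> k y; rewrite /= in_itv/= andbT => y0.
  by rewrite lee_fin gI_bound.
Qed.

(** Integrating [exp (i s y)] over [s > 0] gives half a Dirac mass at [y = 0]
    plus [i] times the principal value of [1 / y]. With the damping [exp (- e s)]
    these are the Poisson kernel [e / (e ^+ 2 + y ^+ 2)], whose limit produces the
    value at [0], and [y / (e ^+ 2 + y ^+ 2)], which increases to [1 / y]; the
    imaginary part of [prodG] vanishes at [0], so dominated convergence applies. *)
Lemma cone_mass1 :
  (\int[mu]_(s in pos) \int[lebesgue_tuple R m]_(t in @orthant R m)
     (cone_density 1 tau s t)%:E =
   (2 / Num.sqrt (2 * pi) *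
     (Num.sqrt (pi / 2) ^+ m * (pi / 2) - \int[mu]_(y in pos) rho 1 tau y))%:E)%E.
Proof.
under eq_integral do rewrite cone_section_fourier// -/c -/(P _).
have cP0 s : 0 <= c * P s.
  rewrite -lee_fin -cone_section_fourier//; apply: integral_ge0 => t _.
  by rewrite lee_fin cone_density_ge0.
have mP : measurable_fun pos (fun s => (c * P s)%:E).
  apply: (eq_measurable_fun (fun s => \int[lebesgue_tuple R m]_(t in @orthant R m)
     (cone_density 1 tau s t)%:E)%E).
    by move=> s _; rewrite cone_section_fourier.
  apply: (@measurable_integral_dom _ _ _ _ _ _ _ _ _ _
     (fun z => (cone_density 1 tau z.1 z.2)%:E)) => //.
  - exact: measurable_orthant.
  - by apply/measurable_EFinP/measurable_funTS; exact: measurable_cone_density2.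
  - by move=> z _; rewrite lee_fin cone_density_ge0.
have h1 : (\int[mu]_(s in pos) (expR (- (e_ k * s)) * (c * P s))%:E)%E @[k --> \oo] -->
    (\int[mu]_(s in pos) (c * P s)%:E)%E.
  have -> : (\int[mu]_(s in pos) (c * P s)%:E)%E = (\int[mu]_(s in pos)
      (limn (fun k => (expR (- (e_ k * s)) * (c * P s))%:E)))%E.
    apply: eq_integral => s _; apply/esym/cvg_lim => //.
    apply: cvg_EFin; first exact: nearW.
    rewrite -[X in _ --> X]mul1r; apply: cvgMr_tmp.
    have es0 : - (e_ k * s) @[k --> \oo] --> (0 : R).
      rewrite -[X in _ --> X]oppr0; apply: cvgN.
      by rewrite -[X in _ --> X](mul0r s); apply: cvgMr_tmp; exact: cvg_e.
    by rewrite -expR0; apply: (cvg_comp _ _ es0); exact: continuous_expR.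
  apply: cvg_monotone_convergence => //.
  - move=> k; apply/measurable_EFinP/measurable_funM; last exact/measurable_EFinP.
    apply: measurable_funTS; apply: measurableT_comp => //.
    by apply: measurableT_comp => //; apply: measurable_funM.
  - by move=> k s _; rewrite lee_fin mulr_ge0 ?expR_ge0.
  - move=> s; rewrite /= in_itv/= andbT => s0 k l kl.
    rewrite lee_fin ler_wpM2r// ler_expR lerN2 ler_wpM2r ?(ltW s0)//.
    by rewrite /e_ lef_pV2 ?posrE// ler_nat.
have h2 : (\int[mu]_(s in pos) (expR (- (e_ k * s)) * (c * P s))%:E)%E @[k --> \oo] -->
    (c * (gR 0 * (pi / 2) - \int[mu]_(y in pos) rho 1 tau y))%:E.
  under eq_fun do rewrite damped//.
  apply: cvg_EFin; first exact: nearW.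
  by apply: cvgMl_tmp; apply: cvgB; [exact: cvg_T1|exact: cvg_T2].
rewrite (cvg_unique _ h1 h2)//; congr (_ * (_ * _ - _))%:E.
rewrite /gR hgauss0 mul1r /prodG.
have -> : \prod_(j < m) gtransform (tau j * 0) = (Num.sqrt (pi / 2) ^+ m)%:C.
  under eq_bigr do rewrite mulr0 /gtransform sing0 cosgE hgauss0 mulr1.
  by rewrite prodr_const card_ord rmorphXn.
by [].
Qed.

End cone_mass_one.

(** * Positive curvature *)

Section cone_mass_pos.
Context {R : realType}.
Notation mu := (@lebesgue_measure R).
Notation pos := (`]0, +oo[%classic : set R).

Definition cone_mass (kappa : R) m (tau : 'I_m -> R) : \bar R :=
  (\int[mu]_(s in pos) \int[lebesgue_tuple R m]_(t in @orthant R m)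
     (cone_density kappa tau s t)%:E)%E.

Lemma measurable_cone_section kappa m (tau : 'I_m -> R) :
  measurable_fun pos (fun s => \int[lebesgue_tuple R m]_(t in @orthant R m)
     (cone_density kappa tau s t)%:E)%E.
Proof.
apply: (@measurable_integral_dom _ _ _ _ _ _ _ _ _ _
   (fun z => (cone_density kappa tau z.1 z.2)%:E)) => //.
- exact: measurable_orthant.
- by apply/measurable_EFinP/measurable_funTS; exact: measurable_cone_density2.
- by move=> z _; rewrite lee_fin cone_density_ge0.
Qed.

(** Substitute [t / sqrt kappa] for [t]. *)
Lemma cone_mass_scale (kappa : R) m (tau : 'I_m -> R) : 0 < kappa ->
  (cone_mass kappa tau = ((Num.sqrt kappa)^-1 ^+ m)%:E *
    cone_mass 1 (fun j => ((Num.sqrt kappa)^-1 * tau j)%R))%E.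
Proof.
move=> k0; have sk0 : 0 < Num.sqrt kappa by rewrite sqrtr_gt0.
have ci0 : 0 < (Num.sqrt kappa)^-1 by rewrite invr_gt0.
rewrite /cone_mass -ge0_integralZl//; last 2 first.
- exact: measurable_cone_section.
- by move=> s _; apply: integral_ge0 => t _; rewrite lee_fin cone_density_ge0.
apply: eq_integral => s _.
rewrite (integral_orthant_dilation ci0); last 2 first.
- by apply/measurable_EFinP/measurable_funTS; exact: measurable_cone_density.
- by move=> t _; rewrite lee_fin cone_density_ge0.
congr (_ * _)%E; apply: eq_integral => t _; congr EFin.
rewrite /cone_density; congr (expR (- (_ / 2)) * hgauss (s + _)).
  rewrite /sqn !mulr_sumr; apply: eq_bigr => j _.
  rewrite tnth_mktuple exprMn exprVn sqr_sqrtr ?(ltW k0)// mul1r.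
  by rewrite mulrA mulfV ?mul1r// gt_eqF.
rewrite /dotp; apply: eq_bigr => j _.
by rewrite tnth_mktuple mulrA (mulrC (tau j)).
Qed.

Lemma integral_rho_scale (kappa : R) m (tau : 'I_m -> R) : 0 < kappa ->
  (forall j, 0 < tau j) -> ~~ odd m ->
  \int[mu]_(y in pos) rho 1 (fun j => (Num.sqrt kappa)^-1 * tau j) y =
  \int[mu]_(y in pos) rho kappa tau y.
Proof.
move=> k0 t0 em; have sk0 : 0 < Num.sqrt kappa by rewrite sqrtr_gt0.
pose tau' j := (Num.sqrt kappa)^-1 * tau j.
have t0' j : 0 < tau' j by rewrite mulr_gt0// invr_gt0.
have ir : mu.-integrable pos (EFin \o rho 1 tau').
  by apply: integrable_rho => // j; rewrite (@le_trans _ _ 0)// oppr_le0 sqr_ge0.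
have ik : mu.-integrable pos (EFin \o rho kappa tau).
  by apply: integrable_rho => // j; rewrite (@le_trans _ _ 0) ?oppr_le0 ?sqr_ge0// ltW.
have E y : 0 < y -> rho 1 tau' (Num.sqrt kappa * y) = (Num.sqrt kappa)^-1 * rho kappa tau y.
  move=> y0; rewrite /rho exprMn sqr_sqrtr ?(ltW k0)// mul1r invfM.
  have -> : prodG tau' (Num.sqrt kappa * y) = prodG tau y.
    apply: eq_bigr => j _; congr gtransform; rewrite /tau'.
    by field; rewrite gt_eqF.
  by ring.
rewrite /Rintegral; congr fine; rewrite (integrable_dilation sk0 ir).
transitivity ((Num.sqrt kappa)%:E * \int[mu]_(x in pos)
  ((Num.sqrt kappa)^-1%:E * (EFin \o rho kappa tau) x))%E.
  congr (_ * _)%E; apply: eq_integral => y /[!inE]/=; rewrite in_itv/= andbT => y0.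
  by rewrite E.
by rewrite integralZl// muleA -EFinM mulfV ?mul1e// gt_eqF.
Qed.

(** The value of [kappa ^+ m./2 * cone_mass kappa tau] in even dimension [m]. *)
Definition cone_value (kappa : R) m (tau : 'I_m -> R) : R :=
  2 / Num.sqrt (2 * pi) *
    (Num.sqrt (pi / 2) ^+ m * (pi / 2) - \int[mu]_(y in pos) rho kappa tau y).

Lemma cone_mass_pos (kappa : R) m (tau : 'I_m -> R) : 0 < kappa ->
  (forall j, 0 < tau j) -> ~~ odd m ->
  cone_mass kappa tau \is a fin_num /\
  kappa ^+ m./2 * fine (cone_mass kappa tau) = cone_value kappa tau.
Proof.
move=> k0 t0 em; have sk0 : 0 < Num.sqrt kappa by rewrite sqrtr_gt0.
rewrite (cone_mass_scale _ k0) {1 2}/cone_mass cone_mass1//; last first.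
  by move=> j; rewrite mulr_gt0// invr_gt0.
rewrite -EFinM; split => //=; rewrite integral_rho_scale// -/(cone_value kappa tau).
rewrite mulrA [X in X * _](_ : _ = 1) ?mul1r//.
have -> : ((Num.sqrt kappa)^-1 ^+ m = (kappa ^+ m./2)^-1)%R.
  rewrite exprVn; congr (_^-1); rewrite -[in LHS](odd_double_half m) (negbTE em) add0n.
  by rewrite -mul2n exprM sqr_sqrtr// ltW.
by rewrite mulfV// gt_eqF// exprn_gt0.
Qed.

End cone_mass_pos.

(** * Power series with an absolutely convergent endpoint *)

Section power_series.
Context {R : realType}.
Implicit Types (f g : R -> R) (a : nat -> R).

Definition psum a (x : R) (n : nat) : R := \sum_(k < n) a k * x ^+ k.

(** Absolute summability at the endpoint [r] is required, so that identities
    extend to [r] itself; this covers the ideal simplices without a limiting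
    argument. *)
Definition has_power_series (r : R) f := exists2 a,
  exists B, forall n, psum (fun k => `|a k|) r n <= B &
  forall x, 0 <= x <= r -> psum a x n @[n --> \oo] --> f x.

Lemma psumS a x n : psum a x n.+1 = psum a x n + a n * x ^+ n.
Proof. by rewrite /psum big_ord_recr. Qed.

Lemma has_power_series_cst r c : 0 <= r -> has_power_series r (fun=> c).
Proof.
move=> r0; exists (fun k => if k is 0 then c else 0).
  exists `|c| => -[|n]; first by rewrite /psum big_ord0.
  rewrite /psum big_ord_recl/= mulr1 big1 ?addr0// => i _.
  by rewrite normr0 mul0r.
move=> x _; apply: cvg_near_cst; exists 1%N => // -[//|n] _.
by rewrite /psum big_ord_recl/= mulr1 big1 ?addr0// => i _; rewrite mul0r.
Qed.

Lemma has_power_series_add r f g : 0 <= r -> has_power_series r f -> has_power_series r g ->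
  has_power_series r (fun x => f x + g x).
Proof.
move=> r0 [a [A HA] fa] [b [B HB] gb]; exists (fun k => a k + b k).
  exists (A + B) => n; apply: le_trans (lerD (HA n) (HB n)).
  rewrite /psum -big_split/=; apply: ler_sum => i _.
  by rewrite -mulrDl ler_wpM2r ?exprn_ge0// ler_normD.
move=> x x0; have -> : psum (fun k => a k + b k) x = (fun n => psum a x n + psum b x n).
  by apply/funext => n; rewrite /psum -big_split/=; apply: eq_bigr => i _; rewrite mulrDl.
by apply: cvgD; [exact: fa|exact: gb].
Qed.

Lemma has_power_series_scale r f c : has_power_series r f ->
  has_power_series r (fun x => c * f x).
Proof.
move=> [a [A HA] fa]; exists (fun k => c * a k).
  exists (`|c| * A) => n; rewrite (_ : psum _ _ _ = `|c| * psum (fun k => `|a k|) r n).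
    by rewrite ler_wpM2l.
  by rewrite /psum mulr_sumr; apply: eq_bigr => i _; rewrite normrM mulrA.
move=> x x0; have -> : psum (fun k => c * a k) x = (fun n => c * psum a x n).
  by apply/funext => n; rewrite /psum mulr_sumr; apply: eq_bigr => i _; rewrite mulrA.
by apply: cvgMl_tmp; exact: fa.
Qed.

Lemma has_power_series_mulX r f : 0 <= r -> has_power_series r f ->
  has_power_series r (fun x => x * f x).
Proof.
move=> r0 [a [A HA] fa]; pose b k := if k is k'.+1 then a k' else 0.
have pb x n : psum b x n.+1 = x * psum a x n.
  rewrite /psum big_ord_recl/= mul0r add0r mulr_sumr; apply: eq_bigr => i _.
  by rewrite exprS mulrCA.
have A0 : 0 <= A by apply: le_trans (HA 0%N); rewrite /psum big_ord0.
exists b.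
  exists (r * A) => -[|n]; first by rewrite /psum big_ord0 mulr_ge0.
  rewrite (_ : psum _ _ _ = r * psum (fun k => `|a k|) r n) ?ler_wpM2l//.
  rewrite /psum big_ord_recl/= normr0 mul0r add0r mulr_sumr; apply: eq_bigr => i _.
  by rewrite exprS mulrCA.
move=> x x0; rewrite -(cvg_shiftS (psum b x)); under eq_fun do rewrite /= pb.
by apply: cvgMl_tmp; exact: fa.
Qed.

Lemma has_power_series_eq r f g : (forall x, 0 <= x <= r -> f x = g x) ->
  has_power_series r f -> has_power_series r g.
Proof. by move=> fg [a HA fa]; exists a => // x x0; rewrite -fg//; exact: fa. Qed.

Lemma has_power_series_mul1B r f n : 0 <= r -> has_power_series r f ->
  has_power_series r (fun x => (1 - x) ^+ n * f x).
Proof.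
move=> r0 hf; elim: n => [|n IHn].
  by apply: has_power_series_eq hf => x _; rewrite expr0 mul1r.
apply: has_power_series_eq (has_power_series_add r0 IHn
  (has_power_series_scale (-1) (has_power_series_mulX r0 IHn))) => x _.
by rewrite exprS; ring.
Qed.

(** If all coefficients before [a m] vanish, the terms after it are
    [O (x ^+ m.+1)] near [0], so [a m * x ^+ m] is too, and [a m = 0]. *)
Lemma power_series_identity r r1 f : 0 < r1 -> r1 <= r -> has_power_series r f ->
  (forall x, 0 < x < r1 -> f x = 0) -> forall x, 0 <= x <= r -> f x = 0.
Proof.
move=> r10 r1r [a [B HB] fa] f0.
have r0 : 0 < r by exact: lt_le_trans r1r.
have a0 m : a m = 0.
  elim/ltn_ind: m => m IHm.
  have key x : 0 < x -> x < r1 -> `|a m| <= x * (B / r ^+ m.+1).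
    move=> x0 xr1; have xr : x <= r by rewrite (le_trans (ltW xr1)).
    have h1 : psum a x n @[n --> \oo] --> 0.
      by rewrite -(f0 x) ?x0//; apply: fa; rewrite (ltW x0).
    have xr01 : 0 <= x / r <= 1.
      by rewrite divr_ge0 ?(ltW x0) ?(ltW r0)//= ler_pdivrMr// mul1r.
    have /andP[q0 q1] := xr01.
    (* every term of index above m gains a factor (x / r) ^+ m.+1 *)
    have tail n : `|psum a x (n + m.+1) - a m * x ^+ m| <=
        (x / r) ^+ m.+1 * psum (fun k => `|a k|) r (n + m.+1).
      elim: n => [|n IHn].
        rewrite add0n psumS [psum a x m]big1 ?add0r ?subrr ?normr0; last first.
          by move=> i _; rewrite IHm// mul0r.
        rewrite mulr_ge0 ?exprn_ge0// sumr_ge0// => i _.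
        by rewrite mulr_ge0// exprn_ge0// ltW.
      rewrite addSn !psumS addrAC mulrDr (le_trans (ler_normD _ _))// lerD//.
      rewrite normrM normrX (gtr0_norm x0) mulrCA ler_wpM2l//.
      rewrite [leLHS](_ : _ = (x / r) ^+ (n + m.+1) * r ^+ (n + m.+1)); last first.
        by rewrite -exprMn divfK// gt_eqF.
      rewrite ler_wpM2r ?exprn_ge0 ?(ltW r0)// addnC exprD.
      by rewrite ler_piMr ?exprn_ge0// exprn_ile1.
    have h2 : `|psum a x (n + m.+1) - a m * x ^+ m| @[n --> \oo] --> `|0 - a m * x ^+ m|.
      apply: cvg_norm; apply: cvgB; last exact: cvg_cst.
      by rewrite cvg_shiftn.
    have : `|0 - a m * x ^+ m| <= (x / r) ^+ m.+1 * B.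
      apply: (cvgr_to_le h2); apply: nearW => n; apply: (le_trans (tail n)).
      by rewrite ler_wpM2l ?exprn_ge0.
    rewrite sub0r normrN normrM normrX (gtr0_norm x0) expr_div_n.
    rewrite [leRHS](_ : _ = x * (B / r ^+ m.+1) * x ^+ m); last by rewrite exprS; ring.
    by rewrite ler_pM2r// exprn_gt0.
  apply/eqP; apply: contraT => am0; have am : 0 < `|a m| by rewrite normr_gt0.
  set K := B / r ^+ m.+1 in key.
  have K1 : 0 < `|K| + 1 by rewrite ltr_wpDl.
  (* [x] lies in the interval where [f] vanishes and makes the bound of [key]
     smaller than [`|a m|] *)
  pose x := Num.min (r1 / 2) (`|a m| / (2 * (`|K| + 1))).
  have x0 : 0 < x by rewrite lt_min !divr_gt0// mulr_gt0.
  have xr1 : x < r1.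
    by rewrite (@le_lt_trans _ _ (r1 / 2)) ?ge_min ?lexx// ltr_pdivrMr// ltr_pMr// ltr1n.
  have := key x x0 xr1; apply: contraLR => _; rewrite -ltNge.
  apply: (@le_lt_trans _ _ (x * (`|K| + 1))).
    by rewrite ler_wpM2l ?(ltW x0)// (le_trans (ler_norm K))// lerDl.
  apply: (@le_lt_trans _ _ (`|a m| / 2)); last first.
    by rewrite ltr_pdivrMr// ltr_pMr// ltr1n.
  rewrite -ler_pdivlMr// (@le_trans _ _ (`|a m| / (2 * (`|K| + 1)))) ?ge_min ?lexx ?orbT//.
  by rewrite invfM mulrA.
move=> x /fa h; apply/esym/(cvg_unique _ _ h) => //.
apply: cvg_near_cst; apply: nearW => n.
by rewrite /psum big1// => i _; rewrite a0 mul0r.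
Qed.

End power_series.

(** * Continuation to negative curvature *)

Section laplace.
Local Open Scope ereal_scope.
Context d (T : measurableType d) (R : realType).
Variables (mu : {measure set T -> \bar R}) (D : set T) (mD : measurable D).
Variables (g w : T -> R).
Hypotheses (mg : measurable_fun D g) (mw : measurable_fun D w).
Hypotheses (g0 : forall x, D x -> (0 <= g x)%R) (w0 : forall x, D x -> (0 <= w x)%R).

Let A (k : nat) : \bar R := \int[mu]_(x in D) (g x * exp_coeff (w x) k)%:E.
Let L (r : R) : \bar R := \int[mu]_(x in D) (g x * expR (r * w x))%:E.

Let mexp k : measurable_fun D (fun x => g x * exp_coeff (w x) k)%R.
Proof.
apply: measurable_funM => //; apply: measurable_funM => //.
exact: measurable_funX.
Qed.

Let A0 k : 0 <= A k.
Proof.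
by apply: integral_ge0 => x Dx; rewrite lee_fin mulr_ge0 ?g0// exp_coeff_ge0 ?w0.
Qed.

Let expR_series (x : R) : (0 <= x)%R ->
  (expR x)%:E = \sum_(k <oo) (exp_coeff x k)%:E.
Proof.
move=> x0; rewrite /expR -EFin_lim; last exact: is_cvg_series_exp_coeff.
by congr (limn _); apply/funext => n; rewrite /= sumEFin.
Qed.

Let LE r : (0 <= r)%R -> L r = \sum_(k <oo) ((r ^+ k)%:E * A k).
Proof.
move=> r0; rewrite /L.
transitivity (\int[mu]_(x in D)
    \sum_(k <oo) ((r ^+ k)%:E * (g x * exp_coeff (w x) k)%:E)).
  apply: eq_integral => x /[!inE] Dx.
  rewrite EFinM expR_series ?mulr_ge0 ?w0// -nneseriesZl; last first.
    by move=> k _; rewrite lee_fin exp_coeff_ge0// mulr_ge0 ?w0.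
  apply: eq_eseriesr => k _; rewrite -!EFinM; congr EFin.
  by rewrite /exp_coeff/= exprMn; ring.
rewrite integral_nneseries//.
- apply: eq_eseriesr => k _; rewrite ge0_integralZl//.
  + exact/measurable_EFinP.
  + by move=> x Dx; rewrite lee_fin mulr_ge0 ?g0// exp_coeff_ge0 ?w0.
  + by rewrite lee_fin exprn_ge0.
- move=> k; under eq_fun do rewrite -EFinM; apply/measurable_EFinP.
  by apply: measurable_funM.
- move=> k x Dx; rewrite mule_ge0// lee_fin ?exprn_ge0// mulr_ge0 ?g0//.
  by rewrite exp_coeff_ge0 ?w0.
Qed.

(** Expand the exponential: all terms are nonnegative, so sum and integral
    commute, and finiteness at [r] is absolute convergence at [r]. *)
Lemma laplace_power_series r : (0 < r)%R -> L r < +oo ->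
  has_power_series r (fun x => fine (L x)).
Proof.
move=> r0 Lr.
have Afin k : A k \is a fin_num.
  rewrite ge0_fin_numE//; rewrite ltNge leye_eq; apply/negP => /eqP Ak.
  move: Lr; rewrite LE ?(ltW r0)// ltNge => /negP; apply.
  apply: (@le_trans _ _ ((r ^+ k)%:E * A k)).
    by rewrite Ak gt0_muley ?lexx// lte_fin exprn_gt0.
  have F0 i : 0 <= (r ^+ i)%:E * A i by rewrite mule_ge0// lee_fin exprn_ge0// ltW.
  apply: le_trans (nneseries_lim_ge (m := 0) (P := xpredT) k.+1 (fun i _ _ => F0 i)).
  by rewrite big_nat_recr//= leeDr// sume_ge0.
have psumE x n : (psum (fun k => fine (A k)) x n)%:E = \sum_(0 <= k < n) ((x ^+ k)%:E * A k).
  rewrite /psum -sumEFin big_mkord; apply: eq_bigr => k _.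
  by rewrite EFinM fineK// muleC.
have L0 x : 0 <= L x.
  by apply: integral_ge0 => t Dt; rewrite lee_fin mulr_ge0 ?g0// expR_ge0.
have Lfin x : (0 <= x <= r)%R -> L x \is a fin_num.
  move=> /andP[x0 xr]; rewrite ge0_fin_numE//; apply: le_lt_trans Lr.
  apply: ge0_le_integral => //.
  - by move=> t Dt; rewrite lee_fin mulr_ge0 ?g0// expR_ge0.
  - apply/measurable_EFinP/measurable_funM => //; apply: measurableT_comp => //.
    exact: measurable_funM.
  - apply/measurable_EFinP/measurable_funM => //; apply: measurableT_comp => //.
    exact: measurable_funM.
  - by move=> t Dt; rewrite lee_fin ler_wpM2l ?g0// ler_expR ler_wpM2r// w0.
exists (fun k => fine (A k)).
  exists (fine (L r)) => n.
  have -> : psum (fun k => `|fine (A k)|%R) r n = psum (fun k => fine (A k)) r n.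
    by apply: eq_bigr => k _; rewrite ger0_norm// fine_ge0.
  rewrite -lee_fin psumE fineK ?Lfin ?lexx ?(ltW r0)// LE ?(ltW r0)//.
  by apply: nneseries_lim_ge => k _ _; rewrite mule_ge0// lee_fin exprn_ge0// ltW.
move=> x x0r; have /andP[x0 _] := x0r.
have h : \sum_(0 <= k < n) ((x ^+ k)%:E * A k) @[n --> \oo] --> (fine (L x))%:E.
  rewrite fineK ?Lfin// LE//.
  by apply: is_cvg_nneseries => k _ _; rewrite mule_ge0// lee_fin exprn_ge0.
rewrite (_ : psum _ x = fine \o (fun n => \sum_(0 <= k < n) ((x ^+ k)%:E * A k))).
  exact: fine_cvg.
by apply/funext => n; rewrite /= -psumE.
Qed.

End laplace.

Section continuation.
Context {R : realType}.
Notation mu := (@lebesgue_measure R).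
Notation pos := (`]0, +oo[%classic : set R).
Variables (m : nat) (tau : 'I_m -> R) (kappa : R).
Hypotheses (t0 : forall j, 0 < tau j) (em : ~~ odd m)
  (kt : forall j, - (tau j ^+ 2) <= kappa) (k0 : kappa <= 0).

Let r := 1 - kappa.
Let r1 : 1 <= r. Proof. by rewrite lerDl oppr_ge0. Qed.
Let r0 : 0 < r. Proof. exact: lt_le_trans r1. Qed.

Let cone_mass_laplace (x : R) : cone_mass (1 - x) tau =
  (\int[mu \x lebesgue_tuple R m]_(z in pos `*` @orthant R m)
    (cone_density 1 tau z.1 z.2 * expR (x * (sqn z.2 / 2)))%:E)%E.
Proof.
have E z : cone_density (1 - x) tau z.1 z.2 =
    cone_density 1 tau z.1 z.2 * expR (x * (sqn z.2 / 2)).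
  rewrite /cone_density [RHS]mulrAC; congr (_ * _).
  by rewrite -expRD; congr expR; ring.
under eq_integral do rewrite -E.
rewrite integral_prod_dom//.
- exact: measurable_orthant.
- by apply/measurable_EFinP/measurable_funTS; exact: measurable_cone_density2.
- by move=> z _; rewrite lee_fin cone_density_ge0.
Qed.

(** In the variable [x = 1 - kappa] the curvature enters only through
    [exp (x * |t| ^+ 2 / 2)], a Laplace transform of a positive measure. *)
Lemma cone_mass_power_series : (cone_mass kappa tau < +oo)%E ->
  has_power_series r (fun x => fine (cone_mass (1 - x) tau)).
Proof.
move=> koo; apply: has_power_series_eq (laplace_power_series (mu := (mu \x lebesgue_tuple R m)%E)
  (D := pos `*` @orthant R m) (g := fun z => cone_density 1 tau z.1 z.2)
  (w := fun z => sqn z.2 / 2) _ _ _ _ _ r0 _) => //.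
- by move=> x _; rewrite cone_mass_laplace.
- by apply: measurableX => //; exact: measurable_orthant.
- by apply: measurable_funTS; exact: measurable_cone_density2.
- apply: measurable_funTS; apply: measurable_funM => //.
  by apply: measurableT_comp; [exact: measurable_sqn|exact: measurable_snd].
- by move=> z _; exact: cone_density_ge0.
- by move=> z _; rewrite divr_ge0// sumr_ge0// => i _; rewrite sqr_ge0.
- by rewrite -cone_mass_laplace /r opprB addrC subrK.
Qed.

Let rho_pos (y : R) : R := Num.max (rho 1 tau y) 0.
Let rho_neg (y : R) : R := Num.max (- rho 1 tau y) 0.

Let rho_pos_neg y : rho 1 tau y = rho_pos y - rho_neg y.
Proof.
rewrite /rho_pos /rho_neg; case: (leP (rho 1 tau y) 0) => h.
  by rewrite max_l ?sub0r ?opprK// oppr_ge0.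
by rewrite max_r ?subr0// oppr_le0 ltW.
Qed.

Let rhoE x y : rho (1 - x) tau y = rho 1 tau y * expR (x * (y ^+ 2 / 2)).
Proof.
by rewrite /rho [RHS]mulrAC -expRD; congr (expR _ * _); ring.
Qed.

Let integrable_parts (h : R -> R) (x : R) : measurable_fun pos h -> x <= r ->
  (forall y, 0 <= h y <= `|rho 1 tau y|) ->
  mu.-integrable pos (fun y => (h y * expR (x * (y ^+ 2 / 2)))%:E).
Proof.
move=> mh xr hh.
have ir : mu.-integrable pos (EFin \o rho (1 - x) tau).
  by apply: integrable_rho => // j; rewrite (le_trans (kt j))// lerBrDl -lerBrDr.
apply: (le_integrable (@measurable_pos R) _ _ ir).
  apply/measurable_EFinP/measurable_funM => //; apply: measurable_funTS.
  apply: measurableT_comp => //; apply: measurable_funM => //.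
  by apply: measurable_funM => //; exact: measurable_funX.
move=> y _; rewrite lee_fin rhoE [leLHS]normrM [leRHS]normrM ler_wpM2r//.
by have /andP[h0 hr] := hh y; rewrite ger0_norm.
Qed.

Let rho_pos_bound y : 0 <= rho_pos y <= `|rho 1 tau y|.
Proof. by rewrite /rho_pos le_max lexx orbT ge_max ler_norm normr_ge0. Qed.

Let rho_neg_bound y : 0 <= rho_neg y <= `|rho 1 tau y|.
Proof. by rewrite /rho_neg le_max lexx orbT ge_max -normrN ler_norm normr_ge0. Qed.

Let measurable_rho_pos : measurable_fun pos rho_pos.
Proof. by apply: measurable_maxr => //; exact: measurable_rho. Qed.

Let measurable_rho_neg : measurable_fun pos rho_neg.
Proof.
by apply: measurable_maxr => //; apply: measurableT_comp => //; exact: measurable_rho.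
Qed.

Let rho_laplace (h : R -> R) (x : R) : R :=
  \int[mu]_(y in pos) (h y * expR (x * (y ^+ 2 / 2))).

Let rho_laplace_power_series (h : R -> R) : measurable_fun pos h ->
  (forall y, 0 <= h y <= `|rho 1 tau y|) -> has_power_series r (rho_laplace h).
Proof.
move=> mh hh.
have h0 y : 0 <= h y by case/andP: (hh y).
apply: (laplace_power_series (mu := mu) (D := pos) (g := h)
  (w := fun y => y ^+ 2 / 2) _ _ _ _ _ r0 _) => //.
- by apply: measurable_funTS; apply: measurable_funM => //; exact: measurable_funX.
- by move=> y _; rewrite divr_ge0// sqr_ge0.
- have /integrableP[_] := integrable_parts mh (lexx r) hh.
  apply: le_lt_trans; rewrite le_eqVlt; apply/orP; left; apply/eqP.
  by apply: eq_integral => y _; rewrite gee0_abs// lee_fin mulr_ge0// expR_ge0.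
Qed.

(** The function [rho 1 tau] changes sign, so [laplace_power_series] is applied
    to its positive and negative parts, with [w := y ^+ 2 / 2]. *)
Lemma integral_rho_power_series :
  has_power_series r (fun x => \int[mu]_(y in pos) rho (1 - x) tau y).
Proof.
apply: has_power_series_eq (has_power_series_add (ltW r0)
  (rho_laplace_power_series measurable_rho_pos rho_pos_bound)
  (has_power_series_scale (-1)
    (rho_laplace_power_series measurable_rho_neg rho_neg_bound))) => x /andP[_ xr].
rewrite mulN1r /rho_laplace -RintegralB//; last 2 first.
- exact: integrable_parts.
- exact: integrable_parts.
by apply: eq_Rintegral => y _; rewrite rhoE rho_pos_neg mulrBl.
Qed.

(** Both sides are power series in [1 - kappa], the factor [kappa ^+ m./2] being
    a polynomial, and they agree on [0 < kappa < 1] by [cone_mass_pos]. *)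
Lemma cone_mass_continuation : (cone_mass kappa tau < +oo)%E ->
  kappa ^+ m./2 * fine (cone_mass kappa tau) = cone_value kappa tau.
Proof.
move=> koo.
pose f x := (1 - x) ^+ m./2 * fine (cone_mass (1 - x) tau) +
   (- 1) * cone_value (1 - x) tau.
have hf : has_power_series r f.
  apply: has_power_series_add; first exact: ltW.
    by apply: has_power_series_mul1B; [exact: ltW|exact: cone_mass_power_series].
  apply: has_power_series_scale; apply: has_power_series_scale.
  apply: has_power_series_eq (has_power_series_add (ltW r0)
    (has_power_series_cst (Num.sqrt (pi / 2) ^+ m * (pi / 2)) (ltW r0))
    (has_power_series_scale (-1) integral_rho_power_series)) => x _.
  by rewrite mulN1r.
have f0 x : 0 < x < 1 -> f x = 0.
  move=> /andP[x0 x1]; have x'0 : 0 < 1 - x by rewrite subr_gt0.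
  by have [_] := cone_mass_pos x'0 t0 em; rewrite /f => ->; rewrite mulN1r subrr.
have := power_series_identity ltr01 r1 hf f0 (x := r).
have rK : 1 - r = kappa by rewrite /r; ring.
by rewrite (ltW r0) lexx /f rK mulN1r => /(_ isT) /subr0_eq.
Qed.

End continuation.

(** * The volume as an integral over the open simplex *)

Section orthosimplex_volume.
Context {R : realType}.
Notation mu := (@lebesgue_measure R).
Notation pos := (`]0, +oo[%classic : set R).

Lemma dotp_ge0 d (tau : 'I_d -> R) (t : d.-tuple R) : (forall j, 0 < tau j) ->
  (forall j, 0 <= tnth t j) -> 0 <= dotp tau t.
Proof. by move=> t0 h; apply: sumr_ge0 => j _; rewrite mulr_ge0// ltW. Qed.

(** The barycentric coordinates of [t] are the [tau j * tnth t j] and, for the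
    vertex [0], the remainder [1 - dotp tau t]. *)
Lemma orthosimplexE d (tau : 'I_d -> R) (t : d.-tuple R) : (forall j, 0 < tau j) ->
  orthosimplex tau (\row_j tnth t j) <->
  (forall j, 0 <= tnth t j) /\ dotp tau t <= 1.
Proof.
move=> t0; split.
  move=> [n [w [p [w0 w1 pV]]]] /rowP E.
  have tE j : tnth t j = \sum_(i < n) w i * p i ord0 j.
    by have := E j; rewrite mxE => ->; rewrite summxE; apply: eq_bigr => i _; rewrite mxE.
  have p0 i j : 0 <= p i ord0 j.
    case: (pV i) => [->|[k _ <-]]; rewrite !mxE//.
    by rewrite mulr_ge0 ?ler0n// invr_ge0 ltW.
  have p1 i : \sum_(j < d) tau j * p i ord0 j <= 1.
    case: (pV i) => [->|[k _ <-]].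
      by rewrite big1// => j _; rewrite mxE mulr0.
    rewrite (bigD1 k)//= big1 ?addr0.
      by rewrite !mxE !eqxx mulr1 mulfV// gt_eqF.
    by move=> j jk; rewrite !mxE eqxx (negbTE jk) !mulr0.
  split=> [j|]; first by rewrite tE sumr_ge0// => i _; rewrite mulr_ge0.
  rewrite /dotp; under eq_bigr do rewrite tE mulr_sumr.
  rewrite exchange_big/= -w1; apply: ler_sum => i _.
  under eq_bigr do rewrite mulrCA.
  by rewrite -mulr_sumr -[leRHS]mulr1 ler_wpM2l.
move=> [h0 h1].
exists d.+1, (fun i => if unlift ord0 i is Some j then tau j * tnth t j else 1 - dotp tau t),
  (fun i => if unlift ord0 i is Some j then (tau j)^-1 *: delta_mx ord0 j else 0).
split.
- move=> i; case: unliftP => [j|] _; last by rewrite subr_ge0.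
  by rewrite mulr_ge0// ltW.
- rewrite big_ord_recl unlift_none; under eq_bigr do rewrite liftK.
  by rewrite -/(dotp tau t) subrK.
- move=> i; case: unliftP => [j|] _; last by left.
  by right; exists j.
- rewrite big_ord_recl unlift_none scaler0 add0r; under eq_bigr do rewrite liftK scalerA.
  apply/rowP => k; rewrite mxE summxE (bigD1 k)//= big1 ?addr0.
    by rewrite !mxE !eqxx mulr1 mulrAC mulfV ?mul1r// gt_eqF.
  by move=> j jk; rewrite !mxE eqxx eq_sym (negbTE jk) mulr0.
Qed.

Lemma enorm_sqr d (t : d.-tuple R) : enorm (\row_j tnth t j) ^+ 2 = sqn t.
Proof.
rewrite /enorm sqr_sqrtr; last by rewrite sumr_ge0// => j _; rewrite sqr_ge0.
by apply: eq_bigr => j _; rewrite mxE.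
Qed.

Lemma sqn_ge0 d (t : d.-tuple R) : 0 <= sqn t.
Proof. by rewrite sumr_ge0// => j _; rewrite sqr_ge0. Qed.

Lemma klein_ballE d (kappa : R) (t : d.-tuple R) :
  klein_ball kappa (\row_j tnth t j) <-> 0 < 1 + kappa * sqn t.
Proof.
rewrite /klein_ball; case: (leP 0 kappa) => k0.
  by split=> // _; rewrite ltr_wpDr// mulr_ge0// sqn_ge0.
have nk0 : 0 < - kappa by rewrite oppr_gt0.
rewrite /= div1r; set e := enorm _.
have e0 : 0 <= e by exact: sqrtr_ge0.
have es0 : 0 <= e * Num.sqrt (- kappa) by rewrite mulr_ge0.
rewrite -div1r ltr_pdivlMr ?sqrtr_gt0//.
rewrite -(@expr_lt1 _ 2)// exprMn (@sqr_sqrtr _ (- kappa)) ?(ltW nk0)// /e enorm_sqr.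
by rewrite (_ : (_ < 1) = (0 < 1 + kappa * sqn t))// -subr_gt0; congr (0 < _); ring.
Qed.

Definition open_simplex d (tau : 'I_d -> R) : set (d.-tuple R) :=
  [set t | orthant t /\ dotp tau t <= 1].

(** Each [a j] is smaller than the sum because there is another index. *)
Lemma sum_sqr_lt d (a : 'I_d -> R) : (2 <= d)%N -> (forall j, 0 < a j) ->
  \sum_j a j ^+ 2 < (\sum_j a j) ^+ 2.
Proof.
case: d a => [|[|d]]// a _ a0.
rewrite expr2 mulr_suml; apply: ltr_sum.
  by apply/hasP; exists ord0; rewrite ?mem_index_enum.
move=> j _; rewrite expr2 ltr_pM2l// (bigD1 j)//= ltrDl.
pose k : 'I_d.+2 := if j == ord0 then ord_max else ord0.
have kj : k != j by rewrite /k; case: (eqVneq j ord0) => [->//|]; rewrite eq_sym.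
by rewrite (bigD1 k)//= ltr_pwDl// sumr_ge0// => i _; exact: ltW.
Qed.

Lemma sqn_ge_sum_sqr d (tau : 'I_d -> R) (kappa : R) (t : d.-tuple R) :
  (forall j, - (tau j ^+ 2) <= kappa) ->
  - \sum_j (tau j * tnth t j) ^+ 2 <= kappa * sqn t.
Proof.
move=> kt; rewrite -sumrN /sqn mulr_sumr; apply: ler_sum => j _.
by rewrite exprMn -mulNr ler_wpM2r// sqr_ge0.
Qed.

(** Off the coordinate hyperplanes the point is not a vertex, so the strict
    inequality [sum_sqr_lt] keeps it inside the Klein ball even when some
    vertices lie on the boundary sphere. *)
Lemma open_simplex_gt0 d (tau : 'I_d -> R) (kappa : R) (t : d.-tuple R) :
  (2 <= d)%N -> (forall j, 0 < tau j) -> (forall j, - (tau j ^+ 2) <= kappa) ->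
  open_simplex tau t -> 0 < 1 + kappa * sqn t.
Proof.
move=> d2 t0 kt [ot t1].
have h : \sum_j (tau j * tnth t j) ^+ 2 < 1.
  apply: (@lt_le_trans _ _ (dotp tau t ^+ 2)).
    by apply: sum_sqr_lt => // j; rewrite mulr_gt0.
  by rewrite expr_le1// dotp_ge0// => j; exact/ltW/ot.
have := sqn_ge_sum_sqr t kt; lra.
Qed.

Lemma measurable_halfspace d (tau : 'I_d -> R) :
  measurable [set t | dotp tau t <= 1].
Proof.
rewrite -[X in measurable X]setTI.
have -> : [set t | dotp tau t <= 1] = dotp tau @^-1` `]-oo, 1].
  by apply/seteqP; split => t /=; rewrite in_itv.
by apply: measurable_dotp.
Qed.

Lemma measurable_open_simplex d (tau : 'I_d -> R) : measurable (open_simplex tau).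
Proof.
have -> : open_simplex tau = @orthant R d `&` [set t | dotp tau t <= 1] by [].
by apply: measurableI; [exact: measurable_orthant|exact: measurable_halfspace].
Qed.

Definition vol_density (kappa : R) d (t : d.-tuple R) : R :=
  ((1 + kappa * sqn t) `^ (d.+1%:R / 2))^-1.

Lemma vol_density_ge0 (kappa : R) d (t : d.-tuple R) : 0 <= vol_density kappa t.
Proof. by rewrite invr_ge0 powR_ge0. Qed.

Lemma measurable_vol_density (kappa : R) d : measurable_fun setT (@vol_density kappa d).
Proof.
rewrite /vol_density; under eq_fun do rewrite -powRN.
apply: (@measurableT_comp _ _ _ _ _ _ (fun x : R => x `^ (- (d.+1%:R / 2)))).
  exact: measurable_powR.
by apply: measurable_funD => //; apply: measurable_funM => //; exact: measurable_sqn.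
Qed.

Lemma lebesgue_tuple_hyperplane d (j : 'I_d) :
  lebesgue_tuple R d [set t | tnth t j = 0] = 0%E.
Proof.
pose A i : set R := if i == j then [set 0] else setT.
have mA i : measurable (A i) by rewrite /A; case: ifP.
have -> : [set t : d.-tuple R | tnth t j = 0] = [set t | forall i, A i (tnth t i)].
  apply/seteqP; split => t /=.
    by move=> tj i; rewrite /A; case: eqP => [->|].
  by move=> /(_ j); rewrite /A eqxx.
rewrite lebesgue_tuple_box//.
rewrite (bigD1 j)//= {1}/A eqxx lebesgue_measure_set1 mul0e//.
Qed.

(** They contain every point of the simplex that is not in [open_simplex], in
    particular the vertices, where the density may be singular. *)
Definition coord_hyperplanes d : set (d.-tuple R) := [set t | exists j, tnth t j = 0].

Lemma measurable_coord_hyperplanes d : measurable (@coord_hyperplanes d).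
Proof.
have -> : @coord_hyperplanes d = \bigcup_(j in [set: 'I_d]) [set t | tnth t j = 0].
  by apply/seteqP; split => t /= [j]; exists j.
apply: fin_bigcup_measurable => // j _.
rewrite -[X in measurable X]setTI.
have -> : [set t : d.-tuple R | tnth t j = 0] = (@tnth _ R ^~ j) @^-1` [set 0] by [].
by apply: measurable_tnth.
Qed.

Lemma lebesgue_coord_hyperplanes d : lebesgue_tuple R d (@coord_hyperplanes d) = 0%E.
Proof.
apply: measure_negligible; first exact: measurable_coord_hyperplanes.
have -> : @coord_hyperplanes d =
    \bigcup_k [set t | exists2 j : 'I_d, j = k :> nat & tnth t j = 0].
  apply/seteqP; split => t /=.
    by move=> [j tj]; exists j => //; exists j.
  by move=> [k _ [j _ tj]]; exists j.
apply: negligible_bigcup => k.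
case: (ltnP k d) => kd; last first.
  have -> : [set t : d.-tuple R | exists2 j : 'I_d, j = k :> nat & tnth t j = 0] = set0.
    by apply/seteqP; split => t //= [j jk]; have := ltn_ord j; rewrite jk ltnNge kd.
  exact: negligible_set0.
have -> : [set t : d.-tuple R | exists2 j : 'I_d, j = k :> nat & tnth t j = 0] =
    [set t | tnth t (Ordinal kd) = 0].
  apply/seteqP; split => t /=; last by exists (Ordinal kd).
  by move=> [j jk tj]; rewrite (_ : Ordinal kd = j)//; exact: val_inj.
apply/negligibleP; last exact: lebesgue_tuple_hyperplane.
rewrite -[X in measurable X]setTI.
have -> : [set t : d.-tuple R | tnth t (Ordinal kd) = 0] =
  (@tnth _ R ^~ (Ordinal kd)) @^-1` [set 0] by [].
by apply: measurable_tnth.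
Qed.

Lemma riemannian_volE d (tau : 'I_d -> R) (kappa : R) :
  (2 <= d)%N -> (forall j, 0 < tau j) -> (forall j, - (tau j ^+ 2) <= kappa) ->
  (riemannian_vol kappa (orthosimplex tau) =
   \int[lebesgue_tuple R d]_(t in open_simplex tau) (vol_density kappa t)%:E)%E.
Proof.
move=> d2 t0 kt; rewrite /riemannian_vol.
set D := [set t | _].
have DE : D = [set t | forall j, 0 <= tnth t j] `&` [set t | dotp tau t <= 1] `&`
    [set t | 0 < 1 + kappa * sqn t].
  apply/seteqP; split => t /=.
    by move=> [/(orthosimplexE _ t0) ? /klein_ballE].
  by move=> [? /klein_ballE ?]; split => //; exact/(orthosimplexE _ t0).
have mD : measurable D.
  rewrite DE; apply: measurableI.
    apply: measurableI.
      apply: (@measurable_tuple_forall R d (fun=> [set x | 0 <= x])) => i.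
      by rewrite -set_itvcy; exact: measurable_itv.
    exact: measurable_halfspace.
  rewrite -[X in measurable X]setTI.
  have -> : [set t : d.-tuple R | 0 < 1 + kappa * sqn t] =
      (fun t => 1 + kappa * sqn t) @^-1` `]0, +oo[.
    by apply/seteqP; split => t /=; rewrite in_itv/= andbT.
  apply: measurable_funD => //; apply: measurable_funM => //; exact: measurable_sqn.
under eq_integral do rewrite enorm_sqr -/(vol_density kappa _).
rewrite (@ge0_negligible_integral _ _ _ _ _ (@coord_hyperplanes d))//.
- congr (integral _ _ _); rewrite DE; apply/seteqP; split => t /=.
    move=> [[[t0' t1] _] nt]; split => // j.
    by rewrite lt_neqAle t0' andbT eq_sym; apply/eqP => tj; apply: nt; exists j.
  move=> St; have [ot t1] := St; split.
    split; last exact: (open_simplex_gt0 d2 t0 kt).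
    by split => // j; exact/ltW/ot.
  by move=> [j tj]; have := ot j; rewrite tj ltxx.
- exact: measurable_coord_hyperplanes.
- by apply/measurable_EFinP/measurable_funTS; exact: measurable_vol_density.
- by move=> t _; rewrite lee_fin vol_density_ge0.
- exact: lebesgue_coord_hyperplanes.
Qed.

End orthosimplex_volume.

(** * Gamma integrals and the Gaussian tail *)

Section gamma_volume.
Context {R : realType}.
Notation mu := (@lebesgue_measure R).
Notation pos := (`]0, +oo[%classic : set R).

Lemma measurable_gamma_integrand (p : R) :
  measurable_fun setT (fun u : R => u `^ (p - 1) * expR (- u)).
Proof.
by apply: measurable_funM => //; exact: measurableT_comp.
Qed.

(** From [ln x <= x - 1], the power is at most a constant times [expR (u / 2)]. *)
Lemma integrable_gamma (p : R) : 1 < p ->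
  mu.-integrable pos (fun u => (u `^ (p - 1) * expR (- u))%:E).
Proof.
move=> p1; pose q := p - 1; have q0 : 0 < q by rewrite subr_gt0.
pose C := expR (q * (ln (2 * q) - 1)).
have h2 : (0 : R) < 2^-1 by rewrite invr_gt0.
apply: (le_integrable (@measurable_pos R) _ _
  (integrableZl (@measurable_pos R) C (integrable_expRN h2))).
  by apply/measurable_EFinP/measurable_funTS; exact: measurable_gamma_integrand.
move=> u; rewrite /= in_itv/= andbT => u0.
rewrite lee_fin ger0_norm ?mulr_ge0 ?powR_ge0 ?expR_ge0//.
rewrite ger0_norm ?mulr_ge0 ?expR_ge0//.
rewrite -/q /powR gt_eqF// -!expRD ler_expR.
have h : ln (u / (2 * q)) <= u / (2 * q) - 1.
  have -> : u / (2 * q) = 1 + (u / (2 * q) - 1) by ring.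
  rewrite [leRHS](_ : _ = u / (2 * q) - 1); last by ring.
  by apply: le_ln1Dx; rewrite ltrBrDr addNr divr_gt0// mulr_gt0.
move: h; rewrite ln_div ?posrE ?mulr_gt0// => h.
have : q * ln u <= q * (u / (2 * q) - 1 + ln (2 * q)) by rewrite ler_wpM2l ?(ltW q0)// -lerBlDr.
have -> : q * (u / (2 * q) - 1 + ln (2 * q)) = u / 2 + q * (ln (2 * q) - 1).
  by field; rewrite gt_eqF.
by lra.
Qed.

Lemma GammaE (p : R) : 1 < p ->
  (\int[mu]_(u in pos) (u `^ (p - 1) * expR (- u))%:E = (Gamma p)%:E)%E.
Proof.
move=> p1; rewrite /Gamma /Rintegral fineK//.
exact: integrable_fin_num (integrable_gamma p1).
Qed.

Lemma Gamma_gt0 (p : R) : 1 < p -> 0 < Gamma p.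
Proof.
move=> p1; rewrite -lte_fin -GammaE//.
apply: (@lt_le_trans _ _ (\int[mu]_(u in `[1%R, 2%R]) (cst (expR (- 2)%R)%:E u))%E).
  rewrite integral_cst//= lebesgue_measure_itv/= lte_fin ltr1n -EFinB -EFinM lte_fin.
  by rewrite mulr_gt0 ?expR_gt0// subr_gt0 ltr1n.
apply: (@le_trans _ _ (\int[mu]_(u in `[1%R, 2%R]) (u `^ (p - 1) * expR (- u))%:E)%E).
  apply: ge0_le_integral => //.
  - by move=> u _; rewrite lee_fin expR_ge0.
  - by apply/measurable_EFinP/measurable_funTS; exact: measurable_gamma_integrand.
  - move=> u /=; rewrite in_itv/= => /andP[u1 u2].
    rewrite lee_fin -[leLHS]mul1r ler_pM ?expR_ge0 ?ler_expR ?lerN2//.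
    by rewrite -[leLHS](powRr0 u) ler_powR// subr_ge0 ltW.
apply: ge0_subset_integral => //.
- by apply/measurable_EFinP/measurable_funTS; exact: measurable_gamma_integrand.
- by move=> u _; rewrite lee_fin mulr_ge0 ?powR_ge0 ?expR_ge0.
- by move=> u /=; rewrite !in_itv/= => /andP[u1 _]; rewrite andbT (lt_le_trans ltr01).
Qed.

Lemma gamma_dilation (p b : R) : 1 < p -> 0 < b ->
  (\int[mu]_(u in pos) (u `^ (p - 1) * expR (- (u * b)))%:E =
   (Gamma p * (b `^ p)^-1)%:E)%E.
Proof.
move=> p1 b0.
have := GammaE p1; rewrite (integral_dilation b0)//; last 2 first.
- by apply/measurable_EFinP/measurable_funTS; exact: measurable_gamma_integrand.
- by move=> u _; rewrite lee_fin mulr_ge0 ?powR_ge0 ?expR_ge0.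
set I := (\int[mu]_(u in pos) (u `^ (p - 1) * expR (- (u * b)))%:E)%E => E.
have : (b%:E * ((b `^ (p - 1))%:E * I) = (Gamma p)%:E)%E.
  rewrite -E; congr (_ * _)%E; rewrite -ge0_integralZl//.
  - apply: eq_integral => u /[!inE]/=; rewrite in_itv/= andbT => u0.
    by rewrite -EFinM powRM ?(ltW b0) ?(ltW u0)// mulrA (mulrC u b).
  - apply/measurable_EFinP/measurable_funTS; apply: measurable_funM.
      exact: measurable_powR.
    by apply: measurableT_comp => //; apply: measurableT_comp => //; exact: measurable_funM.
  - by move=> u _; rewrite lee_fin mulr_ge0 ?powR_ge0 ?expR_ge0.
  - by rewrite lee_fin powR_ge0.
rewrite muleA -EFinM -[X in (X * _)%:E](powRr1 (ltW b0)) -powRD; last first.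
  by rewrite (gt_eqF b0) /= implybT.
rewrite addrC subrK => H.
have bp : b `^ p != 0 by rewrite gt_eqF// powR_gt0.
by rewrite EFinM -H muleC muleA -EFinM mulVf// mul1e.
Qed.

Let v (u : R) : R := Num.sqrt (2 * u).

Let v_gt0 (u : R) : 0 < u -> 0 < v u.
Proof. by move=> u0; rewrite sqrtr_gt0 mulr_gt0. Qed.

Let v_sqr (u : R) : 0 <= u -> v u ^+ 2 = 2 * u.
Proof. by move=> u0; rewrite sqr_sqrtr// mulr_ge0. Qed.

Let is_derive_v (u : R) : 0 < u -> is_derive u 1 v (v u)^-1.
Proof.
move=> u0; have h := @is_derive1_sqrt R (2 * u) (mulr_gt0 (ltr0Sn R 1) u0).
apply: is_derive_eq (@is_derive1_comp R Num.sqrt (fun x => 2 * x) u _ _ h (is_derive_mulc 2 u)) _.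
by rewrite -/(v u); field; rewrite gt_eqF// v_gt0.
Qed.

Let cvg_v : v u @[u --> +oo] --> +oo.
Proof.
apply/cvgryPge => A; near=> u; have [A0|A0] := leP A 0.
  by rewrite (le_trans A0)// sqrtr_ge0.
have uA : A ^+ 2 <= u by near: u; by apply: nbhs_pinfty_ge; rewrite num_real.
have u0 : 0 <= u by rewrite (le_trans _ uA)// sqr_ge0.
rewrite -(@ler_sqr R) ?nnegrE ?sqrtr_ge0 ?(ltW A0)// v_sqr//.
by rewrite (le_trans uA)// ler_peMl// ler1n.
Unshelve. all: end_near. Qed.

(** The substitution [s = sqrt (2 u) - x]. *)
Lemma gauss_tail (x : R) : 0 < x ->
  (\int[mu]_(u in `[(x ^+ 2 / 2)%R, +oo[) ((v u)^-1 * expR (- u))%:E =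
   \int[mu]_(s in pos) (hgauss (s + x))%:E)%E.
Proof.
move=> x0; set a := x ^+ 2 / 2.
have a0 : 0 < a by rewrite divr_gt0// exprn_gt0.
pose F u := v u - x; pose G s := hgauss (s + x).
have dF (u : R) : 0 < u -> is_derive u 1 F (v u)^-1.
  move=> u0; apply: is_derive_eq (is_deriveB (is_derive_v u0) (is_derive_cst x u (1 : R))) _.
  by rewrite subr0.
have F' (u : R) : 0 < u -> derive1 F u = (v u)^-1.
  by move=> u0; rewrite derive1E; have [_ ->] := dF u u0.
have Fa : F a = 0.
  rewrite /F /v /a (_ : 2 * (x ^+ 2 / 2) = x ^+ 2); last by field.
  by rewrite sqrtr_sqr gtr0_norm// subrr.
have cv (u : R) : 0 < u -> {for u, continuous (fun u => (v u)^-1)}.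
  move=> u0; apply: cvgV; first by rewrite gt_eqF// v_gt0.
  exact: (is_derive_continuous (is_derive_v u0)).
have cF' (u : R) : 0 < u -> derive1 F z @[z --> u] --> (v u)^-1.
  move=> u0; apply: cvg_trans (cv u u0); apply: near_eq_cvg.
  by near=> z; rewrite F'//; near: z; exact: (cvgr_gt u).
have cG : continuous G.
  move=> s; apply: (@continuous_comp _ _ _ (fun s => s + x) hgauss).
    by apply: cvgD; [exact: cvg_id|exact: cvg_cst].
  exact: continuous_hgauss.
rewrite -[RHS]/(\int[mu]_(s in pos) (G s)%:E)%E.
rewrite integral_itv_obnd_cbnd; last first.
  apply/measurable_EFinP/measurable_funTS; exact: continuous_measurable_fun.
rewrite -{1}Fa (@increasing_ge0_integration_by_substitutiony R F G a).
- apply: eq_integral => u /[!inE]/=; rewrite in_itv/= andbT => au.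
  have u0 := lt_le_trans a0 au.
  rewrite -[X in _ = X%:E]/(G (F u) * derive1 F u) F'// mulrC; congr (_ * _)%:E.
  by rewrite /G /F subrK /hgauss v_sqr ?(ltW u0)//; congr (expR (- _)); field.
- move=> u w; rewrite !in_itv/= !andbT => au aw uw.
  by rewrite ltrD2r ltr_sqrt ?mulr_gt0 ?(lt_le_trans a0 aw)// ltr_pM2l.
- move=> u; rewrite in_itv/= andbT => au.
  by rewrite /prop_for /continuous_at F' ?(lt_trans a0)//; apply: cF'; exact: lt_trans au.
- apply/cvg_ex; exists (v a)^-1; apply: cvg_at_right_filter; exact: cF'.
- apply/cvg_ex; exists 0.
  have pu : \forall u \near +oo, 0 < (u : R) by apply: nbhs_pinfty_gt; rewrite num_real.
  have : (v u)^-1 @[u --> +oo] --> (0 : R).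
    apply/gtr0_cvgV0; last exact: cvg_v.
    by apply: filterS pu => u; exact: v_gt0.
  apply: cvg_trans; apply: near_eq_cvg; apply: filterS pu => u u0.
  by rewrite F'.
- split.
    by move=> u; rewrite in_itv/= andbT => au; have [] := dF u (lt_trans a0 au).
  by apply: cvg_at_right_filter; exact: (is_derive_continuous (dF a a0)).
- apply/cvgryPge => A; near=> u; rewrite /F lerBrDr; near: u.
  by move/cvgryPge : cvg_v; exact.
- exact: continuous_subspaceT.
- by move=> s _; exact: hgauss_ge0.
Unshelve. all: end_near. Qed.

End gamma_volume.

(** * The volume as a Gaussian cone integral *)

Section gamma_cone.
Context {R : realType}.
Notation mu := (@lebesgue_measure R).
Notation pos := (`]0, +oo[%classic : set R).
Variables (d : nat) (tau : 'I_d -> R) (kappa : R).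
Hypotheses (d2 : (2 <= d)%N) (t0 : forall j, 0 < tau j)
  (kt : forall j, - (tau j ^+ 2) <= kappa).

Let p : R := d.+1%:R / 2.
Let p1 : 1 < p. Proof. by rewrite /p ltr_pdivlMr// mul1r ltr_nat. Qed.
Let Td : measurableType _ := d.-tuple R.
Let v (u : R) : R := Num.sqrt (2 * u).
Let A : set (Td * R) := [set z | dotp tau z.1 <= v z.2].
Let k (t : Td) (u : R) : R := u `^ (p - 1) * expR (- (u * (1 + kappa * sqn t))).
Let K (t : Td) (u : R) : R :=
  expR (- (kappa * sqn t / 2)) * ((v u)^-1 * expR (- u)) * \1_A (t, u).

Let mv : measurable_fun setT v.
Proof.
apply: continuous_measurable_fun => u.
apply: (@continuous_comp _ _ _ (fun u : R => 2 * u) Num.sqrt); last exact: sqrt_continuous.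
by apply: cvgMl_tmp; exact: cvg_id.
Qed.

Let mA : measurable A.
Proof.
rewrite -[X in measurable X]setTI.
have -> : A = (fun z : Td * R => dotp tau z.1 - v z.2) @^-1` `]-oo, 0].
  by apply/seteqP; split => z /=; rewrite /A/= in_itv/= subr_le0.
apply: measurable_funB => //.
  by apply: measurableT_comp; [exact: measurable_dotp|exact: measurable_fst].
by apply: measurableT_comp; [exact: mv|exact: measurable_snd].
Qed.

Let mk : measurable_fun setT (fun z : Td * R => k z.1 z.2).
Proof.
apply: measurable_funM.
  apply: (@measurableT_comp _ _ _ _ _ _ (fun u : R => u `^ (p - 1))) => //.
apply: measurableT_comp => //; apply: measurableT_comp => //.
apply: measurable_funM; first exact: measurable_snd.
apply: measurable_funD => //; apply: measurable_funM => //.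
by apply: measurableT_comp; [exact: measurable_sqn|exact: measurable_fst].
Qed.

Let mK : measurable_fun setT (fun z : Td * R => K z.1 z.2).
Proof.
apply: measurable_funM; last first.
  rewrite (_ : (fun z => _) = \1_A); last by apply/funext => -[].
  exact: measurable_indic.
apply: measurable_funM.
  apply: measurableT_comp => //; apply: measurableT_comp => //.
  apply: measurable_funM => //; apply: measurable_funM => //.
  by apply: measurableT_comp; [exact: measurable_sqn|exact: measurable_fst].
apply: measurable_funM.
  rewrite (_ : (fun z => _) = (fun z : Td * R => v z.2 `^ (-1))); last first.
    by apply/funext => z; rewrite powR_inv1// sqrtr_ge0.
  apply: (@measurableT_comp _ _ _ _ _ _ (fun u : R => u `^ (-1))) => //.
  by apply: measurableT_comp; [exact: mv|exact: measurable_snd].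
by apply: measurableT_comp => //; apply: measurableT_comp => //; exact: measurable_snd.
Qed.

Let mvV : measurable_fun setT (fun u => (v u)^-1 * expR (- u)).
Proof.
apply: measurable_funM; last exact: measurableT_comp.
rewrite (_ : (fun u => _) = (fun u => v u `^ (-1))); last first.
  by apply/funext => u; rewrite powR_inv1// sqrtr_ge0.
exact: (measurableT_comp (measurable_powR (-1)) mv).
Qed.

Let k_ge0 t u : 0 <= k t u.
Proof. by rewrite mulr_ge0 ?powR_ge0 ?expR_ge0. Qed.

Let K_ge0 t u : 0 <= K t u.
Proof.
apply: mulr_ge0; last by rewrite indicE.
by rewrite mulr_ge0 ?expR_ge0// mulr_ge0 ?expR_ge0// invr_ge0 sqrtr_ge0.
Qed.

Let v_gt0 u : 0 < u -> 0 < v u.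
Proof. by move=> u0; rewrite sqrtr_gt0 mulr_gt0. Qed.

Let v_sqr u : 0 <= u -> v u ^+ 2 = 2 * u.
Proof. by move=> u0; rewrite sqr_sqrtr// mulr_ge0. Qed.

Let C2 : R := (Num.sqrt 2)^-1 ^+ d.-1.

(** The Jacobian of the rescaling by [v u] cancels [u `^ (p - 1)] up to one factor
    [(v u)^-1], because [p - 1 = (d - 1) / 2]. *)
Let scaling_factor u : 0 < u -> (v u)^-1 ^+ d * u `^ (p - 1) = C2 * (v u)^-1.
Proof.
move=> u0; have v0 := v_gt0 u0.
have w0 : 0 <= v u / Num.sqrt 2 by rewrite divr_ge0// ltW.
have uE : u = (v u / Num.sqrt 2) ^+ 2.
  rewrite expr_div_n v_sqr ?(ltW u0)// sqr_sqrtr//.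
  by rewrite mulrAC mulfV ?mul1r.
have -> : u `^ (p - 1) = (v u / Num.sqrt 2) ^+ d.-1.
  rewrite [X in X `^ _]uE -powR_mulrn// -powRrM -powR_mulrn//; congr (_ `^ _).
  have dE : d.+1%:R = d.-1%:R + 2 :> R by rewrite -natrD addn2 prednK// ltnW.
  by rewrite /p dE; field.
rewrite /C2 expr_div_n.
have -> : (v u)^-1 ^+ d = (v u)^-1 * (v u)^-1 ^+ d.-1 by rewrite -exprS (ltn_predK d2).
rewrite !exprVn; field; rewrite !expf_neq0 ?gt_eqF// ?sqrtr_gt0//.
Qed.

Let integral_orthantZl (c : R) (f : Td -> R) : 0 <= c -> measurable_fun setT f ->
  (forall t, 0 <= f t) ->
  (c%:E * \int[lebesgue_tuple R d]_(t in @orthant R d) (f t)%:E =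
   \int[lebesgue_tuple R d]_(t in @orthant R d) (c * f t)%:E)%E.
Proof.
move=> c0 mf f0; rewrite -ge0_integralZl//.
- exact: measurable_orthant.
- exact/measurable_EFinP/measurable_funTS.
- by move=> t _; rewrite lee_fin.
Qed.

Let section_u u : 0 < u ->
  (\int[lebesgue_tuple R d]_(t in open_simplex tau) (k t u)%:E =
   C2%:E * \int[lebesgue_tuple R d]_(t in @orthant R d) (K t u)%:E)%E.
Proof.
move=> u0; have v0 := v_gt0 u0; have vi0 : 0 < (v u)^-1 by rewrite invr_gt0.
pose H : set Td := [set t | dotp tau t <= 1].
pose f (t : Td) := k t u * \1_H t.
have mf : measurable_fun setT f.
  apply: measurable_funM; last by apply: measurable_indic; exact: measurable_halfspace.
  exact: (measurableT_comp mk (measurable_pair2 u)).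
transitivity (\int[lebesgue_tuple R d]_(t in @orthant R d) (f t)%:E)%E.
  rewrite -[open_simplex tau]/(@orthant R d `&` H) integral_mkcondr.
  apply: eq_integral => t _; rewrite patchE /f indicE.
  by case: (t \in H); rewrite ?mulr1 ?mulr0.
rewrite (integral_orthant_dilation vi0); last 2 first.
- by apply/measurable_EFinP/measurable_funTS.
- by move=> t _; rewrite lee_fin mulr_ge0// indicE.
have f0 t : 0 <= f t by rewrite mulr_ge0// indicE.
rewrite (@integral_orthantZl ((v u)^-1 ^+ d) (fun t => f (scale_tuple (v u)^-1 t))); last 3 first.
- by rewrite exprn_ge0// ltW.
- exact: (measurableT_comp mf (measurable_scale_tuple _)).
- by move=> t; exact: f0.
rewrite (@integral_orthantZl C2 (fun t => K t u)); last 3 first.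
- by rewrite exprn_ge0// invr_ge0 sqrtr_ge0.
- exact: (measurableT_comp mK (measurable_pair2 u)).
- by move=> t; exact: K_ge0.
apply: eq_integral => t _; congr EFin.
rewrite /f /k /K.
have -> : sqn (scale_tuple (v u)^-1 t) = sqn t / (2 * u).
  rewrite /sqn mulr_suml; apply: eq_bigr => j _.
  by rewrite tnth_mktuple exprMn exprVn v_sqr ?(ltW u0)// mulrC.
have -> : \1_H (scale_tuple (v u)^-1 t) = \1_A (t, u) :> R.
  rewrite !indicE; congr (_%:R); congr (nat_of_bool _).
  have -> : (scale_tuple (v u)^-1 t \in H) = (dotp tau (scale_tuple (v u)^-1 t) <= 1).
    by apply/idP/idP; rewrite inE.
  have -> : ((t, u) \in A) = (dotp tau t <= v u) by apply/idP/idP; rewrite inE.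
  have -> : dotp tau (scale_tuple (v u)^-1 t) = dotp tau t / v u.
    by rewrite /dotp mulr_suml; apply: eq_bigr => j _; rewrite tnth_mktuple mulrCA mulrC.
  by rewrite ler_pdivrMr// mul1r.
have -> : - (u * (1 + kappa * (sqn t / (2 * u)))) = - (kappa * sqn t / 2) + - u.
  by field; rewrite gt_eqF.
rewrite expRD !mulrA scaling_factor//; ring.
Qed.

Let section_t t : orthant t ->
  (\int[mu]_(u in pos) (K t u)%:E = \int[mu]_(s in pos) (cone_density kappa tau s t)%:E)%E.
Proof.
move=> ot.
have x0 : 0 < dotp tau t.
  rewrite /dotp; case: d d2 tau t0 t ot => // d' _ tau' t0' t ot.
  rewrite big_ord_recl ltr_pwDl ?mulr_gt0 ?ot// sumr_ge0// => j _.
  by rewrite mulr_ge0 ?ltW.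
set x := dotp tau t in x0.
set E := expR (- (kappa * sqn t / 2)).
transitivity (E%:E * \int[mu]_(u in `[(x ^+ 2 / 2)%R, +oo[) ((v u)^-1 * expR (- u))%:E)%E.
  rewrite -ge0_integralZl//; last 3 first.
  - exact/measurable_EFinP/measurable_funTS.
  - by move=> u _; rewrite lee_fin mulr_ge0 ?expR_ge0// invr_ge0 sqrtr_ge0.
  - by rewrite lee_fin expR_ge0.
  pose B : set R := [set u | x <= v u].
  have -> : `[(x ^+ 2 / 2)%R, +oo[%classic = pos `&` B.
    apply/seteqP; split => u /=; rewrite !in_itv/= !andbT.
      move=> xu; have u0 : 0 < u by rewrite (lt_le_trans _ xu)// divr_gt0// exprn_gt0.
      split => //; rewrite /B/= -(@ler_sqr R) ?nnegrE ?sqrtr_ge0 ?(ltW x0)//.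
      by rewrite v_sqr ?(ltW u0)// mulrC -ler_pdivrMr.
    move=> [u0]; rewrite /B/= -(@ler_sqr R) ?nnegrE ?sqrtr_ge0 ?(ltW x0)//.
    by rewrite v_sqr ?(ltW u0)// mulrC -ler_pdivrMr.
  rewrite integral_mkcondr; apply: eq_integral => u _.
  rewrite patchE /K -/E indicE.
  have -> : ((t, u) \in A) = (u \in B) by apply/idP/idP; rewrite !inE.
  by case: (u \in B); rewrite ?mulr1 ?mulr0// EFinM.
rewrite gauss_tail// -ge0_integralZl//.
- apply/measurable_EFinP/measurable_funTS.
  by apply: measurableT_comp; [exact: measurable_hgauss|exact: measurable_funD].
- by move=> s _; rewrite lee_fin hgauss_ge0.
- by rewrite lee_fin expR_ge0.
Qed.

(** Write [Gamma p * b `^ (- p)] as [int u `^ (p - 1) exp (- u b) du] with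
    [b = 1 + kappa |t| ^+ 2], exchange the integrals and rescale [t] by
    [sqrt (2 u)]: the simplex becomes the condition [dotp tau t <= sqrt (2 u)],
    the curvature term loses its dependence on [u], and the [u]-integral is the
    Gaussian tail beyond [dotp tau t]. *)
Lemma Gamma_open_simplex :
  ((Gamma (d.+1%:R / 2))%:E *
     \int[lebesgue_tuple R d]_(t in open_simplex tau) (vol_density kappa t)%:E =
   ((Num.sqrt 2)^-1 ^+ d.-1)%:E * cone_mass kappa tau)%E.
Proof.
have mo := @measurable_orthant R d; have mS := measurable_open_simplex tau.
rewrite -ge0_integralZl//; last 3 first.
- by apply/measurable_EFinP/measurable_funTS; exact: measurable_vol_density.
- by move=> t _; rewrite lee_fin vol_density_ge0.
- by rewrite lee_fin ltW// Gamma_gt0.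
transitivity (\int[lebesgue_tuple R d]_(t in open_simplex tau)
    \int[mu]_(u in pos) (k t u)%:E)%E.
  apply: eq_integral => t /[!inE] St.
  by rewrite gamma_dilation//; exact: (open_simplex_gt0 d2 t0 kt St).
rewrite (@fubini_tonelli_dom _ _ _ _ _ (lebesgue_tuple R d) mu _ _ mS (@measurable_pos R)
  (fun z => (k z.1 z.2)%:E)); last 2 first.
- by apply/measurable_EFinP/measurable_funTS.
- by move=> z _; rewrite lee_fin.
transitivity (\int[mu]_(u in pos)
   (C2%:E * \int[lebesgue_tuple R d]_(t in @orthant R d) (K t u)%:E))%E.
  by apply: eq_integral => u /[!inE]/=; rewrite in_itv/= andbT => u0; exact: section_u.
rewrite ge0_integralZl//; last 3 first.
- apply: (@measurable_integral_dom _ _ _ _ _ (lebesgue_tuple R d) _ _ _ mo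
     (fun z => (K z.2 z.1)%:E)) => //.
    apply/measurable_EFinP/measurable_funTS.
    apply: (@measurableT_comp _ _ _ _ _ _ (fun z : Td * R => K z.1 z.2) _
      (fun z : R * Td => (z.2, z.1))); first exact: mK.
    exact: measurable_swap.
  by move=> z _; rewrite lee_fin.
- by move=> u _; apply: integral_ge0 => t _; rewrite lee_fin.
- by rewrite lee_fin exprn_ge0// invr_ge0 sqrtr_ge0.
congr (_ * _)%E.
rewrite -(@fubini_tonelli_dom _ _ _ _ _ (lebesgue_tuple R d) mu _ _ mo (@measurable_pos R)
  (fun z => (K z.1 z.2)%:E)); last 2 first.
- by apply/measurable_EFinP/measurable_funTS.
- by move=> z _; rewrite lee_fin.
transitivity (\int[lebesgue_tuple R d]_(t in @orthant R d)
   \int[mu]_(s in pos) (cone_density kappa tau s t)%:E)%E.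
  by apply: eq_integral => t /[!inE] ot; exact: section_t.
rewrite /cone_mass.
rewrite (@fubini_tonelli_dom _ _ _ _ _ (lebesgue_tuple R d) mu _ _ mo (@measurable_pos R)
  (fun z => (cone_density kappa tau z.2 z.1)%:E))//.
- apply/measurable_EFinP/measurable_funTS.
  apply: (@measurableT_comp _ _ _ _ _ _
    (fun z : R * Td => cone_density kappa tau z.1 z.2) _
    (fun z : Td * R => (z.2, z.1))); first exact: measurable_cone_density2.
  exact: measurable_swap.
- by move=> z _; rewrite lee_fin cone_density_ge0.
Qed.

End gamma_cone.

(** * Finiteness up to the ideal simplex *)

Section finiteness.
Context {R : realType}.
Notation mu := (@lebesgue_measure R).
Notation pos := (`]0, +oo[%classic : set R).
Variables (d : nat) (tau : 'I_d -> R).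
Hypotheses (d2 : (2 <= d)%N) (t0 : forall j, 0 < tau j).

Let p : R := d.+1%:R / 2.
Let p1 : 1 < p. Proof. by rewrite /p ltr_pdivlMr// mul1r ltr_nat. Qed.

Definition cone_to_volume : R := (Num.sqrt 2)^-1 ^+ d.-1 / Gamma p.

Lemma cone_to_volume_gt0 : 0 < cone_to_volume.
Proof. by rewrite divr_gt0 ?Gamma_gt0// exprn_gt0// invr_gt0 sqrtr_gt0. Qed.

Lemma open_simplex_volume (kappa : R) : (forall j, - (tau j ^+ 2) <= kappa) ->
  (\int[lebesgue_tuple R d]_(t in open_simplex tau) (vol_density kappa t)%:E =
   cone_to_volume%:E * cone_mass kappa tau)%E.
Proof.
move=> kt; have G0 := Gamma_gt0 p1.
rewrite /cone_to_volume mulrC EFinM -muleA -(Gamma_open_simplex d2 t0 kt).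
by rewrite muleA -EFinM mulVf ?mul1e// gt_eqF.
Qed.

Lemma open_simplex_measure_lty : (lebesgue_tuple R d (open_simplex tau) < +oo)%E.
Proof.
pose A j : set R := `[0, (tau j)^-1]%classic.
have mA j : measurable (A j) by exact: measurable_itv.
apply: (@le_lt_trans _ _ (lebesgue_tuple R d [set t | forall j, A j (tnth t j)])).
  apply: le_measure; rewrite ?inE.
  - exact: measurable_open_simplex.
  - exact: measurable_tuple_forall.
  - move=> t [ot t1] j; rewrite /A/= in_itv/= ltW ?ot//=.
    rewrite -[leRHS]mul1r ler_pdivlMr// mulrC (le_trans _ t1)//.
    rewrite /dotp (bigD1 j)//= lerDl sumr_ge0// => i _.
    by rewrite mulr_ge0// ltW// ot.
rewrite lebesgue_tuple_box// ltey_eq; apply/orP; left.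
apply: (big_ind (fun x : \bar R => x \is a fin_num)) => //.
  by move=> x y; exact: fin_numM.
move=> j _; rewrite /A lebesgue_measure_itv/=; by case: ifP.
Qed.

(** Above the critical curvature the density is bounded on the simplex, which
    has finite Lebesgue measure. *)
Lemma cone_mass_lty (ks kappa : R) : (forall j, - (tau j ^+ 2) <= ks) ->
  ks < kappa -> kappa < 0 -> (cone_mass kappa tau < +oo)%E.
Proof.
move=> kst ksk k0; have ks0 : ks < 0 by exact: lt_trans k0.
have kt j : - (tau j ^+ 2) <= kappa by rewrite (le_trans (kst j))// ltW.
pose b := 1 - kappa / ks.
have b0 : 0 < b by rewrite subr_gt0 ltr_ndivrMr// mul1r.
have mS := measurable_open_simplex tau.
have Voo : (\int[lebesgue_tuple R d]_(t in open_simplex tau) (vol_density kappa t)%:E < +oo)%E.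
  apply: (@le_lt_trans _ _ (\int[lebesgue_tuple R d]_(t in open_simplex tau)
      (cst (b `^ p)^-1%:E t))%E).
    apply: ge0_le_integral => //.
    - by move=> t _; rewrite lee_fin vol_density_ge0.
    - by apply/measurable_EFinP/measurable_funTS; exact: measurable_vol_density.
    - move=> t St; rewrite lee_fin /vol_density -/p.
      have q0 := open_simplex_gt0 d2 t0 kt St.
      rewrite lef_pV2 ?posrE ?powR_gt0// ge0_ler_powR ?nnegrE ?(ltW b0) ?(ltW q0)//.
        by rewrite (le_trans ler01)// ltW.
      have -> : b = 1 + kappa * sqn t - kappa / ks * (1 + ks * sqn t).
        by rewrite /b; field; rewrite lt_eqF.
      rewrite gerBl mulr_ge0 ?(ltW (open_simplex_gt0 d2 t0 kst St))//.
      by rewrite -mulrNN -invrN divr_ge0// oppr_ge0 ltW.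
  rewrite integral_cst// lte_mul_pinfty ?lee_fin ?invr_ge0 ?powR_ge0//.
  exact: open_simplex_measure_lty.
move: Voo; rewrite open_simplex_volume// => Voo.
rewrite ltNge leye_eq; apply/negP => /eqP koo.
by move: Voo; rewrite koo gt0_muley ?ltxx// lte_fin cone_to_volume_gt0.
Qed.

Hypothesis ed : ~~ odd d.

(** At the critical curvature the density is unbounded near ideal vertices.
    The formula for the larger curvatures bounds [cone_mass] uniformly, because
    its right-hand side stays bounded; monotone convergence transfers the bound
    to [ks]. *)
Lemma cone_mass_ideal_lty (ks : R) : (forall j, - (tau j ^+ 2) <= ks) ->
  ks < 0 -> (cone_mass ks tau < +oo)%E.
Proof.
move=> kst ks0.
(* curvatures decreasing to [ks]; starting at [ks / 2] keeps [k_ k ^+ d./2] away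
   from [0] *)
pose e_ (k : nat) : R := k.+2%:R^-1.
pose k_ k := ks * (1 - e_ k).
have e01 k : 0 < e_ k <= 2^-1.
  by rewrite invr_gt0 ltr0n/= lef_pV2 ?posrE// ler_nat.
have k_gt k : ks < k_ k.
  have /andP[e0 _] := e01 k.
  by rewrite /k_ -[ltLHS]mulr1 ltr_nM2l// gtrBl.
have k_lt k : k_ k <= ks / 2.
  have /andP[_ e1] := e01 k.
  rewrite /k_ ler_nM2l// lerBrDr -lerBrDl (le_trans e1)// [leRHS](_ : _ = 2^-1)//.
  by field.
have k_lt0 k : k_ k < 0 by rewrite (le_lt_trans (k_lt k))// pmulr_llt0.
have kt k j : - (tau j ^+ 2) <= k_ k by rewrite (le_trans (kst j))// ltW.
pose f k (z : R * d.-tuple R) : \bar R := (cone_density (k_ k) tau z.1 z.2)%:E.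
have massE kappa : cone_mass kappa tau = (\int[mu \x lebesgue_tuple R d]_(z in pos `*` @orthant R d)
    (cone_density kappa tau z.1 z.2)%:E)%E.
  rewrite integral_prod_dom//.
  - exact: measurable_orthant.
  - by apply/measurable_EFinP/measurable_funTS; exact: measurable_cone_density2.
  - by move=> z _; rewrite lee_fin cone_density_ge0.
have cv : cone_mass (k_ k) tau @[k --> \oo] --> cone_mass ks tau.
  have cvk : k_ k @[k --> \oo] --> ks.
    rewrite -[X in _ --> X]mulr1; apply: cvgMl_tmp; rewrite -[X in _ --> X]subr0.
    apply: cvgB; first exact: cvg_cst.
    by rewrite (cvg_shiftS (fun k => k.+1%:R^-1 : R)); exact: cvg_harmonic.
  rewrite massE; under eq_fun do rewrite massE.
  have -> : (\int[mu \x lebesgue_tuple R d]_(z in pos `*` @orthant R d)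
      (cone_density ks tau z.1 z.2)%:E =
     \int[mu \x lebesgue_tuple R d]_(z in pos `*` @orthant R d) limn (f ^~ z))%E.
    apply: eq_integral => z _; apply/esym/cvg_lim => //.
    apply: cvg_EFin; first exact: nearW.
    apply: cvgMr_tmp.
    have ck : - (k_ k * sqn z.2 / 2) @[k --> \oo] --> - (ks * sqn z.2 / 2).
      by apply: cvgN; apply: cvgMr_tmp; apply: cvgMr_tmp; exact: cvk.
    by apply: (cvg_comp _ _ ck); exact: continuous_expR.
  apply: cvg_monotone_convergence => //.
  - by apply: measurableX => //; exact: measurable_orthant.
  - move=> k; apply/measurable_EFinP/measurable_funTS; exact: measurable_cone_density2.
  - by move=> k z _; rewrite lee_fin cone_density_ge0.
  - move=> z _ k l kl; rewrite lee_fin ler_wpM2r ?hgauss_ge0// ler_expR lerN2.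
    rewrite ler_wpM2r// ler_wpM2r ?sqn_ge0// /k_ ler_nM2l// lerD2l lerN2.
    by rewrite lef_pV2 ?posrE// ler_nat !ltnS.
pose c : R := 2 / Num.sqrt (2 * pi).
pose I : R := \int[mu]_(y in pos) `|rho ks tau y|.
pose B : R := c * (Num.sqrt (pi / 2) ^+ d * (pi / 2) + I).
have c0 : 0 <= c by rewrite divr_ge0.
have irs : mu.-integrable pos (EFin \o rho ks tau) by exact: integrable_rho.
have valB k : `|cone_value (k_ k) tau| <= B.
  rewrite /cone_value normrM (ger0_norm c0) ler_wpM2l//.
  rewrite (le_trans (ler_normB _ _))// ger0_norm; last first.
    by rewrite mulr_ge0 ?divr_ge0 ?pi_ge0// exprn_ge0.
  rewrite lerD2l.
  have irk : mu.-integrable pos (EFin \o rho (k_ k) tau) by exact: integrable_rho.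
  rewrite (le_trans (le_normr_Rintegral _ irk))//.
  apply: le_Rintegral => //.
  - exact: (integrable_abse irk).
  - exact: (integrable_abse irs).
  - move=> y _; rewrite /rho normrM [leRHS]normrM ler_wpM2r//.
    rewrite !ger0_norm ?expR_ge0// ler_expR lerN2 ler_wpM2r// ler_wpM2r ?sqr_ge0//.
    by rewrite ltW.
pose M := B / (- ks / 2) ^+ d./2.
have massM k : (cone_mass (k_ k) tau <= M%:E)%E.
  have m0 : (0 <= cone_mass (k_ k) tau)%E.
    by apply: integral_ge0 => s _; apply: integral_ge0 => t _; rewrite lee_fin cone_density_ge0.
  have moo := cone_mass_lty kst (k_gt k) (k_lt0 k).
  have mfin : cone_mass (k_ k) tau \is a fin_num by rewrite ge0_fin_numE.
  have := cone_mass_continuation t0 ed (kt k) (ltW (k_lt0 k)) moo.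
  have := valB k; move=> + E; rewrite -E normrM normrX => H.
  rewrite -(fineK mfin) lee_fin /M ler_pdivlMr ?exprn_gt0 ?divr_gt0 ?oppr_gt0//.
  rewrite mulrC (le_trans _ H)// (ger0_norm (fine_ge0 m0)) ler_wpM2r ?fine_ge0//.
  apply: lerXn2r; rewrite ?nnegrE ?normr_ge0 ?divr_ge0 ?oppr_ge0 ?(ltW ks0)//.
  by rewrite ltr0_norm// mulNr lerN2.
rewrite -(cvg_lim _ cv)//; apply: (@le_lt_trans _ _ M%:E); last by rewrite ltry.
by apply: lime_le; [apply/cvg_ex; exists (cone_mass ks tau)|exact: nearW].
Qed.

Lemma cone_mass_identity (kappa : R) : (forall j, - (tau j ^+ 2) <= kappa) ->
  kappa != 0 -> cone_mass kappa tau \is a fin_num /\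
  kappa ^+ d./2 * fine (cone_mass kappa tau) = cone_value kappa tau.
Proof.
move=> kt; rewrite neq_lt => /orP[k0|k0]; last exact: cone_mass_pos.
have moo := cone_mass_ideal_lty kt k0; split.
  rewrite ge0_fin_numE//; apply: integral_ge0 => s _; apply: integral_ge0 => t _.
  by rewrite lee_fin cone_density_ge0.
exact: (cone_mass_continuation t0 ed kt (ltW k0)).
Qed.

End finiteness.

(** * The complex integrand and the volume formula *)

Section integrand.
Context {R : realType}.
Notation mu := (@lebesgue_measure R).
Notation pos := (`]0, +oo[%classic : set R).

Lemma gtransformN (x : R) : gtransform (- x) = (gtransform x)^*%C.
Proof.
rewrite /gtransform /= !cosgE /hgauss sqrrN; congr (_ +i* _).
rewrite /sing -mulN1r -RintegralZl//; last exact: integrable_hgauss_sin.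
by apply: eq_Rintegral => y _; rewrite mulNr sinN; ring.
Qed.

(** The factor [expR (x ^+ 2 / 2)] is the growth of [Phi] along the imaginary
    axis; multiplied over the coordinates it cancels the term
    [expR (- (\sum_j tau j ^+ 2) * y ^+ 2 / 2)] of the integrand. *)
Lemma Phi_gtransform (x : R) : Phi (0 +i* x) =
  (expR (x ^+ 2 / 2) / Num.sqrt (2 * pi))%:C * gtransform x.
Proof.
have r0 : 0 < Num.sqrt (pi / 2 : R) by rewrite sqrtr_gt0 divr_gt0// pi_gt0.
have rE : Num.sqrt (2 * pi) = 2 * Num.sqrt (pi / 2) :> R.
  rewrite (_ : 2 * pi = 2 ^+ 2 * (pi / 2)); last by field.
  by rewrite sqrtrM ?sqr_ge0// sqrtr_sqr ger0_norm.
have e0 := expR_gt0 (x ^+ 2 / 2).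
rewrite PhiE /gtransform cosgE /hgauss expRN rE.
apply/eqP; rewrite eq_complex /= !mul0r subr0 addr0.
by apply/andP; split; apply/eqP; field; rewrite !gt_eqF.
Qed.

Variables (d : nat) (tau : 'I_d -> R).

Let Q (y : R) : R := expR ((\sum_(j < d) tau j ^+ 2) * y ^+ 2 / 2) / Num.sqrt (2 * pi) ^+ d.

Lemma prod_Phi (y : R) :
  \prod_(j < d) Phi ('i%C * (tau j)%:C * y%:C) = (Q y)%:C * prodG tau y /\
  \prod_(j < d) Phi (- 'i%C * (tau j)%:C * y%:C) = (Q y)%:C * (prodG tau y)^*%C.
Proof.
have QE : \prod_(j < d) (expR ((tau j * y) ^+ 2 / 2) / Num.sqrt (2 * pi)) = Q y.
  rewrite big_split/= prodr_const card_ord exprVn /Q; congr (_ / _).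
  rewrite -expR_sum; congr expR; rewrite !mulr_suml.
  by apply: eq_bigr => j _; rewrite exprMn.
split.
  rewrite /prodG -QE rmorph_prod -big_split/=; apply: eq_bigr => j _.
  by rewrite -Phi_gtransform; congr Phi; simpc.
rewrite /prodG -QE (big_morph (@conjc R) (rmorphM (@conjc R)) (conjc1 R)) rmorph_prod.
rewrite -big_split; apply: eq_bigr => j _.
rewrite -gtransformN /= -[in expR _]sqrrN -Phi_gtransform; congr Phi; simpc.
by congr (_ +i* _); ring.
Qed.

(** The two products are complex conjugate, so their difference is purely
    imaginary. *)
Lemma integrandE (kappa y : R) : 0 < y ->
  (expR (- ((kappa + \sum_(j < d) tau j ^+ 2) * y ^+ 2 / 2)))%:C *
    (1 / y%:C) *
    (\prod_(j < d) Phi ('i%C * (tau j)%:C * y%:C) -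
     \prod_(j < d) Phi (- 'i%C * (tau j)%:C * y%:C)) =
  0 +i* (2 / Num.sqrt (2 * pi) ^+ d * rho kappa tau y).
Proof.
move=> y0; have [-> ->] := prod_Phi y.
rewrite -mulrBr.
have -> : prodG tau y - (prodG tau y)^*%C = 0 +i* (2 * complex.Im (prodG tau y)).
  case: (prodG tau y) => a b /=; apply/eqP; rewrite eq_complex/= subrr eqxx/=.
  by apply/eqP; ring.
have -> : 1 / y%:C = (y^-1)%:C :> R[i] by rewrite div1r fmorphV.
rewrite /rho /Q.
have -> : expR (- (kappa * y ^+ 2 / 2)) =
    expR (- ((kappa + \sum_(j < d) tau j ^+ 2) * y ^+ 2 / 2)) *
    expR ((\sum_(j < d) tau j ^+ 2) * y ^+ 2 / 2).
  by rewrite -expRD; congr expR; ring.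
by apply/eqP; rewrite eq_complex/=; apply/andP; split; apply/eqP; ring.
Qed.

End integrand.

Theorem theorem6p3 (R : realType) (d : nat) (kappa : R) (tau : 'I_d -> R)
    (d_ge2 : (2 <= d)%N) (d_even : ~~ odd d) (kappa_neq0 : kappa != 0)
    (tau_gt0 : forall j, 0 < tau j)
    (kappa_ge : forall j, - (tau j ^+ 2) <= kappa) :
  let V := riemannian_vol kappa (orthosimplex tau) in
  let F : R -> R[i] := fun y =>
    (expR (- ((kappa + \sum_(j < d) tau j ^+ 2) * y ^+ 2 / 2)))%:C *
    (1 / y%:C) *
    (\prod_(j < d) Phi ('i%C * (tau j)%:C * y%:C) -
     \prod_(j < d) Phi (- 'i%C * (tau j)%:C * y%:C)) in
  [/\ V \is a fin_num,
      cintegrable `]0, +oo[ F &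
      (fine V)%:C =
      (omega d.+1 / kappa ^+ (d./2))%:C *
      (1 / 2 ^+ d.+1 + 'i%C / (2 * pi)%:C * cintegral `]0, +oo[ F)].
Proof.
move=> V F.
pose a : R := 2 / Num.sqrt (2 * pi) ^+ d.
pose I : R := \int[@lebesgue_measure R]_(y in `]0, +oo[) rho kappa tau y.
have FE (y : R) : y \in (`]0, +oo[%classic : set R) -> F y = 0 +i* (a * rho kappa tau y).
  by rewrite inE/= in_itv/= andbT => y0; exact: integrandE.
have ir := integrable_rho d_even tau_gt0 kappa_ge.
have ReF : {in (`]0, +oo[%classic : set R), forall y, complex.Re (F y) = 0}.
  by move=> y /FE ->.
have ImF : {in (`]0, +oo[%classic : set R), forall y, complex.Im (F y) = a * rho kappa tau y}.
  by move=> y /FE ->.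
have [mfin mE] := cone_mass_identity d_ge2 tau_gt0 d_even kappa_ge kappa_neq0.
have VE : V = ((@cone_to_volume R d)%:E * cone_mass kappa tau)%E.
  by rewrite /V riemannian_volE// open_simplex_volume.
split.
- by rewrite VE fin_numM.
- split.
    apply: (eq_integrable (@measurable_pos R) (fun=> 0%E)); last exact: integrable0.
    by move=> y /ReF ->.
  apply: (eq_integrable (@measurable_pos R) (fun y => a%:E * (rho kappa tau y)%:E)%E).
    by move=> y /ImF ->.
  exact: (integrableZl (@measurable_pos R) a ir).
have -> : cintegral `]0, +oo[ F = 0 +i* (a * I).
  rewrite /cintegral; congr (_ +i* _).
    by under eq_Rintegral => y yD do rewrite (ReF _ yD); rewrite /Rintegral integral0.
  by under eq_Rintegral => y yD do rewrite (ImF _ yD); rewrite RintegralZl.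
have pi0 := pi_gt0 R.
have -> : 1 / 2 ^+ d.+1 + 'i%C / (2 * pi)%:C * (0 +i* (a * I)) =
    ((2 ^+ d.+1)^-1 - a * I / (2 * pi))%:C :> R[i].
  rewrite div1r -(rmorph_nat (real_complex R) 2) -rmorphXn -fmorphV -fmorphV.
  by apply/eqP; rewrite eq_complex/=; apply/andP; split; apply/eqP; ring.
rewrite -rmorphM; congr (_%:C).
rewrite VE fineM//=.
have kn0 : kappa ^+ d./2 != 0 by rewrite expf_neq0.
have -> : fine (cone_mass kappa tau) = cone_value kappa tau / kappa ^+ d./2.
  by rewrite -mE mulrC mulKf.
rewrite /cone_value -/I /cone_to_volume /omega /a.
have G0 : Gamma (d.+1%:R / 2) != 0 :> R.
  by rewrite gt_eqF// Gamma_gt0// ltr_pdivlMr// mul1r ltr_nat.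
have s20 : 0 < Num.sqrt (2 : R) by rewrite sqrtr_gt0.
have sp0 : 0 < Num.sqrt (pi : R) by rewrite sqrtr_gt0.
have sq2 : Num.sqrt (2 : R) ^+ 2 = 2 by rewrite sqr_sqrtr.
have sqp : pi = Num.sqrt (pi : R) ^+ 2 by rewrite sqr_sqrtr// ltW.
have -> : Num.sqrt (2 * pi) = Num.sqrt 2 * Num.sqrt pi :> R by rewrite sqrtrM.
have -> : Num.sqrt (pi / 2) = Num.sqrt pi / Num.sqrt 2 :> R.
  by rewrite sqrtrM ?(ltW pi0)// sqrtrV.
have -> : pi `^ (d.+1%:R / 2) = Num.sqrt pi ^+ d.+1 :> R.
  rewrite -powR12_sqrt ?(ltW pi0)// -powR_mulrn ?powR_ge0// -powRrM.
  by congr (_ `^ _); rewrite mulrC.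
(* with [pi] and [2] written as squares of [sp] and [s2], what remains is an
   identity of rational functions modulo [s2 ^+ 2 = 2] *)
move: s20 sp0 sq2 sqp G0 kn0; set s2 : R := Num.sqrt (2 : R).
set sp : R := Num.sqrt (pi : R); set G : R := Gamma _; set Kn : R := kappa ^+ _.
clearbody s2 sp G Kn => s20 sp0 sq2 sqp G0 kn0; rewrite !sqp.
have -> : d = d.-1.+1 by rewrite prednK// ltnW.
rewrite /= !expr_div_n !exprMn exprVn !exprS expr0 mulr1.
have -> : 2 ^+ d.-1 = (s2 ^+ d.-1) ^+ 2 :> R by rewrite -sq2 -!exprM mulnC.
have X0 : s2 ^+ d.-1 != 0 by rewrite expf_neq0// gt_eqF.
have Y0 : sp ^+ d.-1 != 0 by rewrite expf_neq0// gt_eqF.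
move: X0 Y0; set X : R := s2 ^+ d.-1; set Y : R := sp ^+ d.-1.
clearbody X Y => X0 Y0; have s2n := lt0r_neq0 s20; have spn := lt0r_neq0 sp0.
transitivity ((sp ^+ 2 * Y / (X ^+ 2 * s2 ^+ 2) - 2 * I / (s2 * sp * X)) / (G * Kn)).
  by field; rewrite s2n spn X0 G0 kn0.
by rewrite sq2; field; rewrite s2n spn X0 Y0 G0 kn0.
Qed.
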